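(* $$\mathsf{BIM}+\mathbf{\Pi}^0_1\text{-}\mathbf{AC}_{\omega,2}\vdash\mathbf{\Sigma}^0_1\text{-}\overleftarrow{\mathbf{AC}_{2,2^\omega}}\leftrightarrow\mathbf{FT}.$$ Here: $\mathbf{\Pi}^0_1\text{-}\mathbf{AC}_{\omega,2}$: $\forall\alpha[\forall n\exists m<2[(n,m)\notin E_\alpha]\rightarrow\exists\gamma\in2^\omega\forall n[(n,\gamma(n))\notin E_\alpha]]$; $\mathbf{\Sigma}^0_1\text{-}\overleftarrow{\mathbf{AC}_{2,2^\omega}}$: $\forall\alpha[\forall\gamma\in2^\omega\exists i<2[\gamma^{\upharpoonright i}\in\mathcal G_{\alpha^{\upharpoonright i}}]\rightarrow\exists i<2[2^\omega\subseteq\mathcal G_{\alpha^{\upharpoonright i}}]]$; $\mathbf{FT}$: $\forall \alpha[Bar_{2^\omega}(D_\alpha)\rightarrow\exists m[Bar_{2^\omega}(D_{\overline\alpha m})]]$.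
   Context: $\mathsf{BIM}$ (Basic Intuitionistic Mathematics) is the following two-sorted first-order theory with intuitionistic logic and equality. Numerical variables $m,n,p,\ldots$ range over $\omega=\{0,1,2,\ldots\}$; function variables $\alpha,\beta,\gamma,\ldots$ range over the set $\omega^\omega$ of infinite sequences of natural numbers. There are a numerical constant $0$, unary function constants $Id,\underline 0,S,K,L$ and a binary function symbol $J$; numerical terms are built from numerical variables and $0$ by applying function symbols and function variables. Axioms: (1) $\forall\alpha\forall\beta[\alpha=\beta\leftrightarrow\forall n[\alpha(n)=\beta(n)]]$; (2) $Id(n)=n$, $S(n)\neq 0$, $S(m)=S(n)\rightarrow m=n$, $\underline 0(n)=0$, $K(J(m,n))=m$, $L(J(m,n))=n$, $J(K(n),L(n))=n$; (3) $\forall\alpha\forall\beta\exists\gamma\forall n[\gamma(n)=\alpha(\beta(n))]$, $\forall\alpha\forall\beta\exists\gamma\forall n[\gamma(n)=J(\alpha(n),\beta(n))]$, $\forall\alpha\forall\beta\exists\gamma\forall m\forall n[\gamma(m,0)=\alpha(m)\wedge\gamma(m,S(n))=\beta(m,n,\gamma(m,n))]$, $\forall\alpha[\forall n\exists m[\alpha(n,m)=0]\rightarrow\exists\gamma\forall n[\alpha(n,\gamma(n))=0]]$; (4) induction for all formulas of the language. Here $(m,n):=J(m,n)$, $\alpha(m,n):=\alpha(J(m,n))$, $\alpha(m,n,p):=\alpha(J(J(m,n),p))$, $n':=K(n)$, $n'':=L(n)$. $\mathsf{BIM}$ is tacitly extended (conservatively) by symbols and defining equations for all primitive recursive functions and relations.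 Subsets of $\omega$ and $\omega^\omega$ are given by formulas; set notation is an abbreviation. $\vdash$ denotes derivability. Finite sequences are coded by natural numbers: $\langle\,\rangle=0$, $\langle m_0,\ldots,m_{k-1}\rangle=p(k-1)\cdot\prod_{i<k}p(i)^{m_i}-1$ for $k>0$ ($p(0)=2,p(1)=3,\ldots$ the primes); every number codes exactly one finite sequence. $length(s)$ is the length of the sequence coded by $s$ and $s(i)$ its $i$-th entry ($s(i)=0$ if $i\ge length(s)$); $s\ast t$ is concatenation. $\overline\alpha n=\langle\alpha(0),\ldots,\alpha(n-1)\rangle$. $2^\omega=\{\gamma\mid\forall n[\gamma(n)<2]\}$. $\alpha^{\upharpoonright n}(m)=\alpha(\langle n\rangle\ast m)$ for all $m$. $D_\alpha=\{i\mid\alpha(i)\neq0\}$; for a number $a$, $D_a=\{i<length(a)\mid a(i)\neq0\}$. $E_\alpha=\{n\mid\exists p[\alpha(p)=n+1]\}$. $\mathcal G_\alpha=\{\gamma\mid\exists n[\alpha(\overline\gamma n)\neq0]\}$. $Bar_{\mathcal X}(B)$ means $\forall\gamma\in\mathcal X\exists n[\overline\gamma n\in B]$. *)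

(* Defs.v *)
From Stdlib Require Import List.
Import ListNotations.

(** * Syntax of BIM

    Two-sorted de Bruijn syntax: number variables and function variables have
    separate index spaces.  [AllN]/[ExN] bind a number variable and
    [AllF]/[ExF] a function variable. *)

(** Function constants: BIM's own [Id], [0], [S], [K], [L], together with the
    symbols for all primitive recursive functions.  The three constructors
    [PComp], [PPair], [PRec] follow the closure properties of BIM's third
    axiom group; as there, a function of several arguments is a function of one
    argument through [f(m,n) := f(J(m,n))], [f(m,n,p) := f(J(J(m,n),p))].
    A primitive recursive relation is given by a primitive recursive
    characteristic function. *)
Inductive pr : Type :=
| PId | PZero | PSucc | PK | PL
| PComp (f g : pr)    (* n     |-> f(g(n)) *)
| PPair (f g : pr)    (* n     |-> J(f(n),g(n)) *)
| PRec (f g : pr).    (* (m,0) |-> f(m),  (m,S n) |-> g(m,n,PRec f g (m,n)) *)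

Inductive fterm : Type :=
| fvar (n : nat)
| fcst (c : pr).

Inductive term : Type :=
| tvar (n : nat)
| tzero
| tapp (f : fterm) (t : term)
| tJ (t u : term).

Inductive form : Type :=
| Bot
| EqN (t u : term)
| EqF (f g : fterm)
| And (A B : form)
| Or (A B : form)
| Imp (A B : form)
| AllN (A : form)
| ExN (A : form)
| AllF (A : form)
| ExF (A : form).

Definition Iff (A B : form) : form := And (Imp A B) (Imp B A).

(** ** Simultaneous substitution *)

Definition fsubst (tau : nat -> fterm) (f : fterm) : fterm :=
  match f with fvar n => tau n | fcst c => fcst c end.

Fixpoint tsubst (sigma : nat -> term) (tau : nat -> fterm) (t : term) : term :=
  match t with
  | tvar n => sigma n
  | tzero => tzero
  | tapp f u => tapp (fsubst tau f) (tsubst sigma tau u)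
  | tJ u v => tJ (tsubst sigma tau u) (tsubst sigma tau v)
  end.

Definition scons {X : Type} (x : X) (s : nat -> X) (n : nat) : X :=
  match n with 0 => x | S k => s k end.

Definition shiftN (n : nat) : term := tvar (S n).
Definition shiftF (n : nat) : fterm := fvar (S n).

(** Function terms contain no number variables, so passing a number quantifier
    leaves the function part of a substitution unchanged. *)
Definition upN (sigma : nat -> term) : nat -> term :=
  scons (tvar 0) (fun n => tsubst shiftN fvar (sigma n)).
Definition upF_term (sigma : nat -> term) : nat -> term :=
  fun n => tsubst tvar shiftF (sigma n).
Definition upF (tau : nat -> fterm) : nat -> fterm :=
  scons (fvar 0) (fun n => fsubst shiftF (tau n)).

Fixpoint subst (sigma : nat -> term) (tau : nat -> fterm) (A : form) : form :=
  match A with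
  | Bot => Bot
  | EqN t u => EqN (tsubst sigma tau t) (tsubst sigma tau u)
  | EqF f g => EqF (fsubst tau f) (fsubst tau g)
  | And A B => And (subst sigma tau A) (subst sigma tau B)
  | Or A B => Or (subst sigma tau A) (subst sigma tau B)
  | Imp A B => Imp (subst sigma tau A) (subst sigma tau B)
  | AllN A => AllN (subst (upN sigma) tau A)
  | ExN A => ExN (subst (upN sigma) tau A)
  | AllF A => AllF (subst (upF_term sigma) (upF tau) A)
  | ExF A => ExF (subst (upF_term sigma) (upF tau) A)
  end.

Definition instN (t : term) (A : form) : form := subst (scons t tvar) fvar A.
Definition instF (f : fterm) (A : form) : form := subst tvar (scons f fvar) A.
Definition liftN (A : form) : form := subst shiftN fvar A.
Definition liftF (A : form) : form := subst tvar shiftF A.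

(** * Intuitionistic natural deduction with equality

    The axioms [T] are not lifted in the eigenvariable rules: an open axiom
    stands for its universal closure. *)
Inductive prv (T : form -> Prop) : list form -> form -> Prop :=
| prv_ax G A : T A -> prv T G A
| prv_hyp G A : In A G -> prv T G A
| prv_botE G A : prv T G Bot -> prv T G A
| prv_andI G A B : prv T G A -> prv T G B -> prv T G (And A B)
| prv_andE1 G A B : prv T G (And A B) -> prv T G A
| prv_andE2 G A B : prv T G (And A B) -> prv T G B
| prv_orI1 G A B : prv T G A -> prv T G (Or A B)
| prv_orI2 G A B : prv T G B -> prv T G (Or A B)
| prv_orE G A B C :
    prv T G (Or A B) -> prv T (A :: G) C -> prv T (B :: G) C -> prv T G C
| prv_impI G A B : prv T (A :: G) B -> prv T G (Imp A B)
| prv_impE G A B : prv T G (Imp A B) -> prv T G A -> prv T G B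
| prv_allNI G A : prv T (map liftN G) A -> prv T G (AllN A)
| prv_allNE G A t : prv T G (AllN A) -> prv T G (instN t A)
| prv_exNI G A t : prv T G (instN t A) -> prv T G (ExN A)
| prv_exNE G A C :
    prv T G (ExN A) -> prv T (A :: map liftN G) (liftN C) -> prv T G C
| prv_allFI G A : prv T (map liftF G) A -> prv T G (AllF A)
| prv_allFE G A f : prv T G (AllF A) -> prv T G (instF f A)
| prv_exFI G A f : prv T G (instF f A) -> prv T G (ExF A)
| prv_exFE G A C :
    prv T G (ExF A) -> prv T (A :: map liftF G) (liftF C) -> prv T G C
| prv_eqN_refl G t : prv T G (EqN t t)
| prv_eqN_subst G A t u :
    prv T G (EqN t u) -> prv T G (instN t A) -> prv T G (instN u A)
| prv_eqF_refl G f : prv T G (EqF f f)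
| prv_eqF_subst G A f g :
    prv T G (EqF f g) -> prv T G (instF f A) -> prv T G (instF g A).

Definition derivable (T : form -> Prop) (A : form) : Prop := prv T [] A.

(** * Primitive recursive functions *)

(** [c2 f a b] is [n |-> f(a(n), b(n))].  In the body of a recursion, which is
    applied to [(m,n,r) = J(J(m,n),r)], the arguments [m], [n] and [r] are
    [arg_m], [arg_n] and [PL]. *)
Definition c2 (f a b : pr) : pr := PComp f (PPair a b).
Definition arg_m : pr := PComp PK PK.
Definition arg_n : pr := PComp PL PK.

Definition c_one : pr := PComp PSucc PZero.

(** [n |-> if c(n) = 0 then a(n) else b(n)] *)
Definition c_ifz (c a b : pr) : pr :=
  PComp (PRec a (PComp b arg_m)) (PPair PId c).

Definition c_pred : pr := PComp (PRec PZero arg_n) (PPair PZero PId).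
Definition c_add : pr := PRec PId (PComp PSucc PL).
Definition c_monus : pr := PRec PId (PComp c_pred PL).
Definition c_mul : pr := PRec PZero (c2 c_add PL arg_m).
Definition c_exp : pr := PRec c_one (c2 c_mul PL arg_m).
Definition c_fact : pr :=
  PComp (PRec c_one (c2 c_mul (PComp PSucc arg_n) PL)) (PPair PZero PId).

(** [(m,k) |-> prod_(i<k) f(m,i)] *)
Definition c_prod (f : pr) : pr := PRec c_one (c2 c_mul PL (PComp f PK)).

(** [(m,k) |->] the least [i < k] such that [f(m,i) = 0], or [k] if there is
    none. *)
Definition c_search (f : pr) : pr :=
  PRec PZero (c_ifz (c2 f arg_m PL) PL (PComp PSucc PL)).

(** [(x,d) |->] the least [q] such that [x < d * (q + 1)] (for [d > 0]). *)
Definition c_quot : pr :=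
  c2 (c_search (c2 c_monus (PComp PSucc arg_m) (c2 c_mul arg_n (PComp PSucc PL))))
     PId PK.
Definition c_rem : pr := c2 c_monus PK (c2 c_mul PL c_quot).

(** The least divisor [>= 2] of [q], for [q >= 2]. *)
Definition c_lpf : pr :=
  PComp PSucc (PComp PSucc
    (c2 (c_search (c2 c_rem PK (PComp PSucc (PComp PSucc PL)))) PId PId)).
(** [0] exactly at the primes; [c_lpf] exceeds its argument at [0] and [1]. *)
Definition c_notprime : pr :=
  c2 c_add (c2 c_monus c_lpf PId) (c2 c_monus PId c_lpf).
(** The least prime [> q], searched for up to [q + 1 + q!]. *)
Definition c_nextprime : pr :=
  c2 c_add PSucc
    (c2 (c_search (PComp c_notprime (c2 c_add (PComp PSucc PK) PL))) PId c_fact).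
(** [n |-> p(n)], with [p(0) = 2], [p(1) = 3], and so on *)
Definition c_prime : pr :=
  PComp (PRec (PComp PSucc c_one) (PComp c_nextprime PL)) (PPair PZero PId).

(** [(q,x) |->] the exponent of [q] in [x] (for [q >= 2], [x > 0]). *)
Definition c_val : pr :=
  c2 (c_search (c_ifz (c2 c_rem arg_n (c2 c_exp arg_m (PComp PSucc PL))) c_one PZero))
     PId PL.

(** The sequence coded by [s]: since
    [s + 1 = p(k-1) * prod_(i<k) p(i)^(m_i)], its length [k] is [i + 1] for the
    largest [i] such that [p(i)] divides [s + 1], and is [0] for [s = 0]. *)
Definition c_length : pr :=
  c2 (PRec PZero
        (c_ifz (c2 c_rem (PComp PSucc arg_m) (PComp c_prime arg_n))
               (PComp PSucc arg_n) PL))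
     PId PId.
(** [(s,i) |-> s(i)]: the exponent of [p(i)] in [s + 1], less one if
    [i + 1 = length(s)].  If [i >= length(s)] that exponent is [0], so the test
    may be [length(s) <= i + 1]. *)
Definition c_entry : pr :=
  let v := c2 c_val (PComp c_prime PL) (PComp PSucc PK) in
  c_ifz (c2 c_monus (PComp c_length PK) (PComp PSucc PL)) (PComp c_pred v) v.

(** [(m,k) |-> <f(m,0), ..., f(m,k-1)>] *)
Definition c_code (f : pr) : pr :=
  c_ifz PL PZero
    (PComp c_pred
       (c2 c_mul (PComp c_prime (PComp c_pred PL))
                 (c_prod (c2 c_exp (PComp c_prime PL) f)))).
Definition c_sing : pr := c2 (c_code PK) PId c_one.
Definition c_cat : pr :=
  let s := arg_m in let t := arg_n in
  let i := PL in let k := PComp c_length s in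
  c2 (c_code (c_ifz (c2 c_monus (PComp PSucc i) k)
                    (c2 c_entry s i)
                    (c2 c_entry t (c2 c_monus i k))))
     PId
     (c2 c_add (PComp c_length PK) (PComp c_length PL)).

(** * Writing formulas with named bound variables

    [num], [fn] and [fm] are terms, function terms and formulas that depend on
    the numbers [dn], [df] of enclosing number and function quantifiers.  A
    bound variable computes its de Bruijn index from the depth at which it is
    used, so no explicit lifting is needed. *)
Definition num : Type := nat -> nat -> term.
Definition fn : Type := nat -> nat -> fterm.
Definition fm : Type := nat -> nat -> form.

Definition close (P : fm) : form := P 0 0.

Definition zero : num := fun _ _ => tzero.
Definition app (f : fn) (t : num) : num := fun dn df => tapp (f dn df) (t dn df).
Definition J (t u : num) : num := fun dn df => tJ (t dn df) (u dn df).
Definition cst (c : pr) : fn := fun _ _ => fcst c.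

Definition fBot : fm := fun _ _ => Bot.
Definition eqN (t u : num) : fm := fun dn df => EqN (t dn df) (u dn df).
Definition eqF (f g : fn) : fm := fun dn df => EqF (f dn df) (g dn df).
Definition fAnd (P Q : fm) : fm := fun dn df => And (P dn df) (Q dn df).
Definition fImp (P Q : fm) : fm := fun dn df => Imp (P dn df) (Q dn df).
Definition fIff (P Q : fm) : fm := fAnd (fImp P Q) (fImp Q P).
Definition fNeg (P : fm) : fm := fImp P fBot.

Definition bvarN (dn : nat) : num := fun dn' _ => tvar (dn' - S dn).
Definition bvarF (df : nat) : fn := fun _ df' => fvar (df' - S df).

Definition allN (P : num -> fm) : fm := fun dn df => AllN (P (bvarN dn) (S dn) df).
Definition exN (P : num -> fm) : fm := fun dn df => ExN (P (bvarN dn) (S dn) df).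
Definition allF (P : fn -> fm) : fm := fun dn df => AllF (P (bvarF df) dn (S df)).
Definition exF (P : fn -> fm) : fm := fun dn df => ExF (P (bvarF df) dn (S df)).

Declare Scope bim_scope.
Delimit Scope bim_scope with bim.
Bind Scope bim_scope with num fn fm.
Local Open Scope bim_scope.

Definition ltN (t u : num) : fm :=
  eqN (app (cst c_monus) (J (app (cst PSucc) t) u)) zero.

(** The notations are confined to a module because several of them would clash
    with notations of other libraries. *)
Module BIMNotations.
Notation "f @ t" := (app f t) (at level 11, left associativity) : bim_scope.
Notation "t == u" := (eqN t u) (at level 70, no associativity) : bim_scope.
Notation "t != u" := (fNeg (eqN t u)) (at level 70, no associativity) : bim_scope.
Notation "f =f= g" := (eqF f g) (at level 70, no associativity) : bim_scope.
Notation "P & Q" := (fAnd P Q) (at level 80, right associativity) : bim_scope.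
Notation "P ==> Q" := (fImp P Q) (at level 90, right associativity) : bim_scope.
Notation "P <==> Q" := (fIff P Q) (at level 95, no associativity) : bim_scope.
Notation "'AN' x , P" := (allN (fun x : num => P%bim))
  (at level 200, x name, right associativity) : bim_scope.
Notation "'EN' x , P" := (exN (fun x : num => P%bim))
  (at level 200, x name, right associativity) : bim_scope.
Notation "'AF' x , P" := (allF (fun x : fn => P%bim))
  (at level 200, x name, right associativity) : bim_scope.
Notation "'EF' x , P" := (exF (fun x : fn => P%bim))
  (at level 200, x name, right associativity) : bim_scope.
Notation "t < u" := (ltN t u) (at level 70, no associativity) : bim_scope.
End BIMNotations.
Import BIMNotations.

Definition Succ (t : num) : num := (cst PSucc) @ t.
Definition one : num := Succ zero.
Definition two : num := Succ one.

(** * The axioms of BIM *)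

Definition ax_ext : fm :=
  AF a, AF b, a =f= b <==> AN n, a @ n == b @ n.

Definition ax_Id : fm := AN n, (cst PId) @ n == n.
Definition ax_S_neq_0 : fm := AN n, Succ n != zero.
Definition ax_S_inj : fm := AN m, AN n, Succ m == Succ n ==> m == n.
Definition ax_Zero : fm := AN n, (cst PZero) @ n == zero.
Definition ax_K : fm := AN m, AN n, (cst PK) @ (J m n) == m.
Definition ax_L : fm := AN m, AN n, (cst PL) @ (J m n) == n.
Definition ax_J : fm := AN n, J ((cst PK) @ n) ((cst PL) @ n) == n.

Definition ax_comp : fm :=
  AF a, AF b, EF c, AN n, c @ n == a @ (b @ n).
Definition ax_pair : fm :=
  AF a, AF b, EF c, AN n, c @ n == J (a @ n) (b @ n).
Definition ax_rec : fm :=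
  AF a, AF b, EF c, AN m, AN n,
    c @ (J m zero) == a @ m &
    c @ (J m (Succ n)) == b @ (J (J m n) (c @ (J m n))).
Definition ax_choice : fm :=
  AF a, (AN n, EN m, a @ (J n m) == zero) ==>
        EF c, AN n, a @ (J n (c @ n)) == zero.

(** Defining equations of the symbols for primitive recursive functions. *)
Definition def_comp (f g : pr) : fm :=
  AN n, (cst (PComp f g)) @ n == (cst f) @ ((cst g) @ n).
Definition def_pair (f g : pr) : fm :=
  AN n, (cst (PPair f g)) @ n == J ((cst f) @ n) ((cst g) @ n).
Definition def_rec (f g : pr) : fm :=
  AN m, AN n,
    (cst (PRec f g)) @ (J m zero) == (cst f) @ m &
    (cst (PRec f g)) @ (J m (Succ n)) ==
      (cst g) @ (J (J m n) ((cst (PRec f g)) @ (J m n))).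

(** Induction on number variable 0 of [A]; the other free variables of [A] are
    parameters. *)
Definition ax_ind (A : form) : form :=
  Imp (instN tzero A)
    (Imp (AllN (Imp A (subst (scons (tapp (fcst PSucc) (tvar 0)) shiftN) fvar A)))
       (AllN A)).

Inductive BIM : form -> Prop :=
| BIM_ax_ext : BIM (close ax_ext)
| BIM_ax_Id : BIM (close ax_Id)
| BIM_ax_S_neq_0 : BIM (close ax_S_neq_0)
| BIM_ax_S_inj : BIM (close ax_S_inj)
| BIM_ax_Zero : BIM (close ax_Zero)
| BIM_ax_K : BIM (close ax_K)
| BIM_ax_L : BIM (close ax_L)
| BIM_ax_J : BIM (close ax_J)
| BIM_ax_comp : BIM (close ax_comp)
| BIM_ax_pair : BIM (close ax_pair)
| BIM_ax_rec : BIM (close ax_rec)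
| BIM_ax_choice : BIM (close ax_choice)
| BIM_ax_def_comp f g : BIM (close (def_comp f g))
| BIM_ax_def_pair f g : BIM (close (def_pair f g))
| BIM_ax_def_rec f g : BIM (close (def_rec f g))
| BIM_ax_ind A : BIM (ax_ind A).

(** * Sets and abbreviations *)

Definition len (s : num) : num := (cst c_length) @ s.
Definition entry (s i : num) : num := (cst c_entry) @ (J s i).
Definition sing (m : num) : num := (cst c_sing) @ m.
Definition cat (s t : num) : num := (cst c_cat) @ (J s t).

Definition exlt (b : num) (P : num -> fm) : fm := EN m, m < b & P m.
Definition alllt (b : num) (P : num -> fm) : fm := AN m, m < b ==> P m.

Definition Cantor (c : fn) : fm := AN n, c @ n < two.
Definition all_in (X : fn -> fm) (P : fn -> fm) : fm := AF c, X c ==> P c.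
Definition ex_in (X : fn -> fm) (P : fn -> fm) : fm := EF c, X c & P c.

(** The initial segment of [a] of length [n] and the sequence
    [m |-> a(<n> * m)] are not terms of the language.  A formula [P] in which
    one of them occurs abbreviates a formula saying that [P] holds of the object
    with the appropriate defining property, which BIM proves to exist and to be
    unique. *)
Definition with_init (a : fn) (n : num) (P : num -> fm) : fm :=
  EN s, (len s == n & alllt n (fun i => entry s i == a @ i)) & P s.
Definition with_sub (a : fn) (n : num) (P : fn -> fm) : fm :=
  EF b, (AN m, b @ m == a @ (cat (sing n) m)) & P b.

Definition inD_fn (a : fn) (i : num) : fm := a @ i != zero.
Definition inD_num (a : num) (i : num) : fm := i < len a & entry a i != zero.
Definition inE (a : fn) (n : num) : fm := EN p, a @ p == Succ n.
Definition inG (a : fn) (c : fn) : fm := EN n, with_init c n (fun s => a @ s != zero).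

Definition Bar (X : fn -> fm) (B : num -> fm) : fm :=
  all_in X (fun c => EN n, with_init c n B).

(** * The principles *)

Definition Pi01_AC_omega_2 : form := close
  (AF a, (AN n, exlt two (fun m => fNeg (inE a (J n m)))) ==>
         ex_in Cantor (fun c => AN n, fNeg (inE a (J n (c @ n))))).

Definition Sigma01_revAC_2_Cantor : form := close
  (AF a,
     all_in Cantor (fun c => exlt two (fun i =>
       with_sub c i (fun ci => with_sub a i (fun ai => inG ai ci)))) ==>
     exlt two (fun i =>
       with_sub a i (fun ai => all_in Cantor (fun c => inG ai c)))).

Definition FT : form := close
  (AF a, Bar Cantor (inD_fn a) ==>
         EN m, with_init a m (fun b => Bar Cantor (inD_num b))).

Definition BIM_Pi01_AC (A : form) : Prop := BIM A \/ A = Pi01_AC_omega_2.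

(* Main.v *)
From Stdlib Require Import List PeanoNat Lia Setoid Morphisms Ring Cantor.
From Stdlib Require Import FunctionalExtensionality PropExtensionality ProofIrrelevance.
From Stdlib Require Import Classical ClassicalEpsilon.
Require Import Defs.
Import ListNotations.

(** The mathematical argument has two directions.

    From the fan theorem to the contraposed choice principle.  Let [al0], [al1] be the two
    subsequences of [al].  An initial segment [x] of a binary [c] is marked if it already
    shows that one of the two subsequences [c0], [c1] of [c] meets the bar given by the
    corresponding [al_i].  The hypothesis says that the marked segments form a bar, so the
    fan theorem gives a bound [m] for their codes.  Then one of [al0], [al1] is met by all
    binary sequences within [m] steps, which is decidable: otherwise two sequences of length
    [m] that miss them are the subsequences of one [c], and no marked segment of [c] has a
    code below [m].

    From the contraposed choice principle to the fan theorem.  Let [al] be a bar in Cantor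
    space.  Call [q] secured at stage [k] if all binary sequences compatible with [q] meet
    [al] within [k] steps ([Sec]), and call its [i]-th successor ahead at stage [k] if at
    that stage it is secured but neither the other successor nor the empty sequence is
    ([Ahead]).  One of the two successors is never ahead, as securing persists, but
    constructively one cannot tell which.  The contraposed principle can: let the [i]-th bar
    consist of those [u] in [al] for which the [i]-th successor has not been ahead up to
    stage [length(u)].  A pair of binary sequences always meets one of the two bars, so one
    of the bars is met by all binary sequences, say the [i]-th; and if the [i]-th successor
    were ahead at stage [k], a sequence of length [k] witnessing that the empty sequence is
    not secured, continued by zeros, would miss it ([ahead_dead]).  So for each [q] there is
    an [i] such that the [i]-th successor of [q] is never ahead, and choice for binary
    numbers yields a function [ga] picking such an [i].  Following [ga] from the empty
    sequence one reaches the bar at some stage [n].  Going back along the path, if the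
    successor chosen by [ga] is secured at stage [n] then, not being ahead, it has a secured
    sibling unless the empty sequence is secured; so the empty sequence is secured at stage
    [n] ([sec_step]), and this bounds the bar.

    The rest makes derivations out of these arguments.  Derivability coincides with a
    forcing relation whose conditions are contexts ([force_prv]), so that quantifiers and
    implications of the calculus become those of the metalanguage, and disjunctions and
    existence statements may be opened whenever the goal is itself a forced formula.
    Everything about codes of finite sequences, prime factorization included, is
    quantifier-free once bounded quantifiers are replaced by primitive recursive functions.
    By decidability, such statements are derivable as soon as they hold in all classical
    structures for primitive recursive arithmetic ([transfer]).  The bar enters these
    statements through a number [a] coding a sufficiently long initial segment of it. *)

(** * Substitution and eigenvariables *)

Lemma tsubst_comp s' t' s t u :
  tsubst s' t' (tsubst s t u)
  = tsubst (fun n => tsubst s' t' (s n)) (fun n => fsubst t' (t n)) u.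
Proof.
  induction u as [n| |f u IH|u IHu v IHv]; cbn; trivial.
  - rewrite IH. destruct f; reflexivity.
  - now rewrite IHu, IHv.
Qed.

Lemma tsubst_id u : tsubst tvar fvar u = u.
Proof.
  induction u as [n| |f u IH|u IHu v IHv]; cbn; trivial.
  - rewrite IH. destruct f; reflexivity.
  - now rewrite IHu, IHv.
Qed.

Lemma fsubst_comp t' t f :
  fsubst t' (fsubst t f) = fsubst (fun n => fsubst t' (t n)) f.
Proof. destruct f; reflexivity. Qed.

Lemma fsubst_id f : fsubst fvar f = f.
Proof. destruct f; reflexivity. Qed.

Lemma subst_comp A : forall s' t' s t,
  subst s' t' (subst s t A)
  = subst (fun n => tsubst s' t' (s n)) (fun n => fsubst t' (t n)) A.
Proof.
  assert (upN_comp : forall s' t' s,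
    (fun n => tsubst (upN s') t' (upN s n)) = upN (fun n => tsubst s' t' (s n))).
  { intros s' t' s. extensionality n. destruct n; cbn; trivial.
    rewrite !tsubst_comp. f_equal. extensionality k. symmetry. apply fsubst_id. }
  assert (upF_comp : forall s' t' s t,
    (fun n => tsubst (upF_term s') (upF t') (upF_term s n))
      = upF_term (fun n => tsubst s' t' (s n)) /\
    (fun n => fsubst (upF t') (upF t n)) = upF (fun n => fsubst t' (t n))).
  { intros s' t' s t; split; extensionality n.
    - unfold upF_term. rewrite !tsubst_comp. f_equal.
    - destruct n; cbn; trivial. rewrite !fsubst_comp. reflexivity. }
  induction A; intros; cbn; trivial;
    rewrite ?tsubst_comp, ?fsubst_comp, ?IHA1, ?IHA2, ?IHA; trivial.
  - f_equal. now rewrite (upN_comp s' t' s).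
  - f_equal. now rewrite (upN_comp s' t' s).
  - f_equal. destruct (upF_comp s' t' s t) as [-> ->]. reflexivity.
  - f_equal. destruct (upF_comp s' t' s t) as [-> ->]. reflexivity.
Qed.

Lemma subst_id A : subst tvar fvar A = A.
Proof.
  assert (eN : upN tvar = tvar) by (extensionality n; destruct n; reflexivity).
  assert (eF : upF fvar = fvar) by (extensionality n; destruct n; reflexivity).
  assert (eT : upF_term tvar = tvar) by reflexivity.
  induction A; cbn; rewrite ?tsubst_id, ?fsubst_id, ?eN, ?eF, ?eT; congruence.
Qed.

Lemma subst_instN s t u A :
  instN u (subst (upN s) t A) = subst (scons u s) t A.
Proof.
  unfold instN. rewrite subst_comp. f_equal; extensionality n.
  - destruct n; cbn; trivial. rewrite tsubst_comp. apply tsubst_id.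
  - apply fsubst_id.
Qed.

Lemma subst_instF s t f A :
  instF f (subst (upF_term s) (upF t) A) = subst s (scons f t) A.
Proof.
  unfold instF. rewrite subst_comp. f_equal; extensionality n.
  - unfold upF_term. rewrite tsubst_comp. apply tsubst_id.
  - destruct n; cbn; trivial. rewrite fsubst_comp. apply fsubst_id.
Qed.

Lemma instN_subst s t u A :
  subst s t (instN u A) = instN (tsubst s t u) (subst (upN s) t A).
Proof.
  rewrite subst_instN. unfold instN. rewrite subst_comp. f_equal; extensionality n.
  destruct n; reflexivity.
Qed.

Lemma instF_subst s t f A :
  subst s t (instF f A) = instF (fsubst t f) (subst (upF_term s) (upF t) A).
Proof.
  rewrite subst_instF. unfold instF. rewrite subst_comp. f_equal; extensionality n.
  destruct n; reflexivity.
Qed.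

Lemma liftN_subst s t A : subst (upN s) t (liftN A) = liftN (subst s t A).
Proof.
  unfold liftN. rewrite !subst_comp. f_equal; extensionality n. symmetry. apply fsubst_id.
Qed.

Lemma liftF_subst s t A :
  subst (upF_term s) (upF t) (liftF A) = liftF (subst s t A).
Proof. unfold liftF. rewrite !subst_comp. f_equal. Qed.

Local Notation Th := BIM_Pi01_AC.

Lemma axiom_subst s t A : Th A -> Th (subst s t A).
Proof.
  intros [H| -> ]; [|right; reflexivity].
  left; destruct H; try constructor.
  assert (E : ax_ind (subst (upN s) t A) = subst s t (ax_ind A));
    [|rewrite <- E; constructor].
  unfold ax_ind; cbn. rewrite instN_subst, !subst_comp. cbn.
  match goal with |- Imp _ (Imp (AllN (Imp _ ?x)) _) = Imp _ (Imp (AllN (Imp _ ?y)) _) =>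
    enough (E : x = y) by now rewrite E end.
  f_equal; extensionality n; [|apply fsubst_id].
  destruct n; cbn; trivial. rewrite tsubst_comp. reflexivity.
Qed.

(** The calculus has no substitution rule; it is admissible because the axiom
    set, whose only open members are instances of induction, is stable. *)
Lemma prv_subst G A : prv Th G A ->
  forall s t, prv Th (map (subst s t) G) (subst s t A).
Proof.
  assert (mN : forall s t G, map (subst (upN s) t) (map liftN G)
                             = map liftN (map (subst s t) G)).
  { intros. rewrite !map_map. apply map_ext. intros; apply liftN_subst. }
  assert (mF : forall s t G, map (subst (upF_term s) (upF t)) (map liftF G)
                             = map liftF (map (subst s t) G)).
  { intros. rewrite !map_map. apply map_ext. intros; apply liftF_subst. }
  induction 1; intros s' t'; cbn in *.
  - now apply prv_ax, axiom_subst.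
  - now apply prv_hyp, in_map.
  - now apply prv_botE.
  - now apply prv_andI.
  - eapply prv_andE1; eauto.
  - eapply prv_andE2; eauto.
  - apply prv_orI1; auto.
  - apply prv_orI2; auto.
  - eapply prv_orE; eauto.
  - apply prv_impI; auto.
  - eapply prv_impE; eauto.
  - apply prv_allNI. rewrite <- mN. auto.
  - rewrite instN_subst. apply prv_allNE. auto.
  - eapply prv_exNI. rewrite <- instN_subst. auto.
  - eapply prv_exNE; eauto. rewrite <- mN, <- liftN_subst. auto.
  - apply prv_allFI. rewrite <- mF. auto.
  - rewrite instF_subst. apply prv_allFE. auto.
  - eapply prv_exFI. rewrite <- instF_subst. auto.
  - eapply prv_exFE; eauto. rewrite <- mF, <- liftF_subst. auto.
  - apply prv_eqN_refl.
  - rewrite instN_subst. eapply prv_eqN_subst; eauto. rewrite <- instN_subst. auto.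
  - apply prv_eqF_refl.
  - rewrite instF_subst. eapply prv_eqF_subst; eauto. rewrite <- instF_subst. auto.
Qed.

Lemma prv_weaken G A : prv Th G A -> forall G', incl G G' -> prv Th G' A.
Proof.
  induction 1; intros G' I.
  - now apply prv_ax.
  - now apply prv_hyp, I.
  - apply prv_botE; auto.
  - apply prv_andI; auto.
  - eapply prv_andE1; eauto.
  - eapply prv_andE2; eauto.
  - apply prv_orI1; auto.
  - apply prv_orI2; auto.
  - eapply prv_orE; [auto|apply IHprv2|apply IHprv3];
      (apply incl_cons; [left; trivial|apply incl_tl; trivial]).
  - apply prv_impI, IHprv. apply incl_cons; [left; trivial|apply incl_tl; trivial].
  - eapply prv_impE; eauto.
  - apply prv_allNI, IHprv. now apply incl_map.
  - apply prv_allNE; auto.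
  - eapply prv_exNI; eauto.
  - eapply prv_exNE; eauto. apply IHprv2.
    apply incl_cons; [left; trivial|apply incl_tl, incl_map; trivial].
  - apply prv_allFI, IHprv. now apply incl_map.
  - apply prv_allFE; auto.
  - eapply prv_exFI; eauto.
  - eapply prv_exFE; eauto. apply IHprv2.
    apply incl_cons; [left; trivial|apply incl_tl, incl_map; trivial].
  - apply prv_eqN_refl.
  - eapply prv_eqN_subst; eauto.
  - apply prv_eqF_refl.
  - eapply prv_eqF_subst; eauto.
Qed.

(** ** Fresh variables *)

Definition agree {X} (n : nat) (s s' : nat -> X) := forall k, k < n -> s k = s' k.

(** All free variables of [A] have indices below [n].  This is expressed through what it
    is used for, so that no list of free variables has to be computed. *)
Definition fvbound (n : nat) (A : form) :=
  forall s s' t t', agree n s s' -> agree n t t' -> subst s t A = subst s' t' A.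

Lemma agree_le {X} n n' (s s' : nat -> X) : n <= n' -> agree n' s s' -> agree n s s'.
Proof. intros L H k K. apply H. lia. Qed.

Lemma fvbound_le n n' A : n <= n' -> fvbound n A -> fvbound n' A.
Proof. intros L H s s' t t' P Q. apply H; (eapply agree_le; [exact L|assumption]). Qed.

Lemma fbound_ex (f : fterm) :
  exists n, forall t t', agree n t t' -> fsubst t f = fsubst t' f.
Proof. destruct f as [k|c]; [exists (S k)|exists 0]; intros t t' H; cbn; auto. Qed.

Lemma tbound_ex (u : term) : exists n, forall s s' t t',
  agree n s s' -> agree n t t' -> tsubst s t u = tsubst s' t' u.
Proof.
  induction u as [k| |f u [n IH]|u [n IHu] v [m IHv]].
  - exists (S k). intros; cbn; auto.
  - exists 0; reflexivity.
  - destruct (fbound_ex f) as [m E]. exists (n + m). intros s s' t t' P Q; cbn.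
    rewrite (IH s s' t t'), (E t t'); trivial; (eapply agree_le; [|eassumption]; lia).
  - exists (n + m). intros s s' t t' P Q; cbn.
    rewrite (IHu s s' t t'), (IHv s s' t t'); trivial; (eapply agree_le; [|eassumption]; lia).
Qed.

Lemma fvbound_ex A : exists n, fvbound n A.
Proof.
  assert (uN : forall n s s', agree n s s' -> agree (S n) (upN s) (upN s')).
  { intros n s s' H [|k] K; cbn; trivial. rewrite (H k); [trivial|lia]. }
  assert (uF : forall n t t', agree n t t' -> agree (S n) (upF t) (upF t')).
  { intros n s s' H [|k] K; cbn; trivial. rewrite (H k); [trivial|lia]. }
  assert (uT : forall n s s', agree n s s' -> agree n (upF_term s) (upF_term s')).
  { intros n s s' H k K; unfold upF_term. rewrite (H k); [trivial|lia]. }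
  induction A as [|u v|f g|A [n HA] B [m HB]|A [n HA] B [m HB]|A [n HA] B [m HB]
                 |A [n HA]|A [n HA]|A [n HA]|A [n HA]].
  2: { destruct (tbound_ex u) as [n Hu], (tbound_ex v) as [m Hv].
       exists (n + m). intros s s' t t' P Q; cbn.
       rewrite (Hu s s' t t'), (Hv s s' t t'); trivial; (eapply agree_le; [|eassumption]; lia). }
  2: { destruct (fbound_ex f) as [n Hf], (fbound_ex g) as [m Hg].
       exists (n + m). intros s s' t t' P Q; cbn.
       rewrite (Hf t t'), (Hg t t'); trivial; (eapply agree_le; [|eassumption]; lia). }
  1: exists 0; intros s s' t t' P Q; reflexivity.
  1-3: exists (n + m); intros s s' t t' P Q; cbn;
       rewrite (HA s s' t t'), (HB s s' t t'); trivial; (eapply agree_le; [|eassumption]; lia).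
  all: exists n; intros s s' t t' P Q; cbn; f_equal; apply HA;
    solve [ trivial | auto | eapply agree_le; [|apply uN; eassumption]; lia
          | eapply agree_le; [|apply uF; eassumption]; lia ].
Qed.

Lemma fvbound_list G : exists n, forall A, In A G -> fvbound n A.
Proof.
  induction G as [|A G [n IH]].
  - exists 0; intros A [].
  - destruct (fvbound_ex A) as [m H]. exists (n + m). intros B [ -> | I].
    + eapply fvbound_le; [|exact H]; lia.
    + eapply fvbound_le; [|apply IH; trivial]; lia.
Qed.

(** A fresh number (function) variable [n] may serve as the eigenvariable: a
    renaming moves it to index 0 and shifts everything else. *)
Definition toTop {X} (v : nat -> X) (n k : nat) : X :=
  if Nat.eqb k n then v 0 else v (S k).

Lemma toTop_agree {X} (v : nat -> X) n : agree n (toTop v n) (fun k => v (S k)).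
Proof. intros k K. unfold toTop. destruct (Nat.eqb_spec k n); trivial; lia. Qed.

Lemma toTop_liftN n A : fvbound n A -> subst (toTop tvar n) fvar A = liftN A.
Proof. intros H. apply H; [apply toTop_agree|intros ? ?; reflexivity]. Qed.

Lemma toTop_liftF n A : fvbound n A -> subst tvar (toTop fvar n) A = liftF A.
Proof. intros H. apply H; [intros ? ?; reflexivity|apply toTop_agree]. Qed.

Lemma toTop_instN n A : fvbound n A -> subst (toTop tvar n) fvar (instN (tvar n) A) = A.
Proof.
  intros H. unfold instN. rewrite subst_comp. rewrite <- (subst_id A) at 2. apply H.
  - intros k K. destruct k; cbn; unfold toTop.
    + now rewrite Nat.eqb_refl.
    + destruct (Nat.eqb_spec k n); trivial; lia.
  - intros k K; reflexivity.
Qed.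

Lemma toTop_instF n A : fvbound n A -> subst tvar (toTop fvar n) (instF (fvar n) A) = A.
Proof.
  intros H. unfold instF. rewrite subst_comp. rewrite <- (subst_id A) at 2. apply H.
  - intros k K; reflexivity.
  - intros k K. destruct k; cbn; unfold toTop.
    + now rewrite Nat.eqb_refl.
    + destruct (Nat.eqb_spec k n); trivial; lia.
Qed.

(** Since contexts are finite, a fresh variable always exists.  This makes the domain of
    quantification the same, all terms, in every context. *)
Lemma allN_terms G A : (forall t, prv Th G (instN t A)) -> prv Th G (AllN A).
Proof.
  intros H. destruct (fvbound_list (A :: G)) as [n F].
  apply prv_allNI.
  pose proof (prv_subst _ _ (H (tvar n)) (toTop tvar n) fvar) as P.
  rewrite toTop_instN in P by (apply F; left; trivial).
  erewrite map_ext_in in P; [exact P|].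
  intros B I. apply toTop_liftN, F. right; trivial.
Qed.

Lemma allF_terms G A : (forall f, prv Th G (instF f A)) -> prv Th G (AllF A).
Proof.
  intros H. destruct (fvbound_list (A :: G)) as [n F].
  apply prv_allFI.
  pose proof (prv_subst _ _ (H (fvar n)) tvar (toTop fvar n)) as P.
  rewrite toTop_instF in P by (apply F; left; trivial).
  erewrite map_ext_in in P; [exact P|].
  intros B I. apply toTop_liftF, F. right; trivial.
Qed.

Lemma exN_terms G A C : prv Th G (ExN A) ->
  (forall t, prv Th (instN t A :: G) C) -> prv Th G C.
Proof.
  intros E H. destruct (fvbound_list (C :: A :: G)) as [n F].
  eapply prv_exNE; [exact E|].
  pose proof (prv_subst _ _ (H (tvar n)) (toTop tvar n) fvar) as P.
  rewrite toTop_liftN in P by (apply F; left; trivial). cbn [map] in P.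
  rewrite toTop_instN in P by (apply F; right; left; trivial).
  erewrite map_ext_in in P; [exact P|].
  intros B I. apply toTop_liftN, F. right; right; trivial.
Qed.

Lemma exF_terms G A C : prv Th G (ExF A) ->
  (forall f, prv Th (instF f A :: G) C) -> prv Th G C.
Proof.
  intros E H. destruct (fvbound_list (C :: A :: G)) as [n F].
  eapply prv_exFE; [exact E|].
  pose proof (prv_subst _ _ (H (fvar n)) tvar (toTop fvar n)) as P.
  rewrite toTop_liftF in P by (apply F; left; trivial). cbn [map] in P.
  rewrite toTop_instF in P by (apply F; right; left; trivial).
  erewrite map_ext_in in P; [exact P|].
  intros B I. apply toTop_liftF, F. right; right; trivial.
Qed.

(** * Forcing over contexts *)

(** Propositions about contexts.  The Kripke conditions are contexts ordered by
    inclusion, and the domain is constant. *)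
Definition wprop := list form -> Prop.

Definition eqn (t u : term) : wprop := fun G => prv Th G (EqN t u).
Definition eqf (f g : fterm) : wprop := fun G => prv Th G (EqF f g).
Definition bot : wprop := fun G => prv Th G Bot.
Definition wand (P Q : wprop) : wprop := fun G => P G /\ Q G.
Definition imp (P Q : wprop) : wprop := fun G => forall G', incl G G' -> P G' -> Q G'.
Definition alln (P : term -> wprop) : wprop := fun G => forall t, P t G.
Definition allf (P : fterm -> wprop) : wprop := fun G => forall f, P f G.

(** [cl P] is the impredicative closure under proofs by cases: whatever follows
    from [P] in all larger contexts is derivable.  Disjunction and existence hold
    only in this sense at a context, since a context need not be prime. *)
Definition cl (P : wprop) : wprop := fun G => forall G1, incl G G1 ->
  forall C, (forall G', incl G1 G' -> P G' -> prv Th G' C) -> prv Th G1 C.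
Definition wor (P Q : wprop) : wprop := cl (fun G => P G \/ Q G).
Definition exn (P : term -> wprop) : wprop := cl (fun G => exists t, P t G).
Definition exf (P : fterm -> wprop) : wprop := cl (fun G => exists f, P f G).

Fixpoint force (s : nat -> term) (t : nat -> fterm) (A : form) : wprop :=
  match A with
  | Bot => bot
  | EqN u v => eqn (tsubst s t u) (tsubst s t v)
  | EqF f g => eqf (fsubst t f) (fsubst t g)
  | And A B => wand (force s t A) (force s t B)
  | Or A B => wor (force s t A) (force s t B)
  | Imp A B => imp (force s t A) (force s t B)
  | AllN A => alln (fun u => force (scons u s) t A)
  | ExN A => exn (fun u => force (scons u s) t A)
  | AllF A => allf (fun f => force s (scons f t) A)
  | ExF A => exf (fun f => force s (scons f t) A)
  end.

(** The formulas are their own model: a formula is forced exactly when it is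
    derivable.  So a derivation may be given as an argument about forcing, where
    the variables of the object language are variables of the metalanguage. *)
Theorem force_prv A : forall s t G, force s t A G <-> prv Th G (subst s t A).
Proof.
  assert (I : forall (A : form) G, incl G (A :: G)) by (intros; apply incl_tl, incl_refl).
  assert (H1 : forall (A : form) G, prv Th (A :: G) A) by (intros; apply prv_hyp; left; trivial).
  induction A as [|u v|f g|A HA B HB|A HA B HB|A HA B HB|A HA|A HA|A HA|A HA];
    intros s t G; cbn.
  1-3: reflexivity.
  - unfold wand. rewrite HA, HB. split.
    + intros [? ?]; now apply prv_andI.
    + intros H; split; [eapply prv_andE1|eapply prv_andE2]; eauto.
  - split.
    + intros H. apply H; [apply incl_refl|]. intros G' _ [K|K].
      * apply prv_orI1, HA, K.
      * apply prv_orI2, HB, K.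
    + intros H G1 J C K. apply prv_weaken with (G' := G1) in H; trivial.
      eapply prv_orE; [exact H| |]; apply K; auto.
      * left; apply HA; auto.
      * right; apply HB; auto.
  - split.
    + intros H. apply prv_impI, HB, H; auto. apply HA; auto.
    + intros H G' J K. apply HB. eapply prv_impE; [eapply prv_weaken; eauto|]. apply HA, K.
  - split.
    + intros H. apply allN_terms. intros u. rewrite subst_instN. apply HA, H.
    + intros H u. apply HA. rewrite <- subst_instN. now apply prv_allNE.
  - split.
    + intros H. apply H; [apply incl_refl|]. intros G' _ [u K]. eapply prv_exNI. rewrite subst_instN.
      apply HA, K.
    + intros H G1 J C K. apply prv_weaken with (G' := G1) in H; trivial.
      eapply exN_terms; [exact H|]. intros u. apply K; auto.
      exists u. apply HA. rewrite subst_instN. auto.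
  - split.
    + intros H. apply allF_terms. intros u. rewrite subst_instF. apply HA, H.
    + intros H u. apply HA. rewrite <- subst_instF. now apply prv_allFE.
  - split.
    + intros H. apply H; [apply incl_refl|]. intros G' _ [u K]. eapply prv_exFI. rewrite subst_instF.
      apply HA, K.
    + intros H G1 J C K. apply prv_weaken with (G' := G1) in H; trivial.
      eapply exF_terms; [exact H|]. intros u. apply K; auto.
      exists u. apply HA. rewrite subst_instF. auto.
Qed.

(** ** Propositions that may be proved by cases *)

(** These are the propositions of the sheaf model: monotone, and true as soon as they
    hold in all cases of a derivable case distinction.  All propositions below are of this
    kind. *)
Class Good (P : wprop) : Prop := {
  good_mono : forall G G', incl G G' -> P G -> P G';
  good_cl : forall G, cl P G -> P G }.

Lemma cl_ret (P : wprop) G : (forall G', incl G G' -> P G') -> cl P G.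
Proof. intros H G1 I C K. apply K; auto using incl_refl. Qed.

Lemma Good_prv A : Good (fun G => prv Th G A).
Proof.
  split.
  - intros G G' I H. eapply prv_weaken; eauto.
  - intros G H. apply (H G (incl_refl _)). auto.
Qed.

Lemma cl_mono (P : wprop) G G' : incl G G' -> cl P G -> cl P G'.
Proof. intros I H G1 I1. apply H. eapply incl_tran; eauto. Qed.

Lemma cl_map (P Q : wprop) G :
  (forall G', incl G G' -> P G' -> Q G') -> cl P G -> cl Q G.
Proof.
  intros F H G1 I1 C K. apply H; trivial. intros G' I P'. apply K; trivial.
  apply F; trivial. eapply incl_tran; eauto.
Qed.

Lemma cl_bind (P Q : wprop) G : Good Q ->
  cl P G -> (forall G', incl G G' -> P G' -> Q G') -> Q G.
Proof. intros GQ H F. apply good_cl. eapply cl_map; eauto. Qed.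

#[export] Instance Good_eqn t u : Good (eqn t u).
Proof. apply Good_prv. Qed.
#[export] Instance Good_bot : Good bot.
Proof. apply Good_prv. Qed.
#[export] Instance Good_and P Q : Good P -> Good Q -> Good (wand P Q).
Proof.
  intros GP GQ. split.
  - intros G G' I [H K]. split; eapply good_mono; eauto.
  - intros G H. split; apply good_cl; (eapply cl_map; [|exact H]); intros G' I [? ?]; trivial.
Qed.
#[export] Instance Good_imp P Q : Good P -> Good Q -> Good (imp P Q).
Proof.
  intros GP GQ. split.
  - intros G G' I H G1 I1. apply H. eapply incl_tran; eauto.
  - intros G H G' I K. apply good_cl. apply cl_mono with (G' := G') in H; trivial.
    eapply cl_map; [|exact H]. intros G1 I1 F. apply F; [apply incl_refl|].
    eapply good_mono; eauto.
Qed.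
#[export] Instance Good_alln P : (forall t, Good (P t)) -> Good (alln P).
Proof.
  intros GP. split.
  - intros G G' I H t. eapply good_mono; eauto.
  - intros G H t. apply good_cl. eapply cl_map; [|exact H]. intros G1 I1 F. apply F.
Qed.
#[export] Instance Good_allf P : (forall f, Good (P f)) -> Good (allf P).
Proof.
  intros GP. split.
  - intros G G' I H t. eapply good_mono; eauto.
  - intros G H t. apply good_cl. eapply cl_map; [|exact H]. intros G1 I1 F. apply F.
Qed.
#[export] Instance Good_closure P : Good (cl P).
Proof.
  split.
  - intros G G' I H. eapply cl_mono; eauto.
  - intros G H G1 I1 C K. apply H; trivial. intros G2 I2 F. apply F; [apply incl_refl|].
    intros G3 I3. apply K. eapply incl_tran; eauto.
Qed.
#[export] Instance Good_force s t A : Good (force s t A).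
Proof.
  split.
  - intros G G' I H. rewrite force_prv in *. eapply prv_weaken; eauto.
  - intros G H. rewrite force_prv. apply (H G (incl_refl _)).
    intros G' _ K. now rewrite <- force_prv.
Qed.

Lemma or_l P Q G : Good P -> P G -> wor P Q G.
Proof. intros GP H. apply cl_ret. intros G' I. left. eapply good_mono; eauto. Qed.
Lemma or_r P Q G : Good Q -> Q G -> wor P Q G.
Proof. intros GP H. apply cl_ret. intros G' I. right. eapply good_mono; eauto. Qed.
Lemma exn_intro (P : term -> wprop) t G : Good (P t) -> P t G -> exn P G.
Proof. intros GP H. apply cl_ret. intros G' I. exists t. eapply good_mono; eauto. Qed.
Lemma exf_intro (P : fterm -> wprop) f G : Good (P f) -> P f G -> exf P G.
Proof. intros GP H. apply cl_ret. intros G' I. exists f. eapply good_mono; eauto. Qed.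

Lemma bot_elim P G : Good P -> bot G -> P G.
Proof. intros GP H. apply good_cl. intros G1 I C _. apply prv_botE. eapply prv_weaken; eauto. Qed.

Lemma mp (P Q : wprop) G : imp P Q G -> P G -> Q G.
Proof. intros H. apply H, incl_refl. Qed.

(** Each step into a larger context carries all hypotheses along, so that the context
    never has to be mentioned in a proof.  [wopen] opens a disjunction or an existence
    statement by [cl_bind]. *)
Ltac wlift G G' I :=
  repeat match goal with
  | H : ?P G |- _ =>
    lazymatch type of P with
    | list form -> Prop => apply (good_mono (P := P) G G' I) in H
    | wprop => apply (good_mono (P := P) G G' I) in H
    end
  end; clear I; try clear G.
Ltac wnext :=
  match goal with |- forall G', incl ?G G' -> _ =>
    let G' := fresh "G" in let I := fresh in intros G' I; wlift G G' I end.
Tactic Notation "wintro" simple_intropattern(pat) :=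
  match goal with |- ?P ?G =>
    let G' := fresh "G" in let I := fresh in let K := fresh in
    intros G' I K; wlift G G' I; revert K; intros pat end.
Tactic Notation "wassert" ident(H) ":" uconstr(P) :=
  match goal with |- _ ?G => assert (H : P G) end.
Tactic Notation "wopen" uconstr(H) "as" simple_intropattern(pat) :=
  match goal with |- ?P ?G =>
    let G' := fresh "G" in let I := fresh in let K := fresh in
    refine (cl_bind _ P G _ H _); try (let h := constr:(H) in clear h);
    intros G' I K; wlift G G' I; revert K; intros pat end.

(** ** Equality *)

(** [eqn] with the context first, as setoid rewriting expects a relation. *)
Definition teq (G : list form) (t u : term) : Prop := prv Th G (EqN t u).

Lemma eqn_refl t G : eqn t t G.
Proof. apply prv_eqN_refl. Qed.

Lemma force_eqn A s t u v G :
  eqn u v G -> force (scons u s) t A G -> force (scons v s) t A G.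
Proof.
  rewrite !force_prv, <- !subst_instN. apply prv_eqN_subst.
Qed.

#[export] Instance teq_equiv G : Equivalence (teq G).
Proof.
  assert (S : Symmetric (teq G)).
  { intros t u H. apply (force_eqn (EqN (tvar 0) (tvar 1)) (scons t tvar) fvar t u G H).
    apply eqn_refl. }
  split; trivial.
  - intros t. apply eqn_refl.
  - intros t u v H K.
    apply (force_eqn (EqN (tvar 1) (tvar 0)) (scons t tvar) fvar u v G K). exact H.
Qed.

#[export] Instance teq_app G f : Proper (teq G ==> teq G) (tapp f).
Proof.
  intros t u H.
  apply (force_eqn (EqN (tapp (fvar 0) (tvar 1)) (tapp (fvar 0) (tvar 0)))
           (scons t tvar) (scons f fvar) t u G H). apply eqn_refl.
Qed.

#[export] Instance teq_J G : Proper (teq G ==> teq G ==> teq G) tJ.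
Proof.
  intros t u H t' u' H'. transitivity (tJ t u').
  - apply (force_eqn (EqN (tJ (tvar 1) (tvar 2)) (tJ (tvar 1) (tvar 0)))
           (scons t (scons t' tvar)) fvar t' u' G H'). apply eqn_refl.
  - apply (force_eqn (EqN (tJ (tvar 1) (tvar 2)) (tJ (tvar 0) (tvar 2)))
           (scons t (scons u' tvar)) fvar t u G H). apply eqn_refl.
Qed.

Lemma eqn_sym t u G : eqn t u G -> eqn u t G.
Proof. apply (teq_equiv G). Qed.
Lemma eqn_trans t u v G : eqn t u G -> eqn u v G -> eqn t v G.
Proof. apply (teq_equiv G). Qed.

Ltac erw_ H :=
  let K := fresh in
  match goal with |- eqn ?l ?r ?G =>
    change (teq G l r); pose proof H as K; cbv beta in K;
    try match type of K with eqn ?a ?b ?G' => change (teq G' a b) in K end;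
    rewrite K; clear K;
    try match goal with |- teq _ ?l ?r => change (eqn l r G) end end.
Tactic Notation "erw" constr(H) := erw_ H; try apply eqn_refl.
Tactic Notation "erw" "<-" uconstr(H) := erw_ open_constr:(eqn_sym _ _ _ H); try apply eqn_refl.

(** ** Axioms and induction *)

Lemma force_ax A s t G : Th A -> force s t A G.
Proof. intros H. apply force_prv, prv_ax, axiom_subst, H. Qed.

Lemma force_subst A s' t' s t G :
  force s' t' (subst s t A) G
  <-> force (fun n => tsubst s' t' (s n)) (fun n => fsubst t' (t n)) A G.
Proof. rewrite !force_prv, subst_comp. reflexivity. Qed.

Local Notation St := (tapp (fcst PSucc)).

(** Induction is restricted to predicates given by a formula; the environments [s] and
    [t] supply its parameters. *)
Lemma force_ind A s t G :
  force (scons tzero s) t A G ->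
  (forall G', incl G G' -> forall u,
     force (scons u s) t A G' -> force (scons (St u) s) t A G') ->
  forall u, force (scons u s) t A G.
Proof.
  intros H0 HS.
  assert (E : forall u (G : list form), force (scons u s) t (subst (scons (St (tvar 0)) shiftN) fvar A) G
    <-> force (scons (St u) s) t A G).
  { intros u G'. rewrite force_subst.
    match goal with |- force ?x ?y _ _ <-> force ?x' ?y' _ _ =>
      replace x with x' by (extensionality n; destruct n; reflexivity);
      replace y with y' by (extensionality n; reflexivity) end. reflexivity. }
  pose proof (force_ax (ax_ind A) s t G (or_introl (BIM_ax_ind A))) as X.
  unfold ax_ind in X. cbn [force] in X.
  refine (mp _ _ _ (mp _ _ _ X _) _).
  - unfold instN. apply force_subst.
    match goal with |- force ?x ?y _ _ => match type of H0 with force ?x' ?y' _ _ =>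
      replace x with x' by (extensionality n; destruct n; reflexivity);
      replace y with y' by (extensionality n; reflexivity) end end. exact H0.
  - intros u G' I K. apply E. auto.
Qed.

(** * First arithmetic inside the calculus *)

Local Notation cs c := (tapp (fcst c)) (only parsing).

Ltac by_axiom c :=
  let H := fresh in
  intros; match goal with G : list form |- _ =>
    pose proof (force_ax _ tvar fvar G (or_introl c)) as H end; apply H.

Lemma e_Id t G : teq G (cs PId t) t.
Proof. by_axiom BIM_ax_Id. Qed.
Lemma e_Zero t G : teq G (cs PZero t) tzero.
Proof. by_axiom BIM_ax_Zero. Qed.
Lemma e_K t u G : teq G (cs PK (tJ t u)) t.
Proof. by_axiom BIM_ax_K. Qed.
Lemma e_L t u G : teq G (cs PL (tJ t u)) u.
Proof. by_axiom BIM_ax_L. Qed.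
Lemma e_comp f g t G : teq G (cs (PComp f g) t) (cs f (cs g t)).
Proof. by_axiom (BIM_ax_def_comp f g). Qed.
Lemma e_pair f g t G : teq G (cs (PPair f g) t) (tJ (cs f t) (cs g t)).
Proof. by_axiom (BIM_ax_def_pair f g). Qed.
Lemma e_rec0 f g t G : teq G (cs (PRec f g) (tJ t tzero)) (cs f t).
Proof.
  pose proof (force_ax _ tvar fvar G (or_introl (BIM_ax_def_rec f g))) as H.
  cbn in H. apply (H t tzero).
Qed.
Lemma e_recS f g t u G :
  teq G (cs (PRec f g) (tJ t (St u))) (cs g (tJ (tJ t u) (cs (PRec f g) (tJ t u)))).
Proof.
  pose proof (force_ax _ tvar fvar G (or_introl (BIM_ax_def_rec f g))) as H.
  cbn in H. apply (H t u).
Qed.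
Lemma S_neq_0 t G : eqn (St t) tzero G -> bot G.
Proof. intros H. refine (mp _ _ _ _ H). clear H. revert t. by_axiom BIM_ax_S_neq_0. Qed.
Lemma S_inj t u G : eqn (St t) (St u) G -> eqn t u G.
Proof. intros H. refine (mp _ _ _ _ H). clear H. revert t u. by_axiom BIM_ax_S_inj. Qed.

Lemma zero_or_succ t G : wor (eqn t tzero) (exn (fun u => eqn t (St u))) G.
Proof.
  apply (force_ind (Or (EqN (tvar 0) tzero) (ExN (EqN (tvar 1) (St (tvar 0))))) tvar fvar).
  - apply or_l; [apply _|]. apply eqn_refl.
  - intros G' _ u _. apply or_r; [apply _|]. apply (exn_intro _ u); [apply _|]. apply eqn_refl.
Qed.

(** Equality of numbers is decidable, by double induction.  All decisions made in the
    derivation reduce to this one. *)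
Lemma eqn_dec t u G : wor (eqn t u) (imp (eqn t u) bot) G.
Proof.
  revert u.
  apply (force_ind (AllN (Or (EqN (tvar 1) (tvar 0)) (Imp (EqN (tvar 1) (tvar 0)) Bot))) tvar fvar);
    cbn [force tsubst scons fsubst].
  - intros u. wopen (zero_or_succ u _) as [E|E].
    + apply or_l; [apply _|]. apply eqn_sym, E.
    + wopen E as [v E]. apply or_r; [apply _|]. wintro H.
      apply (S_neq_0 v). erw <- E. apply eqn_sym, H.
  - clear t. intros G1 _ t IH u. wopen (zero_or_succ u _) as [E|E].
    + apply or_r; [apply _|]. wintro H.
      apply (S_neq_0 t). erw H. exact E.
    + wopen E as [v E]. wopen (IH v) as [K|K].
      * apply or_l; [apply _|]. erw E. erw K.
      * apply or_r; [apply _|]. wintro H. apply (mp _ _ _ K). apply S_inj. erw H. exact E.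
Qed.

Ltac prs :=
  repeat first [ erw e_comp | erw e_pair | erw e_K
               | erw e_L | erw e_Id ].

Lemma e_ifz_0 c a b t G : eqn (cs c t) tzero G -> teq G (cs (c_ifz c a b) t) (cs a t).
Proof.
  intros H. change (eqn (cs (c_ifz c a b) t) (cs a t) G). unfold c_ifz. prs. erw H.
  erw e_rec0.
Qed.

Lemma e_ifz_S c a b t u G : eqn (cs c t) (St u) G -> teq G (cs (c_ifz c a b) t) (cs b t).
Proof.
  intros H. change (eqn (cs (c_ifz c a b) t) (cs b t) G). unfold c_ifz, arg_m. prs. erw H.
  erw e_recS. prs.
Qed.

(** [c_climb f] counts upwards for as long as [f(p,_)] vanishes.  It makes the
    failure of an induction visible at a definable number: if [f(p,0) = 0], then
    either [f(p,_)] vanishes up to [n], or it changes from zero to nonzero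
    just after [c_climb f (p,n)].  Hence quantifier-free induction holds in every
    structure that satisfies the axioms for its terms, without further witnesses. *)
Definition c_climb (f : pr) : pr :=
  PRec PZero (c_ifz (c2 f arg_m (PComp PSucc PL)) (PComp PSucc PL) PL).

Lemma climb f p n G : eqn (cs f (tJ p tzero)) tzero G ->
  let r := cs (c_climb f) (tJ p n) in
  wand (eqn (cs f (tJ p r)) tzero)
       (wor (eqn r n) (imp (eqn (cs f (tJ p (St r))) tzero) bot)) G.
Proof.
  intros H0 r. subst r. revert n.
  apply (force_ind
    (let r := tapp (fvar 1) (tJ (tvar 1) (tvar 0)) in
     And (EqN (tapp (fvar 0) (tJ (tvar 1) r)) tzero)
         (Or (EqN r (tvar 0)) (Imp (EqN (tapp (fvar 0) (tJ (tvar 1) (St r))) tzero) Bot)))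
    (scons p tvar) (scons (fcst f) (scons (fcst (c_climb f)) fvar)) G);
  cbn [force tsubst scons fsubst].
  - assert (E : eqn (cs (c_climb f) (tJ p tzero)) tzero G).
    { unfold c_climb. erw e_rec0. apply e_Zero. }
    split; [erw E; exact H0|]. apply or_l; [apply _|]. exact E.
  - intros G' I n [F K]. apply (good_mono _ _ I) in H0. clear G I.
    set (r := cs (c_climb f) (tJ p n)) in *.
    set (r' := cs (c_climb f) (tJ p (St n))).
    assert (E0 : forall G, eqn (cs f (tJ p (St r))) tzero G -> eqn r' (St r) G).
    { intros G E. unfold r', c_climb. erw e_recS. fold (c_climb f). fold r.
      erw (e_ifz_0 (c2 f arg_m (PComp PSucc PL)) (PComp PSucc PL) PL (tJ (tJ p n) r));
        [prs|unfold c2, arg_m; prs; exact E]. }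
    assert (ES : forall u G, eqn (cs f (tJ p (St r))) (St u) G -> eqn r' r G).
    { intros u G E. unfold r', c_climb. erw e_recS. fold (c_climb f). fold r.
      erw (e_ifz_S (c2 f arg_m (PComp PSucc PL)) (PComp PSucc PL) PL (tJ (tJ p n) r) u);
        [prs|unfold c2, arg_m; prs; exact E]. }
    wopen (zero_or_succ (cs f (tJ p (St r))) _) as [E|E].
    + specialize (E0 _ E). split; [erw E0; exact E|].
      apply or_l; [apply _|]. wopen K as [K|K].
      * erw E0. erw K.
      * apply bot_elim; [apply _|]. apply (mp _ _ _ K E).
    + wopen E as [u E]. specialize (ES _ _ E). split; [erw ES; exact F|].
      apply or_r; [apply _|]. wintro X. apply (S_neq_0 u). erw <- E. erw <- X. erw ES.
Qed.

(** Characteristic functions of equality and order are built from [c_monus]; the laws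
    needed for this require induction over formulas with quantifiers and are therefore
    proved in the calculus. *)
Local Notation mon t u := (cs c_monus (tJ t u)) (only parsing).

Lemma e_pred_S t G : teq G (cs c_pred (St t)) t.
Proof.
  change (eqn (cs c_pred (St t)) t G). unfold c_pred, arg_n. prs. erw e_recS. prs.
Qed.
Lemma e_monus_0 t G : teq G (mon t tzero) t.
Proof. change (eqn (mon t tzero) t G). unfold c_monus. erw e_rec0. prs. Qed.
Lemma e_monus_S t u G : teq G (mon t (St u)) (cs c_pred (mon t u)).
Proof.
  change (eqn (mon t (St u)) (cs c_pred (mon t u)) G). unfold c_monus at 1. erw e_recS. prs.
Qed.

Lemma monus_S_S t u G : teq G (mon (St t) (St u)) (mon t u).
Proof.
  revert u.
  apply (force_ind (EqN (mon (St (tvar 1)) (St (tvar 0))) (mon (tvar 1) (tvar 0)))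
           (scons t tvar) fvar); cbn [force tsubst scons fsubst].
  - erw e_monus_S. erw e_monus_0. erw e_monus_0. apply e_pred_S.
  - intros G' _ u IH. erw (e_monus_S (St t) (St u)). erw (e_monus_S t u). erw IH.
Qed.

Lemma monus_self t G : eqn (mon t t) tzero G.
Proof.
  apply (force_ind (EqN (mon (tvar 0) (tvar 0)) tzero) tvar fvar);
    cbn [force tsubst scons fsubst].
  - apply e_monus_0.
  - intros G' _ u IH. erw (monus_S_S u u). exact IH.
Qed.

Lemma monus_antisym t u G : eqn (mon t u) tzero G -> eqn (mon u t) tzero G -> eqn t u G.
Proof.
  intros H K. refine (mp _ _ _ (mp _ _ _ _ H) K). clear H K. revert u.
  apply (force_ind (AllN (Imp (EqN (mon (tvar 1) (tvar 0)) tzero)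
    (Imp (EqN (mon (tvar 0) (tvar 1)) tzero) (EqN (tvar 1) (tvar 0))))) tvar fvar);
    cbn [force tsubst scons fsubst].
  - intros u. wintro H. wintro K. erw <- K. erw (e_monus_0 u).
  - intros G' _ v IH u. wopen (zero_or_succ u _) as [E|E].
    + wintro H. wintro K. apply bot_elim; [apply _|]. apply (S_neq_0 v).
      erw <- H. erw E. erw (e_monus_0 (St v)).
    + wopen E as [w E]. wintro H. wintro K. erw E.
      wassert X : (eqn v w).
      { refine (mp _ _ _ (mp _ _ _ (IH w) _) _).
        - erw <- (monus_S_S v w _). erw <- E. exact H.
        - erw <- (monus_S_S w v _). erw <- E. exact K. }
      erw X.
Qed.

Lemma zero_monus t G : eqn (mon tzero t) tzero G.
Proof.
  apply (force_ind (EqN (mon tzero (tvar 0)) tzero) tvar fvar);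
    cbn [force tsubst scons fsubst]; [apply e_monus_0|].
  intros G' _ w IH. erw (e_monus_S tzero w). erw IH.
  unfold c_pred. prs. erw e_rec0. apply e_Zero.
Qed.

Lemma monus_total t u G : wor (eqn (mon t u) tzero) (eqn (mon (St u) t) tzero) G.
Proof.
  revert u.
  apply (force_ind (AllN (Or (EqN (mon (tvar 1) (tvar 0)) tzero)
    (EqN (mon (St (tvar 0)) (tvar 1)) tzero))) tvar fvar);
    cbn [force tsubst scons fsubst].
  - intros u. apply or_l; [apply _|]. apply zero_monus.
  - intros G' _ v IH u. wopen (zero_or_succ u _) as [E|E].
    + apply or_r; [apply _|]. erw E. erw (monus_S_S tzero v). apply zero_monus.
    + wopen E as [w E]. wopen (IH w) as [K|K].
      * apply or_l; [apply _|]. erw E. erw (monus_S_S v w). exact K.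
      * apply or_r; [apply _|]. erw E. erw (monus_S_S (St w) v). exact K.
Qed.

(** * Arithmetical structures *)

(** Classical structures with genuine equality.  Induction is available for the vanishing
    of a primitive recursive function with a parameter [p].  The laws of [c_monus] and the
    case distinction are added to make this usable: they let equations and
    propositional combinations be expressed in that form. *)
Record PRA := {
  N : Type;
  N0 : N;
  NJ : N -> N -> N;
  ev : pr -> N -> N;
  ev_Id x : ev PId x = x;
  ev_Zero x : ev PZero x = N0;
  S_O x : ev PSucc x <> N0;
  S_injective x y : ev PSucc x = ev PSucc y -> x = y;
  ev_K x y : ev PK (NJ x y) = x;
  ev_L x y : ev PL (NJ x y) = y;
  ev_comp f g x : ev (PComp f g) x = ev f (ev g x);
  ev_pair f g x : ev (PPair f g) x = NJ (ev f x) (ev g x);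
  ev_rec_0 f g x : ev (PRec f g) (NJ x N0) = ev f x;
  ev_rec_S f g x y :
    ev (PRec f g) (NJ x (ev PSucc y)) = ev g (NJ (NJ x y) (ev (PRec f g) (NJ x y)));
  O_or_pred x : x = N0 \/ x = ev PSucc (ev c_pred x);
  monus_diag x : ev c_monus (NJ x x) = N0;
  monus_anti x y : ev c_monus (NJ x y) = N0 -> ev c_monus (NJ y x) = N0 -> x = y;
  monus_cases x y : ev c_monus (NJ x y) = N0 \/ ev c_monus (NJ (ev PSucc y) x) = N0;
  ev_ind f p :
    ev f (NJ p N0) = N0 ->
    (forall x, ev f (NJ p x) = N0 -> ev f (NJ p (ev PSucc x)) = N0) ->
    forall x, ev f (NJ p x) = N0 }.

(** ** Maximal consistent sets of formulas *)

(** Formulas are enumerated for the construction of a maximal consistent set. *)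
Definition pair_code (n m : nat) : nat := Cantor.to_nat (n, m).

Lemma pair_code_inj n m n' m' : pair_code n m = pair_code n' m' -> n = n' /\ m = m'.
Proof.
  intros H. apply (f_equal Cantor.of_nat) in H. unfold pair_code in H.
  rewrite !Cantor.cancel_of_to in H. now injection H.
Qed.

Fixpoint code_pr (c : pr) : nat :=
  match c with
  | PId => pair_code 0 0 | PZero => pair_code 1 0 | PSucc => pair_code 2 0
  | PK => pair_code 3 0 | PL => pair_code 4 0
  | PComp f g => pair_code 5 (pair_code (code_pr f) (code_pr g))
  | PPair f g => pair_code 6 (pair_code (code_pr f) (code_pr g))
  | PRec f g => pair_code 7 (pair_code (code_pr f) (code_pr g))
  end.

Definition code_fterm (f : fterm) : nat :=
  match f with fvar n => pair_code 0 n | fcst c => pair_code 1 (code_pr c) end.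

Fixpoint code_term (t : term) : nat :=
  match t with
  | tvar n => pair_code 0 n | tzero => pair_code 1 0
  | tapp f u => pair_code 2 (pair_code (code_fterm f) (code_term u))
  | tJ u v => pair_code 3 (pair_code (code_term u) (code_term v))
  end.

Fixpoint code_form (A : form) : nat :=
  match A with
  | Bot => pair_code 0 0
  | EqN u v => pair_code 1 (pair_code (code_term u) (code_term v))
  | EqF u v => pair_code 2 (pair_code (code_fterm u) (code_fterm v))
  | And A B => pair_code 3 (pair_code (code_form A) (code_form B))
  | Or A B => pair_code 4 (pair_code (code_form A) (code_form B))
  | Imp A B => pair_code 5 (pair_code (code_form A) (code_form B))
  | AllN A => pair_code 6 (code_form A)
  | ExN A => pair_code 7 (code_form A)
  | AllF A => pair_code 8 (code_form A)
  | ExF A => pair_code 9 (code_form A)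
  end.

Ltac code_cases :=
  intros y H; destruct y; cbn [code_pr code_fterm code_term code_form] in H;
  repeat match goal with
  | H : pair_code _ _ = pair_code _ _ |- _ => apply pair_code_inj in H; destruct H
  end; try discriminate.

Lemma code_pr_inj : forall x y, code_pr x = code_pr y -> x = y.
Proof. induction x; code_cases; f_equal; auto. Qed.

Lemma code_fterm_inj : forall x y, code_fterm x = code_fterm y -> x = y.
Proof. destruct x; code_cases; f_equal; auto using code_pr_inj. Qed.

Lemma code_term_inj : forall x y, code_term x = code_term y -> x = y.
Proof. induction x; code_cases; f_equal; auto using code_fterm_inj. Qed.

Lemma code_form_inj : forall x y, code_form x = code_form y -> x = y.
Proof. induction x; code_cases; f_equal; auto using code_fterm_inj, code_term_inj. Qed.

Section Maximal.
Variable X : form -> Prop.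

Definition consistent (X : form -> Prop) :=
  forall L, (forall A, In A L -> X A) -> ~ prv Th L Bot.
Definition add (X : form -> Prop) (A : form) : form -> Prop := fun B => X B \/ B = A.

Fixpoint stage (n : nat) : form -> Prop :=
  match n with
  | 0 => X
  | S n => fun A => stage n A \/ (code_form A = n /\ consistent (add (stage n) A))
  end.
Definition maxi (A : form) : Prop := exists n, stage n A.

Hypothesis consX : consistent X.

Lemma stage_le n m A : n <= m -> stage n A -> stage m A.
Proof. induction 1; cbn; auto. Qed.

Lemma stage_cons n : consistent (stage n).
Proof.
  induction n as [|n IH]; trivial. intros L HL.
  destruct (classic (exists A, code_form A = n /\ consistent (add (stage n) A)))
    as [[A [E C]]|H].
  - apply C. intros B I. destruct (HL B I) as [K|[K _]].
    + now left.
    + right. apply code_form_inj. congruence.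
  - apply IH. intros B I. destruct (HL B I) as [K|K]; trivial. exfalso; eauto.
Qed.

Lemma maxi_list L : (forall A, In A L -> maxi A) ->
  exists n, forall A, In A L -> stage n A.
Proof.
  induction L as [|B L IH]; intros H; [exists 0; intros A []|].
  destruct IH as [n Hn]; [intros; apply H; right; trivial|].
  destruct (H B) as [m Hm]; [left; trivial|].
  exists (n + m). intros A [ -> | I]; (eapply stage_le; [|eauto]; lia).
Qed.

Lemma maxi_cons : consistent maxi.
Proof. intros L HL. destruct (maxi_list L HL) as [n H]. now apply (stage_cons n). Qed.

Lemma maxi_max A : consistent (add maxi A) -> maxi A.
Proof.
  intros C. exists (S (code_form A)). right. split; trivial.
  intros L HL. apply C. intros B I. destruct (HL B I); [left; eexists; eauto|now right].
Qed.

Lemma add_split Y A L C : (forall B, In B L -> add Y A B) -> prv Th L C ->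
  exists L', (forall B, In B L' -> Y B) /\ prv Th (A :: L') C.
Proof.
  intros HL H.
  assert (K : exists L', (forall B, In B L' -> Y B) /\ incl L (A :: L')).
  { clear H. induction L as [|D L IH]; [exists []; split; [intros B []|intros B []]|].
    destruct IH as [L' [H1 H2]]; [intros; apply HL; right; trivial|].
    destruct (HL D) as [K| ->]; [left; trivial| |].
    - exists (D :: L'). split.
      + intros B [ <- | I]; auto.
      + intros B [ <- | I]; [right; left; trivial|].
        destruct (H2 B I) as [ <- | I']; [left|right; right]; trivial.
    - exists L'. split; trivial. intros B [ <- | I]; [left; trivial|auto]. }
  destruct K as [L' [H1 H2]]. exists L'; split; trivial. eapply prv_weaken; eauto.
Qed.

Lemma maxi_closed L A : (forall B, In B L -> maxi B) -> prv Th L A -> maxi A.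
Proof.
  intros HL H. apply maxi_max. intros L1 H1 K.
  destruct (add_split maxi A L1 Bot H1 K) as [L2 [H2 K2]].
  apply (maxi_cons (L ++ L2)).
  - intros B I. apply in_app_or in I as [I|I]; auto.
  - eapply prv_impE; [apply prv_impI|].
    + eapply prv_weaken; [exact K2|]. apply incl_cons; [left; trivial|].
      apply incl_tl, incl_appr, incl_refl.
    + eapply prv_weaken; [exact H|]. apply incl_appl, incl_refl.
Qed.

(** The calculus is intuitionistic, but a maximal consistent set decides every formula,
    so it describes a classical structure. *)
Lemma maxi_neg A : ~ maxi A -> maxi (Imp A Bot).
Proof.
  intros H. apply NNPP. intros K. apply H, maxi_max. intros L HL P.
  destruct (add_split maxi A L Bot HL P) as [L' [H1 P1]].
  apply K. apply (maxi_closed L' _ H1). now apply prv_impI.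
Qed.

Lemma force_id A G : force tvar fvar A G <-> prv Th G A.
Proof. rewrite force_prv, subst_id. reflexivity. Qed.

(** ** The structure of numerical terms *)

Definition meq (t u : term) : Prop := maxi (EqN t u).

Lemma meq_refl t : meq t t.
Proof. apply (maxi_closed []); [intros B []|]. apply prv_eqN_refl. Qed.
Lemma meq_sym t u : meq t u -> meq u t.
Proof.
  intros H. apply (maxi_closed [EqN t u]); [intros B [ <- |[]]; trivial|].
  apply (eqn_sym t u). apply prv_hyp; left; trivial.
Qed.
Lemma meq_trans t u v : meq t u -> meq u v -> meq t v.
Proof.
  intros H K. apply (maxi_closed [EqN t u; EqN u v]).
  - intros B [ <- |[ <- |[]]]; trivial.
  - apply (eqn_trans t u v); apply prv_hyp; [left|right; left]; trivial.
Qed.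
Lemma meq_app f t u : meq t u -> meq (tapp f t) (tapp f u).
Proof.
  intros H. apply (maxi_closed [EqN t u]); [intros B [ <- |[]]; trivial|].
  apply teq_app. apply prv_hyp; left; trivial.
Qed.
Lemma meq_J t u t' u' : meq t u -> meq t' u' -> meq (tJ t t') (tJ u u').
Proof.
  intros H K. apply (maxi_closed [EqN t u; EqN t' u']).
  - intros B [ <- |[ <- |[]]]; trivial.
  - apply teq_J; apply prv_hyp; [left|right; left]; trivial.
Qed.
Lemma meq_thm t u : (forall G, eqn t u G) -> meq t u.
Proof. intros H. apply (maxi_closed []); [intros B []|apply H]. Qed.

(** A canonical member of each class makes equality of the quotient Leibniz equality. *)
Definition rep (t : term) : term := epsilon (inhabits tzero) (meq t).
Lemma rep_meq t : meq t (rep t).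
Proof. unfold rep. apply epsilon_spec. exists t. apply meq_refl. Qed.
Lemma rep_eq t u : meq t u -> rep t = rep u.
Proof.
  intros H. unfold rep. f_equal. extensionality v. apply propositional_extensionality.
  split; intros K; eapply meq_trans; eauto using meq_sym.
Qed.

Definition carrier := { t : term | rep t = t }.
Definition cls (t : term) : carrier :=
  exist _ (rep t) (rep_eq _ _ (meq_sym _ _ (rep_meq t))).

Lemma cls_eq t u : cls t = cls u <-> meq t u.
Proof.
  split.
  - intros H. apply (f_equal (@proj1_sig _ _)) in H. cbn in H.
    eapply meq_trans; [apply rep_meq|]. rewrite H. apply meq_sym, rep_meq.
  - intros H. apply subset_eq_compat. now apply rep_eq.
Qed.

Lemma cls_surj (x : carrier) : exists t, x = cls t.
Proof. destruct x as [t H]. exists t. apply subset_eq_compat. now symmetry. Qed.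

Definition c_ev (c : pr) (x : carrier) : carrier := cls (tapp (fcst c) (proj1_sig x)).
Definition c_J (x y : carrier) : carrier := cls (tJ (proj1_sig x) (proj1_sig y)).

Lemma c_ev_cls c t : c_ev c (cls t) = cls (tapp (fcst c) t).
Proof. apply cls_eq, meq_app, meq_sym, rep_meq. Qed.
Lemma c_J_cls t u : c_J (cls t) (cls u) = cls (tJ t u).
Proof. apply cls_eq, meq_J; apply meq_sym, rep_meq. Qed.

(** Only induction is not immediate: a maximal set need not contain witnesses for its
    existence statements.  If induction failed at [n], then [c_climb f (p,n)] would be a
    term at which the induction step fails ([climb]). *)
Definition term_structure : PRA.
Proof.
  refine {| N := carrier; N0 := cls tzero; NJ := c_J; ev := c_ev |}; intros;
  repeat match goal with x : carrier |- _ => destruct (cls_surj x) as [? ->]; clear x end;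
  repeat rewrite ?c_J_cls, ?c_ev_cls in *.

  - apply cls_eq, meq_thm; intros G; apply e_Id.
  - apply cls_eq, meq_thm; intros G; apply e_Zero.
  - rewrite cls_eq. intros K. apply (maxi_cons [EqN (St x0) tzero]).
    + intros B [ <- |[]]; exact K.
    + apply (S_neq_0 x0). apply prv_hyp; left; trivial.
  - rewrite cls_eq in H |- *. apply (maxi_closed [EqN (St x1) (St x0)]).
    + intros B [ <- |[]]; trivial.
    + apply (S_inj x1 x0). apply prv_hyp; left; trivial.
  - apply cls_eq, meq_thm; intros G; apply e_K.
  - apply cls_eq, meq_thm; intros G; apply e_L.
  - apply cls_eq, meq_thm; intros G; apply e_comp.
  - apply cls_eq, meq_thm; intros G; apply e_pair.
  - apply cls_eq, meq_thm; intros G; apply e_rec0.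
  - apply cls_eq, meq_thm; intros G; apply e_recS.
  - rewrite !cls_eq. destruct (classic (meq x0 tzero)) as [K|K]; [left; exact K|right].
    apply maxi_neg in K. apply (maxi_closed [Imp (EqN x0 tzero) Bot]).
    + intros B [ <- |[]]; exact K.
    + set (L := [_]). assert (K1 : force tvar fvar (Imp (EqN x0 tzero) Bot) L)
        by (apply force_id, prv_hyp; left; trivial).
      cbn [force tsubst] in K1. rewrite tsubst_id in K1. clearbody L.
      change (eqn x0 (St (cs c_pred x0)) L). wopen (zero_or_succ x0 _) as [E|E].
      * apply bot_elim; [apply _|]. apply (mp _ _ _ K1 E).
      * wopen E as [u E]. erw E. erw (e_pred_S u).
  - apply cls_eq, meq_thm; intros G; apply monus_self.
  - rewrite cls_eq in H, H0 |- *.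
    apply (maxi_closed [EqN (mon x1 x0) tzero; EqN (mon x0 x1) tzero]).
    + intros B [ <- |[ <- |[]]]; trivial.
    + apply (monus_antisym x1 x0); apply prv_hyp; [left|right; left]; trivial.
  - rewrite !cls_eq. apply NNPP. intros K. apply not_or_and in K as [K K'].
    apply maxi_neg in K. apply maxi_neg in K'.
    apply (maxi_cons [Imp (EqN (mon x1 x0) tzero) Bot; Imp (EqN (mon (St x0) x1) tzero) Bot]).
    + intros B [ <- |[ <- |[]]]; trivial.
    + set (L := [_; _]).
      assert (K1 : force tvar fvar (Imp (EqN (mon x1 x0) tzero) Bot) L)
        by (apply force_id, prv_hyp; left; trivial).
      assert (K2 : force tvar fvar (Imp (EqN (mon (St x0) x1) tzero) Bot) L)
        by (apply force_id, prv_hyp; right; left; trivial).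
      cbn [force tsubst fsubst] in K1, K2. rewrite !tsubst_id in K1, K2. clearbody L.
      change (bot L). wopen (monus_total x1 x0 _) as [E|E].
      * apply (mp _ _ _ K1 E).
      * apply (mp _ _ _ K2 E).
  - apply cls_eq. rewrite cls_eq in H.
    rename x0 into n, x into q.
    set (r := cs (c_climb f) (tJ q n)).
    assert (C : forall G, In (EqN (cs f (tJ q tzero)) tzero) G -> _)
      by (intros G I; exact (climb f q n G (prv_hyp _ _ _ I))).
    fold r in C. cbv zeta in C.
    assert (F : meq (cs f (tJ q r)) tzero).
    { apply (maxi_closed [EqN (cs f (tJ q tzero)) tzero]).
      - intros B [ <- |[]]; exact H.
      - apply C. left; trivial. }
    assert (F' : meq (cs f (tJ q (St r))) tzero).
    { specialize (H0 (cls r)). repeat rewrite ?c_J_cls, ?c_ev_cls in H0.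
      rewrite !cls_eq in H0. auto. }
    destruct (classic (meq r n)) as [K|K].
    + apply meq_trans with (cs f (tJ q r)); trivial.
      apply meq_app, meq_J; [apply meq_refl|]. now apply meq_sym.
    + exfalso. apply maxi_neg in K.
      apply (maxi_cons [EqN (cs f (tJ q tzero)) tzero; EqN (cs f (tJ q (St r))) tzero;
                        Imp (EqN r n) Bot]).
      { intros B [ <- |[ <- |[ <- |[]]]]; trivial. }
      set (L := [_; _; _]). change (bot L).
      destruct (C L) as [_ D]; [left; trivial|].
      assert (F1 : eqn (cs f (tJ q (St r))) tzero L) by (apply prv_hyp; right; left; trivial).
      assert (K1 : force tvar fvar (Imp (EqN r n) Bot) L)
        by (apply force_id, prv_hyp; right; right; left; trivial).
      cbn [force] in K1. rewrite !tsubst_id in K1. 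
      clearbody L. wopen D as [D|D]; [apply (mp _ _ _ K1 D)|apply (mp _ _ _ D F1)].
Defined.

End Maximal.

(** ** Transfer *)

Fixpoint teval (M : PRA) (s : nat -> N M) (t : term) : N M :=
  match t with
  | tvar n => s n
  | tzero => N0 M
  | tapp (fcst c) u => ev M c (teval M s u)
  | tapp (fvar _) u => N0 M
  | tJ u v => NJ M (teval M s u) (teval M s v)
  end.

Fixpoint sat (M : PRA) (s : nat -> N M) (A : form) : Prop :=
  match A with
  | Bot => False
  | EqN t u => teval M s t = teval M s u
  | And A B => sat M s A /\ sat M s B
  | Or A B => sat M s A \/ sat M s B
  | Imp A B => sat M s A -> sat M s B
  | _ => False
  end.

Fixpoint tnum (t : term) : bool :=
  match t with
  | tvar _ | tzero => true
  | tapp (fcst _) u => tnum u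
  | tapp (fvar _) _ => false
  | tJ u v => tnum u && tnum v
  end.

Fixpoint qf (A : form) : bool :=
  match A with
  | Bot => true
  | EqN t u => tnum t && tnum u
  | And A B | Or A B | Imp A B => qf A && qf B
  | _ => false
  end.

Lemma qf_dec A : qf A = true -> forall s t G, wor (force s t A) (imp (force s t A) bot) G.
Proof.
  induction A as [|u v|f g|A HA B HB|A HA B HB|A HA B HB|A HA|A HA|A HA|A HA];
    cbn [qf]; intros Q s t G; try discriminate Q;
    try (apply andb_prop in Q as [QA QB]; specialize (HA QA s t); specialize (HB QB s t));
    cbn [force].
  - apply or_r; [apply _|]. wintro H. exact H.
  - apply eqn_dec.
  - wopen (HA _) as [a|a]; [wopen (HB _) as [b|b]|].
    + apply or_l; [apply _|]. split; trivial.
    + apply or_r; [apply _|]. wintro [_ K]. apply (mp _ _ _ b K).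
    + apply or_r; [apply _|]. wintro [K _]. apply (mp _ _ _ a K).
  - wopen (HA _) as [a|a]; [|wopen (HB _) as [b|b]].
    + apply or_l; [apply _|]. apply or_l; [apply _|trivial].
    + apply or_l; [apply _|]. apply or_r; [apply _|trivial].
    + apply or_r; [apply _|]. wintro K. wopen K as [K|K].
      * apply (mp _ _ _ a K).
      * apply (mp _ _ _ b K).
  - wopen (HB _) as [b|b]; [|wopen (HA _) as [a|a]].
    + apply or_l; [apply _|]. wintro K. exact b.
    + apply or_r; [apply _|]. wintro K. apply (mp _ _ _ b). apply (mp _ _ _ K a).
    + apply or_l; [apply _|]. wintro K. apply bot_elim; [apply _|]. apply (mp _ _ _ a K).
Qed.

(** If the formula is not derivable, its negation is consistent, by decidability, and a
    maximal consistent set containing it yields a structure of terms in which truth of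
    quantifier-free formulas is membership in that set.  So all elementary number theory
    can be done in classical structures. *)
Theorem transfer A : qf A = true ->
  (forall M s, sat M s A) -> forall s t G, force s t A G.
Proof.
  intros Q H s t G. apply NNPP. intros NP.
  set (C := subst s t A).
  set (X := fun B => In B (Imp C Bot :: G)).
  assert (cX : consistent X).
  { intros L HL K. apply NP.
    apply prv_weaken with (G' := Imp C Bot :: G) in K; [|exact HL].
    apply prv_impI in K.
    apply force_id in K. cbn [force] in K.
    wopen (qf_dec A Q s t _) as [a|a]; trivial.
    apply bot_elim; [apply _|]. apply (mp _ _ _ K). wintro c. apply (mp _ _ _ a).
    apply force_prv. now apply force_id. }
  set (M := term_structure X cX).
  assert (E : forall u, tnum u = true ->
    teval M (fun n => cls X cX (s n)) u = cls X cX (tsubst s t u)).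
  { induction u as [n| |[n|c] u IH|u IHu v IHv]; cbn [tnum]; intros V; try discriminate V.
    - reflexivity.
    - reflexivity.
    - cbn [teval]. rewrite IH; trivial. apply c_ev_cls.
    - apply andb_prop in V as [V W]. cbn [teval]. rewrite IHu, IHv; trivial. apply c_J_cls. }
  assert (S : forall B, qf B = true ->
    (sat M (fun n => cls X cX (s n)) B <-> maxi X (subst s t B))).
  { induction B as [|u v|f g|B HB D HD|B HB D HD|B HB D HD|B HB|B HB|B HB|B HB];
      cbn [qf sat subst]; intros V; try discriminate V.
    3-5: apply andb_prop in V as [V W]; rewrite (HB V), (HD W).
    - split; [intros []|]. intros K. apply (maxi_cons X cX [Bot]).
      + intros ? [ <- |[]]; trivial.
      + apply prv_hyp; left; trivial.
    - apply andb_prop in V as [V W]. rewrite !E; trivial. apply cls_eq.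
    - split.
      + intros [K1 K2]. apply (maxi_closed X cX [subst s t B; subst s t D]).
        * intros ? [ <- |[ <- |[]]]; trivial.
        * apply prv_andI; apply prv_hyp; [left|right; left]; trivial.
      + intros K; split; (apply (maxi_closed X cX [And (subst s t B) (subst s t D)]);
          [intros ? [ <- |[]]; trivial|]).
        * eapply prv_andE1, prv_hyp; left; trivial.
        * eapply prv_andE2, prv_hyp; left; trivial.
    - split.
      + intros [K|K].
        * apply (maxi_closed X cX [subst s t B]); [intros ? [ <- |[]]; trivial|].
          apply prv_orI1, prv_hyp; left; trivial.
        * apply (maxi_closed X cX [subst s t D]); [intros ? [ <- |[]]; trivial|].
          apply prv_orI2, prv_hyp; left; trivial.
      + intros K. apply NNPP. intros NK. apply not_or_and in NK as [N1 N2].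
        apply maxi_neg in N1; trivial. apply maxi_neg in N2; trivial.
        apply (maxi_cons X cX [Or (subst s t B) (subst s t D); Imp (subst s t B) Bot;
          Imp (subst s t D) Bot]); [intros ? [ <- |[ <- |[ <- |[]]]]; trivial|].
        eapply prv_orE; [apply prv_hyp; left; trivial| |];
          (eapply prv_impE; [|apply prv_hyp; left; trivial]); apply prv_hyp; cbn; auto.
    - split.
      + intros K. destruct (classic (maxi X (subst s t B))) as [b|b].
        * apply (maxi_closed X cX [subst s t D]); [intros ? [ <- |[]]; auto|].
          apply prv_impI, prv_hyp; cbn; auto.
        * apply maxi_neg in b; trivial.
          apply (maxi_closed X cX [Imp (subst s t B) Bot]); [intros ? [ <- |[]]; auto|].
          apply prv_impI, prv_botE. eapply prv_impE; apply prv_hyp; cbn; auto.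
      + intros K b. apply (maxi_closed X cX [Imp (subst s t B) (subst s t D); subst s t B]).
        * intros ? [ <- |[ <- |[]]]; trivial.
        * eapply prv_impE; apply prv_hyp; cbn; auto. }
  apply (maxi_cons X cX [Imp C Bot; C]).
  - intros ? [ <- |[ <- |[]]].
    + exists 0. left; trivial.
    + apply (proj1 (S A Q)). apply H.
  - eapply prv_impE; apply prv_hyp; cbn; auto.
Qed.

(** * Number theory in arithmetical structures *)

Module Arith.

Declare Scope pra_scope.
Delimit Scope pra_scope with pra.
Local Open Scope pra_scope.

Local Notation "'s' x" := (ev _ PSucc x) (at level 9, x at level 9) : pra_scope.
Local Notation "0" := (N0 _) : pra_scope.
Local Notation "1" := (ev _ PSucc (N0 _)) : pra_scope.
Local Notation "2" := (ev _ PSucc (ev _ PSucc (N0 _))) : pra_scope.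
Local Notation "x + y" := (ev _ c_add (NJ _ x y)) : pra_scope.
Local Notation "x - y" := (ev _ c_monus (NJ _ x y)) : pra_scope.
Local Notation "x * y" := (ev _ c_mul (NJ _ x y)) : pra_scope.
Local Notation "x ^ y" := (ev _ c_exp (NJ _ x y)) : pra_scope.
Local Notation "x <= y" := (ev _ c_monus (NJ _ x y) = N0 _) : pra_scope.
Local Notation "x < y" := (ev _ c_monus (NJ _ (ev _ PSucc x) y) = N0 _) : pra_scope.
Local Notation K := (ev _ PK).
Local Notation L := (ev _ PL).
Local Notation rem x d := (ev _ c_rem (NJ _ x d)).
Local Notation lpf x := (ev _ c_lpf x).
Local Notation prime x := (ev _ c_notprime x = 0).
Local Notation fact x := (ev _ c_fact x).
Local Notation pp i := (ev _ c_prime i).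
Local Notation val q x := (ev _ c_val (NJ _ q x)).
Local Notation pows f := (c2 c_exp (PComp c_prime PL) f).
Local Notation prod f m k := (ev _ (c_prod (pows f)) (NJ _ m k)).
Local Notation code f m k := (ev _ (c_code f) (NJ _ m k)).
Local Notation len x := (ev _ c_length x).
Local Notation entry x i := (ev _ c_entry (NJ _ x i)).
Local Notation vl x i := (val (pp i) (s x)).
Local Notation sing x := (ev _ c_sing x).
Local Notation cat x y := (ev _ c_cat (NJ _ x y)).
Local Notation init x n := (code c_entry x n).

(** [p(k) * prod_(i<k) p(i)], a bound for the codes of binary sequences of length [k]. *)
Definition c_bnd : pr := c2 c_mul c_prime (c2 (c_prod (pows c_one)) PZero PId).
Local Notation bnd k := (ev _ c_bnd k).

Lemma ev_c2 M f a b (x : N M) : ev M (c2 f a b) x = ev M f (NJ M (ev M a x) (ev M b x)).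
Proof. unfold c2. now rewrite ev_comp, ev_pair. Qed.

Ltac prv1 := repeat (rewrite ?ev_c2, ?ev_comp, ?ev_pair, ?ev_K, ?ev_L, ?ev_Id, ?ev_Zero).

Section NumberTheory.
Context {M : PRA}.
Local Notation N := (N M).

Implicit Types x y z u v w p q k m n i j r : N.

(** ** Definability *)

Lemma ifz_0 c a b x : ev M c x = 0 -> ev M (c_ifz c a b) x = ev M a x.
Proof. intros H. unfold c_ifz. prv1. rewrite H. apply ev_rec_0. Qed.

Lemma O_or_S x : x = 0 \/ exists y, x = s y.
Proof. destruct (O_or_pred M x); eauto. Qed.

Lemma ifz_S c a b x : ev M c x <> 0 -> ev M (c_ifz c a b) x = ev M b x.
Proof.
  intros H. unfold c_ifz, arg_m. prv1. destruct (O_or_S (ev M c x)) as [E|[y E]]; [easy|].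
  rewrite E, ev_rec_S. prv1. reflexivity.
Qed.

(** As in the order relation, 0 is truth. *)
Definition b_not (a : pr) : pr := c_ifz a c_one PZero.
Definition b_and (a b : pr) : pr := c_ifz a b c_one.
Definition b_or (a b : pr) : pr := c_ifz a PZero b.
Definition b_le (a b : pr) : pr := c2 c_monus a b.
Definition b_eq (a b : pr) : pr := b_and (b_le a b) (b_le b a).

Lemma one_neq_0 x : ev M c_one x <> 0.
Proof. unfold c_one. prv1. apply S_O. Qed.

Lemma b_notP a x : ev M (b_not a) x = 0 <-> ev M a x <> 0.
Proof.
  unfold b_not. destruct (classic (ev M a x = 0)) as [H|H].
  - rewrite ifz_0 by trivial. split; [intros K; now apply one_neq_0 in K|easy].
  - rewrite ifz_S by trivial. prv1. easy.
Qed.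
Lemma b_andP a b x : ev M (b_and a b) x = 0 <-> ev M a x = 0 /\ ev M b x = 0.
Proof.
  unfold b_and. destruct (classic (ev M a x = 0)) as [H|H].
  - rewrite ifz_0 by trivial. tauto.
  - rewrite ifz_S by trivial. split; [intros K; now apply one_neq_0 in K|easy].
Qed.
Lemma b_orP a b x : ev M (b_or a b) x = 0 <-> ev M a x = 0 \/ ev M b x = 0.
Proof.
  unfold b_or. destruct (classic (ev M a x = 0)) as [H|H].
  - rewrite ifz_0 by trivial. prv1. tauto.
  - rewrite ifz_S by trivial. tauto.
Qed.
Lemma b_leP a b x : ev M (b_le a b) x = 0 <-> ev M a x <= ev M b x.
Proof. unfold b_le, c2. prv1. reflexivity. Qed.
Lemma b_eqP a b x : ev M (b_eq a b) x = 0 <-> ev M a x = ev M b x.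
Proof.
  unfold b_eq. rewrite b_andP, !b_leP. split.
  - intros [H H']. now apply monus_anti.
  - intros ->. now rewrite monus_diag.
Qed.

(** Functions and predicates with parameters in the structure for which induction is
    available; type class resolution finds them from the shape of [g] and [P]. *)
Class Fun1 (g : N -> N) := fun1 : exists f p, forall x, g x = ev M f (NJ M p x).
Class Dec1 (P : N -> Prop) := dec1 : exists f p, forall x, P x <-> ev M f (NJ M p x) = 0.

#[local] Instance Fun1_const c : Fun1 (fun _ => c) | 0.
Proof. exists PK, c. intros. now prv1. Qed.
#[local] Instance Fun1_id : Fun1 (fun x => x) | 0.
Proof. exists PL, 0. intros. now prv1. Qed.
#[local] Instance Fun1_ev f g : Fun1 g -> Fun1 (fun x => ev M f (g x)) | 1.
Proof. intros [h [p H]]. exists (PComp f h), p. intros. prv1. now rewrite H. Qed.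

(** Two parameters are merged into one. *)
Definition par1 (f : pr) : pr := PComp f (PPair (PComp PK PK) PL).
Definition par2 (f : pr) : pr := PComp f (PPair (PComp PL PK) PL).
Lemma par1P f p q x : ev M (par1 f) (NJ M (NJ M p q) x) = ev M f (NJ M p x).
Proof. unfold par1. now prv1. Qed.
Lemma par2P f p q x : ev M (par2 f) (NJ M (NJ M p q) x) = ev M f (NJ M q x).
Proof. unfold par2. now prv1. Qed.

#[local] Instance Fun1_J g g' : Fun1 g -> Fun1 g' -> Fun1 (fun x => NJ M (g x) (g' x)) | 1.
Proof.
  intros [h [p H]] [h' [p' H']]. exists (PPair (par1 h) (par2 h')), (NJ M p p'). intros.
  now rewrite ev_pair, par1P, par2P, H, H'.
Qed.
(* eta-contracted forms of the previous two, which unification produces *)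
#[local] Instance Fun1_ev1 f : Fun1 (ev M f) | 0 := Fun1_ev f _ Fun1_id.
#[local] Instance Fun1_J1 c : Fun1 (NJ M c) | 0 := Fun1_J _ _ (Fun1_const c) Fun1_id.
#[local] Instance Dec1_eq g h : Fun1 g -> Fun1 h -> Dec1 (fun x => g x = h x) | 1.
Proof.
  intros [f [p H]] [f' [p' H']]. exists (b_eq (par1 f) (par2 f')), (NJ M p p'). intros.
  now rewrite b_eqP, par1P, par2P, H, H'.
Qed.
#[local] Instance Dec1_and P Q : Dec1 P -> Dec1 Q -> Dec1 (fun x => P x /\ Q x) | 1.
Proof.
  intros [f [p H]] [f' [p' H']]. exists (b_and (par1 f) (par2 f')), (NJ M p p'). intros.
  now rewrite b_andP, par1P, par2P, H, H'.
Qed.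
#[local] Instance Dec1_or P Q : Dec1 P -> Dec1 Q -> Dec1 (fun x => P x \/ Q x) | 1.
Proof.
  intros [f [p H]] [f' [p' H']]. exists (b_or (par1 f) (par2 f')), (NJ M p p'). intros.
  now rewrite b_orP, par1P, par2P, H, H'.
Qed.
#[local] Instance Dec1_not P : Dec1 P -> Dec1 (fun x => ~ P x) | 1.
Proof. intros [f [p H]]. exists (b_not f), p. intros. now rewrite b_notP, H. Qed.
#[local] Instance Dec1_imp P Q : Dec1 P -> Dec1 Q -> Dec1 (fun x => P x -> Q x) | 2.
Proof.
  intros [f [p H]] [f' [p' H']]. exists (b_or (b_not (par1 f)) (par2 f')), (NJ M p p'). intros.
  rewrite b_orP, b_notP, par1P, par2P, H, H'.
  destruct (classic (ev M f (NJ M p x) = 0)); tauto.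
Qed.

Lemma N_ind (P : N -> Prop) : Dec1 P ->
  P 0 -> (forall x, P x -> P (s x)) -> forall x, P x.
Proof.
  intros [f [p H]] H0 HS x. rewrite H. revert x. apply ev_ind.
  - now apply H.
  - intros x. rewrite <- !H. auto.
Qed.

Ltac nind x := pattern x; revert x; apply N_ind; [apply _| |].

(** ** Order and the semiring laws *)

Lemma monus_0 x : x - 0 = x.
Proof. unfold c_monus. rewrite ev_rec_0. now prv1. Qed.
Lemma monus_S x y : x - s y = ev M c_pred (x - y).
Proof. unfold c_monus at 1. rewrite ev_rec_S. now prv1. Qed.
Lemma pred_S x : ev M c_pred (s x) = x.
Proof. unfold c_pred, arg_n. prv1. rewrite ev_rec_S. now prv1. Qed.
Lemma pred_0 : ev M c_pred 0 = 0.
Proof. unfold c_pred, arg_n. prv1. rewrite ev_rec_0. now prv1. Qed.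
Lemma monus_SS x y : s x - s y = x - y.
Proof.
  nind y.
  - now rewrite monus_S, !monus_0, pred_S.
  - intros y IH. rewrite (monus_S (s x) (s y)), IH. symmetry. apply monus_S.
Qed.
Lemma zero_le x : 0 <= x.
Proof. nind x. - apply monus_0. - intros x H. rewrite monus_S, H. apply pred_0. Qed.
Lemma le_refl x : x <= x. Proof. apply monus_diag. Qed.
Lemma le_0 x : x <= 0 -> x = 0. Proof. now rewrite monus_0. Qed.
Lemma lt_0 x : ~ x < 0. Proof. rewrite monus_0. apply S_O. Qed.
Lemma lt_S x y : x < s y <-> x <= y. Proof. now rewrite monus_SS. Qed.
Lemma S_lt_S x y : s x < s y <-> x < y. Proof. now rewrite monus_SS. Qed.
Lemma le_or_lt x y : x <= y \/ y < x. Proof. apply monus_cases. Qed.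
Lemma le_anti x y : x <= y -> y <= x -> x = y. Proof. apply monus_anti. Qed.

Lemma lt_le x y : x < y -> x <= y.
Proof.
  destruct (O_or_S y) as [->|[z ->]]; [intros H; now apply lt_0 in H|].
  rewrite monus_SS. intros H. rewrite monus_S, H. apply pred_0.
Qed.
Lemma S_monus_self x : s x - x = 1.
Proof. nind x. - apply monus_0. - intros x H. now rewrite monus_SS. Qed.
Lemma lt_irrefl x : ~ x < x.
Proof. rewrite S_monus_self. apply S_O. Qed.
Lemma le_S x y : x <= y -> x <= s y.
Proof. intros H. rewrite monus_S, H. apply pred_0. Qed.
Lemma le_S_eq x y : x <= s y -> x <= y \/ x = s y.
Proof.
  intros H. destruct (le_or_lt x y) as [K|K]; [now left|right]. now apply le_anti.
Qed.
Lemma not_le_lt x y : ~ x <= y -> y < x.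
Proof. destruct (le_or_lt x y); tauto. Qed.

Lemma add_0 x : x + 0 = x.
Proof. unfold c_add. rewrite ev_rec_0. now prv1. Qed.
Lemma add_S x y : x + s y = s (x + y).
Proof. unfold c_add. rewrite ev_rec_S. now prv1. Qed.
Lemma O_add x : 0 + x = x.
Proof. nind x. - apply add_0. - intros x H. now rewrite add_S, H. Qed.
Lemma S_add x y : s x + y = s (x + y).
Proof. nind y. - now rewrite !add_0. - intros y H. now rewrite !add_S, H. Qed.
Lemma add_comm x y : x + y = y + x.
Proof. nind y. - now rewrite add_0, O_add. - intros y H. now rewrite add_S, S_add, H. Qed.
Lemma add_assoc x y z : x + (y + z) = (x + y) + z.
Proof. nind z. - now rewrite !add_0. - intros z H. now rewrite !add_S, H. Qed.
Lemma mul_0 x : x * 0 = 0.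
Proof. unfold c_mul. rewrite ev_rec_0. now prv1. Qed.
Lemma mul_S x y : x * s y = x * y + x.
Proof. unfold c_mul, c2, arg_m. rewrite ev_rec_S. now prv1. Qed.
Lemma O_mul x : 0 * x = 0.
Proof. nind x. - apply mul_0. - intros x H. now rewrite mul_S, H, add_0. Qed.
Lemma S_mul x y : s x * y = x * y + y.
Proof.
  nind y. - now rewrite !mul_0, add_0.
  - intros y H. rewrite !mul_S, H, !add_S, <- !add_assoc, (add_comm y x). reflexivity.
Qed.
Lemma mul_comm x y : x * y = y * x.
Proof. nind y. - now rewrite mul_0, O_mul. - intros y H. now rewrite mul_S, S_mul, H. Qed.
Lemma mul_add x y z : (x + y) * z = x * z + y * z.
Proof.
  nind z. - now rewrite !mul_0, add_0.
  - intros z H. rewrite !mul_S, H, <- !add_assoc. f_equal. f_equal.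
    rewrite !add_assoc. now rewrite (add_comm _ x).
Qed.
Lemma mul_assoc x y z : x * (y * z) = (x * y) * z.
Proof.
  nind z. - now rewrite !mul_0.
  - intros z H. rewrite !mul_S, <- H, (mul_comm x), mul_add, (mul_comm _ x), (mul_comm y x).
    reflexivity.
Qed.
Lemma one_mul x : 1 * x = x.
Proof. now rewrite S_mul, O_mul, O_add. Qed.

(** For [ring], the operations as constants and the successor as [+ 1]. *)
Definition ring_add x y := x + y.
Definition ring_mul x y := x * y.
Definition ring_one : N := 1.
Lemma S_ring_add x : s x = ring_add x ring_one.
Proof. unfold ring_add, ring_one. now rewrite add_S, add_0. Qed.
Lemma N_semiring : @semi_ring_theory N 0 ring_one ring_add ring_mul eq.
Proof.
  unfold ring_add, ring_mul, ring_one. split; intros.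
  - apply O_add. - apply add_comm. - apply add_assoc. - apply one_mul. - apply O_mul.
  - apply mul_comm. - apply mul_assoc. - apply mul_add.
Qed.
Add Ring N_ring : N_semiring.
Ltac nring :=
  rewrite ?S_ring_add;
  repeat change (ev M c_add (NJ M ?a ?b)) with (ring_add a b);
  repeat change (ev M c_mul (NJ M ?a ?b)) with (ring_mul a b);
  repeat match goal with
  | |- context [ev M c_add (NJ M ?a ?b)] => change (ev M c_add (NJ M a b)) with (ring_add a b)
  | |- context [ev M c_mul (NJ M ?a ?b)] => change (ev M c_mul (NJ M a b)) with (ring_mul a b)
  end;
  ring.

Lemma le_add x y : x <= x + y.
Proof. nind y. - rewrite add_0. apply le_refl. - intros y H. rewrite add_S. now apply le_S. Qed.

Lemma S_monus x y : x <= y -> s y - x = s (y - x).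
Proof.
  nind x.
  - intros _. now rewrite !monus_0.
  - intros x _ H. rewrite monus_SS. destruct (O_or_S (y - x)) as [E|[z E]].
    + exfalso. apply (lt_irrefl x). replace y with x in H; trivial.
      apply le_anti; trivial. now apply lt_le.
    + rewrite monus_S, E, pred_S. reflexivity.
Qed.

Lemma add_monus x y : x <= y -> x + (y - x) = y.
Proof.
  nind y.
  - intros H. apply le_0 in H as ->. now rewrite monus_0, add_0.
  - intros y IH H. apply le_S_eq in H as [H| ->].
    + rewrite S_monus, add_S, IH; trivial.
    + now rewrite monus_diag, add_0.
Qed.

Lemma le_ex x y : x <= y <-> exists z, y = x + z.
Proof.
  split.
  - intros H. exists (y - x). now rewrite add_monus.
  - intros [z ->]. apply le_add.
Qed.
Lemma lt_ex x y : x < y <-> exists z, y = s (x + z).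
Proof. rewrite le_ex. split; intros [z ->]; exists z; now rewrite S_add. Qed.

Tactic Notation "wit" uconstr(w) := first [apply lt_ex | apply le_ex]; exists w; nring.

Lemma le_trans x y z : x <= y -> y <= z -> x <= z.
Proof. rewrite !le_ex. intros [a ->] [b ->]. exists (a + b). nring. Qed.
Lemma lt_le_trans x y z : x < y -> y <= z -> x < z.
Proof. apply le_trans. Qed.
Lemma le_lt_trans x y z : x <= y -> y < z -> x < z.
Proof. intros H. apply le_trans. now rewrite monus_SS. Qed.
Lemma lt_trans x y z : x < y -> y < z -> x < z.
Proof. intros H. apply le_lt_trans. now apply lt_le. Qed.
Lemma lt_self x : x < s x. Proof. rewrite lt_S. apply le_refl. Qed.
Lemma le_self x : x <= s x. Proof. apply lt_le, lt_self. Qed.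
Lemma lt_not_le x y : x < y -> ~ y <= x.
Proof. intros H K. apply (lt_irrefl x). eapply lt_le_trans; eauto. Qed.
Lemma le_lt_eq x y : x <= y -> x < y \/ x = y.
Proof.
  intros H. destruct (le_or_lt y x) as [K|K]; [right; now apply le_anti|now left].
Qed.
Lemma lt_S_cases x y : x < s y -> x < y \/ x = y.
Proof. rewrite lt_S. apply le_lt_eq. Qed.
Lemma lt_or_gt x y : x <> y -> x < y \/ y < x.
Proof. intros H. destruct (le_or_lt x y) as [K|K]; auto. apply le_lt_eq in K as [K|K]; auto; easy. Qed.
Lemma pos_S x : x <> 0 <-> 0 < x.
Proof.
  split.
  - intros H. destruct (O_or_S x) as [E|[y ->]]; [easy|]. rewrite monus_SS. apply zero_le.
  - intros H ->. now apply lt_0 in H.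
Qed.

Lemma add_le x y z w : x <= y -> z <= w -> x + z <= y + w.
Proof. rewrite !le_ex. intros [a ->] [b ->]. exists (a + b). nring. Qed.
Lemma mul_le x y z w : x <= y -> z <= w -> x * z <= y * w.
Proof. rewrite !le_ex. intros [a ->] [b ->]. exists (x * b + a * z + a * b). nring. Qed.
Lemma add_cancel x y z : x + y = x + z -> y = z.
Proof.
  nind x. - now rewrite !O_add. - intros x IH H. rewrite !S_add in H. now apply S_injective, IH in H.
Qed.
Lemma add_eq_0 x y : x + y = 0 -> x = 0 /\ y = 0.
Proof.
  destruct (O_or_S y) as [->|[z ->]].
  - rewrite add_0. auto.
  - rewrite add_S. intros H. now apply S_O in H.
Qed.
Lemma mul_eq_0 x y : x * y = 0 -> x = 0 \/ y = 0.
Proof.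
  destruct (O_or_S x) as [->|[x' ->]]; auto. destruct (O_or_S y) as [->|[y' ->]]; auto.
  rewrite mul_S, add_S. intros H. now apply S_O in H.
Qed.
Lemma mul_cancel x y z : x <> 0 -> x * y = x * z -> y = z.
Proof.
  intros Hx H. destruct (le_or_lt y z) as [I|I].
  - apply le_ex in I as [d ->].
    assert (E : x * d = 0).
    { apply (add_cancel (x * y)). rewrite add_0. rewrite H at 2. nring. }
    apply mul_eq_0 in E as [E| ->]; [easy|]. now rewrite add_0.
  - apply lt_ex in I as [d ->].
    assert (E : x * s d = 0).
    { apply (add_cancel (x * z)). rewrite add_0. rewrite <- H at 2. nring. }
    apply mul_eq_0 in E as [E|E]; [easy|]. now apply S_O in E.
Qed.
Lemma add_monus_l x y : (x + y) - x = y.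
Proof. apply (add_cancel x). apply add_monus, le_add. Qed.
Lemma mul_lt_cancel x y z : x * y < x * z -> y < z.
Proof.
  intros H. apply not_le_lt. intros K. apply (lt_not_le _ _ H), mul_le; trivial. apply le_refl.
Qed.
Lemma mul_one x : x * 1 = x. Proof. now rewrite mul_comm, one_mul. Qed.

(** ** Bounded quantifiers and search *)

Definition b_all (f k : pr) : pr :=
  c2 (PRec PZero (b_and PL (PComp f PK))) PId k.
Definition b_ex (f k : pr) : pr := b_not (b_all (b_not f) k).

Lemma b_allP (f k : pr) x :
  ev M (b_all f k) x = 0 <-> forall i, i < ev M k x -> ev M f (NJ M x i) = 0.
Proof.
  unfold b_all, c2. prv1. set (r := PRec _ _). set (n := ev M k x). clearbody n.
  assert (E0 : ev M r (NJ M x 0) = 0) by (unfold r; rewrite ev_rec_0; now prv1).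
  assert (ES : forall y, ev M r (NJ M x (s y)) = 0 <->
                         ev M r (NJ M x y) = 0 /\ ev M f (NJ M x y) = 0).
  { intros y. unfold r at 1. rewrite ev_rec_S, b_andP. now prv1. }
  split.
  - intros H i. revert H. nind n.
    + intros _ H. now apply lt_0 in H.
    + intros n IH H I. apply ES in H as [H H']. apply lt_S_cases in I as [I| ->]; auto.
  - intros H. enough (K : forall j, j <= n -> ev M r (NJ M x j) = 0) by apply K, le_refl.
    intros j. nind j; trivial. intros j IH I. apply ES. split; auto using lt_le.
Qed.

Lemma b_exP (f k : pr) x :
  ev M (b_ex f k) x = 0 <-> exists i, i < ev M k x /\ ev M f (NJ M x i) = 0.
Proof.
  unfold b_ex. rewrite b_notP, b_allP. setoid_rewrite b_notP. split.
  - intros H. apply NNPP. intros K. apply H. intros i I E. eauto.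
  - intros [i [I E]] H. now apply (H i).
Qed.

#[local] Instance Dec1_all g (Q : N -> N -> Prop) :
  Fun1 g -> Dec1 (fun z => Q (K z) (L z)) -> Dec1 (fun x => forall y, y < g x -> Q x y) | 1.
Proof.
  intros [h [p H]] [f [q E]].
  exists (b_all (PComp f (PPair (PComp PL (PComp PK PK)) (PPair (PComp PL PK) PL))) (par1 h)),
    (NJ M p q).
  intros x. rewrite b_allP, par1P, <- H. prv1.
  split; intros A y I; specialize (A y I).
  - prv1. apply E. now prv1.
  - revert A. prv1. rewrite <- E. now prv1.
Qed.

#[local] Instance Dec1_ex g (Q : N -> N -> Prop) :
  Fun1 g -> Dec1 (fun z => Q (K z) (L z)) -> Dec1 (fun x => exists y, y < g x /\ Q x y) | 1.
Proof.
  intros [h [p H]] [f [q E]].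
  exists (b_ex (PComp f (PPair (PComp PL (PComp PK PK)) (PPair (PComp PL PK) PL))) (par1 h)),
    (NJ M p q).
  intros x. rewrite b_exP, par1P, <- H.
  split; intros [y [I A]]; exists y; split; trivial.
  - prv1. apply E. now prv1.
  - revert A. prv1. rewrite <- E. now prv1.
Qed.

Lemma strong_ind (P : N -> Prop) : Dec1 P ->
  (forall x, (forall y, y < x -> P y) -> P x) -> forall x, P x.
Proof.
  intros D H. enough (A : forall x y, y < x -> P y).
  { intros x. apply (A (s x)), lt_self. }
  assert (D' : Dec1 (fun x => forall y, y < x -> P y)).
  { apply Dec1_all; [apply _|]. destruct D as [f [p E]].
    exists (PComp f (PPair PK (PComp PL PL))), p. intros x. rewrite E. now prv1. }
  apply (N_ind _ D').
  - intros y I. now apply lt_0 in I.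
  - intros x IH y I. apply H. intros z J. apply IH. rewrite lt_S in I. eapply lt_le_trans; eauto.
Qed.

Lemma least (P : N -> Prop) : Dec1 P -> forall x, P x ->
  exists y, y <= x /\ P y /\ forall z, z < y -> ~ P z.
Proof.
  intros D x Px. apply NNPP. intros H.
  assert (A : forall y, ~ (y <= x /\ P y)).
  { apply (strong_ind _ _). intros y IH [I Py]. apply H. exists y. repeat split; trivial.
    intros z J Pz. apply (IH z J). split; trivial. eapply le_trans; [apply lt_le|]; eauto. }
  apply (A x). split; trivial. apply le_refl.
Qed.

Lemma searchP f m k : let r := ev M (c_search f) (NJ M m k) in
  r <= k /\ (forall i, i < r -> ev M f (NJ M m i) <> 0) /\ (r < k -> ev M f (NJ M m r) = 0).
Proof.
  intros r. subst r.
  assert (E0 : ev M (c_search f) (NJ M m 0) = 0)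
    by (unfold c_search; rewrite ev_rec_0; now prv1).
  assert (ES : forall n, let r := ev M (c_search f) (NJ M m n) in
    (ev M f (NJ M m r) = 0 -> ev M (c_search f) (NJ M m (s n)) = r) /\
    (ev M f (NJ M m r) <> 0 -> ev M (c_search f) (NJ M m (s n)) = s r)).
  { intros n r. unfold c_search. rewrite ev_rec_S. fold (c_search f). fold r.
    split; intros H; [rewrite ifz_0|rewrite ifz_S];
      unfold c2, arg_m; prv1; trivial. }
  nind k.
  - rewrite E0. split; [apply le_refl|]. split; intros; exfalso; eapply lt_0; eauto.
  - intros k [I1 [I2 I3]]. destruct (ES k) as [F1 F2]. set (r := ev M (c_search f) (NJ M m k)) in *.
    destruct (classic (ev M f (NJ M m r) = 0)) as [F|F].
    + rewrite (F1 F). split; [now apply le_S|]. split; trivial.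
    + rewrite (F2 F). apply le_lt_eq in I1 as [I1|I1]; [now apply I3 in I1|].
      rewrite I1 in *. split; [apply le_refl|]. split.
      * intros i Hi. apply lt_S_cases in Hi as [Hi| ->]; auto.
      * intros X. now apply lt_irrefl in X.
Qed.

Lemma search_found f m k i : i < k -> ev M f (NJ M m i) = 0 ->
  let r := ev M (c_search f) (NJ M m k) in r <= i /\ ev M f (NJ M m r) = 0.
Proof.
  intros I H r. destruct (searchP f m k) as [A [B C]]. fold r in A, B, C.
  destruct (le_or_lt r i) as [D|D]; [|now apply B in D].
  split; trivial. apply C. eapply le_lt_trans; eauto.
Qed.

(** ** Division and primes *)

Local Notation "d | x" := (rem x d = 0) (at level 70) : pra_scope.

Lemma quotP x d : d <> 0 ->
  d * ev M c_quot (NJ M x d) <= x /\ x < d * s (ev M c_quot (NJ M x d)).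
Proof.
  intros Hd. unfold c_quot. prv1. 
  match goal with |- context [c_search ?g] => set (f := g) end.
  assert (F : forall i, ev M f (NJ M (NJ M x d) i) = 0 <-> x < d * s i).
  { intros i. unfold f, c2, arg_m, arg_n. prv1. reflexivity. }
  destruct (searchP f (NJ M x d) x) as [A [B C]].
  set (r := ev M (c_search f) (NJ M (NJ M x d) x)) in *.
  assert (D : x < d * s r).
  { apply le_lt_eq in A as [A|A]; [now apply F, C|]. rewrite A.
    apply pos_S, lt_ex in Hd as [e ->]. wit (x * e + e). }
  split; trivial. destruct (O_or_S r) as [E|[r' E]].
  - rewrite E, mul_0. apply zero_le.
  - destruct (le_or_lt (d * r) x) as [G|G]; trivial. exfalso.
    apply (B r'); [rewrite E; apply lt_self|]. apply F. now rewrite <- E.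
Qed.

Lemma remE x d : rem x d = x - d * ev M c_quot (NJ M x d).
Proof. unfold c_rem, c2. now prv1. Qed.

Lemma dvdP d x : d | x <-> exists y, x = d * y.
Proof.
  rewrite remE. destruct (classic (d = 0)) as [->|Hd].
  - rewrite O_mul, monus_0. split; [intros ->; exists 0; now rewrite O_mul|].
    intros [y ->]. apply O_mul.
  - destruct (quotP x d Hd) as [A B]. set (r := ev M c_quot (NJ M x d)) in *. split.
    + intros H. exists r. now apply le_anti.
    + intros [y E]. enough (y = r) as <- by (rewrite E; apply le_refl).
      rewrite E in A, B. apply mul_lt_cancel in B. rewrite lt_S in B.
      apply le_anti; trivial. destruct (le_or_lt r y) as [C|C]; trivial. exfalso.
      apply lt_ex in C as [z E']. rewrite E' in A. apply pos_S, lt_ex in Hd as [e Ee].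
      apply (lt_not_le (d * y) (d * s (y + z))); trivial. rewrite Ee. wit (e * s z + z).
Qed.

Lemma rem_decomp x d : d <> 0 -> x = d * ev M c_quot (NJ M x d) + rem x d /\ rem x d < d.
Proof.
  intros Hd. destruct (quotP x d Hd) as [A B]. rewrite remE.
  set (r := ev M c_quot (NJ M x d)) in *. rewrite add_monus by trivial. split; trivial.
  apply le_ex in A as [z E]. rewrite E, add_monus_l. rewrite E in B.
  destruct (le_or_lt d z) as [C|C]; trivial. exfalso. apply le_ex in C as [w ->].
  apply (lt_not_le _ _ B). wit w.
Qed.

Lemma dvd_refl x : x | x.
Proof. apply dvdP. exists 1. now rewrite mul_one. Qed.
Lemma dvd_trans x y z : x | y -> y | z -> x | z.
Proof. rewrite !dvdP. intros [a ->] [b ->]. exists (a * b). nring. Qed.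
Lemma dvd_mul_l x y : x | x * y. Proof. apply dvdP. eauto. Qed.
Lemma dvd_mul_r x y : x | y * x. Proof. rewrite mul_comm. apply dvd_mul_l. Qed.
Lemma one_dvd x : 1 | x. Proof. apply dvdP. exists x. now rewrite one_mul. Qed.
Lemma dvd_le d x : x <> 0 -> d | x -> d <= x.
Proof.
  rewrite dvdP. intros H [y ->]. destruct (O_or_S y) as [->|[z ->]].
  - now rewrite mul_0 in H.
  - wit (d * z).
Qed.
Lemma dvd_sub d x y : d | x -> d | x + y -> d | y.
Proof.
  rewrite !dvdP. intros [a ->] [b E]. destruct (classic (d = 0)) as [->|Hd].
  - exists 0. rewrite !O_mul, O_add in E. now rewrite O_mul.
  - assert (I : d * a <= d * b) by (rewrite <- E; apply le_add).
    destruct (le_or_lt a b) as [C|C].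
    + apply le_ex in C as [c ->]. exists c. apply (add_cancel (d * a)). rewrite E. nring.
    + apply lt_ex in C as [c ->]. exfalso. apply pos_S, lt_ex in Hd as [e ->].
      apply (lt_not_le (s (0 + e) * b) (s (0 + e) * s (b + c))); trivial.
      wit (e * s c + c).
Qed.
Lemma one_lt_2 : 1 < (2 : N). Proof. apply lt_self. Qed.
Lemma not_2_le_1 : ~ 2 <= (1 : N). Proof. apply lt_not_le, one_lt_2. Qed.
Lemma not_2_le_0 : ~ 2 <= (0 : N). Proof. apply lt_0. Qed.
Lemma ge2_neq_0 x : 2 <= x -> x <> 0.
Proof. intros H ->. now apply not_2_le_0. Qed.
Lemma cases2 x : x <> 0 -> x <> 1 -> 2 <= x.
Proof.
  intros H H1. destruct (O_or_S x) as [->|[y ->]]; [easy|].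
  destruct (O_or_S y) as [->|[z ->]]; [easy|]. rewrite !monus_SS. apply zero_le.
Qed.

Lemma lpf_ge x : 2 <= lpf x.
Proof. unfold c_lpf. prv1. rewrite !monus_SS. apply zero_le. Qed.
Lemma lpfP x : 2 <= x -> (lpf x | x) /\ forall d, 2 <= d -> d | x -> lpf x <= d.
Proof.
  intros H. unfold c_lpf. prv1.
  match goal with |- context [c_search ?g] => set (f := g) end.
  assert (F : forall i, ev M f (NJ M x i) = 0 <-> s (s i) | x).
  { intros i. unfold f, c2. prv1. reflexivity. }
  assert (G : forall d, 2 <= d -> d | x ->
    let r := ev M (c_search f) (NJ M x x) in s (s r) <= d /\ s (s r) | x).
  { intros d Hd D. apply le_ex in Hd as [i E]. rewrite !S_add, O_add in E. subst d.
    destruct (search_found f x x i) as [A B].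
    - eapply le_trans; [apply le_self|]. apply dvd_le; trivial. now apply ge2_neq_0.
    - now apply F.
    - split; [|now apply F]. now rewrite !monus_SS. }
  split.
  - apply (G x); trivial. apply dvd_refl.
  - intros d Hd D. now apply G.
Qed.

Lemma primeE x : prime x <-> lpf x = x.
Proof.
  unfold c_notprime, c2. prv1. split.
  - intros H. apply add_eq_0 in H as [A B]. now apply le_anti.
  - intros ->. now rewrite monus_diag, add_0.
Qed.
Lemma prime_ge x : prime x -> 2 <= x.
Proof. intros H. apply primeE in H. rewrite <- H. apply lpf_ge. Qed.
Lemma prime_dvd x d : prime x -> d | x -> d = 1 \/ d = x.
Proof.
  intros P D. pose proof (prime_ge x P) as H.
  destruct (classic (d = 1)) as [|N1]; auto. right.
  assert (N0 : d <> 0).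
  { intros ->. apply dvdP in D as [y E]. rewrite O_mul in E. now apply ge2_neq_0 in H. }
  apply le_anti; [apply dvd_le; trivial; now apply ge2_neq_0|].
  apply primeE in P. rewrite <- P. apply lpfP; trivial. now apply cases2.
Qed.
Lemma lpf_prime x : 2 <= x -> prime (lpf x).
Proof.
  intros H. destruct (lpfP x H) as [A B]. destruct (lpfP (lpf x) (lpf_ge x)) as [A' B'].
  apply primeE, le_anti.
  - apply B'; [apply lpf_ge|apply dvd_refl].
  - apply B; [apply lpf_ge|]. eapply dvd_trans; eauto.
Qed.

(** The least positive [d] with [q | d * b] divides every [c] with [q | c * b], by division
    with remainder; in particular it divides both [q] and [a]. *)
Lemma euclid q a b : prime q -> q | a * b -> (q | a) \/ (q | b).
Proof.
  intros P D. pose proof (ge2_neq_0 _ (prime_ge _ P)) as Hq.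
  destruct (least (fun d => d <> 0 /\ q | d * b) _ q) as [d [_ [[Hd Dd] Min]]].
  { split; trivial. apply dvd_mul_l. }
  assert (G : forall c, q | c * b -> d | c).
  { intros c Dc. destruct (rem_decomp c d Hd) as [E I].
    destruct (classic (rem c d = 0)) as [|R]; trivial. exfalso. apply (Min _ I).
    split; trivial. rewrite E in Dc.
    apply (dvd_sub _ (d * ev M c_quot (NJ M c d) * b)).
    - eapply dvd_trans; [exact Dd|]. apply dvdP. exists (ev M c_quot (NJ M c d)). nring.
    - revert Dc. rewrite mul_add. trivial. }
  destruct (prime_dvd q d P) as [->| ->].
  - apply G, dvd_mul_l.
  - right. now rewrite one_mul in Dd.
  - left. now apply G.
Qed.

Lemma fact_0 : fact 0 = (1 : N).
Proof. unfold c_fact. prv1. rewrite ev_rec_0. unfold c_one. now prv1. Qed.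
Lemma fact_S x : fact (s x) = s x * fact x.
Proof. unfold c_fact, c2, arg_n. prv1. rewrite ev_rec_S. now prv1. Qed.
Lemma fact_pos x : fact x <> 0.
Proof.
  nind x. - rewrite fact_0. apply S_O.
  - intros x H E. rewrite fact_S in E. apply mul_eq_0 in E as [E|E]; [now apply S_O in E|easy].
Qed.
Lemma dvd_fact d x : d <> 0 -> d <= x -> d | fact x.
Proof.
  intros Hd. nind x.
  - intros H. now apply le_0 in H.
  - intros x IH H. rewrite fact_S. apply le_S_eq in H as [H| ->].
    + eapply dvd_trans; [now apply IH|]. apply dvd_mul_r.
    + apply dvd_mul_l.
Qed.

(** Euclid: the least prime factor of [q! + 1] exceeds [q]. *)
Lemma nextprimeP q : q <> 0 -> let r := ev M c_nextprime q in
  prime r /\ q < r /\ forall r', prime r' -> q < r' -> r <= r'.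
Proof.
  intros Hq. unfold c_nextprime. prv1.
  match goal with |- context [c_search ?g] => set (f := g) end.
  assert (F : forall i, ev M f (NJ M q i) = 0 <-> prime (s q + i)).
  { intros i. unfold f, c2. prv1. reflexivity. }
  set (r := ev M (c_search f) (NJ M q (fact q))). cbv zeta.
  assert (G : forall r', prime r' -> q < r' -> r' <= s (fact q) ->
                         prime (s q + r) /\ s q + r <= r').
  { intros r' P I J. apply le_ex in I as [i ->].
    destruct (search_found f q (fact q) i) as [A B].
    - apply pos_S, lt_ex in Hq as [e E].
      rewrite S_add, monus_SS in J. eapply lt_le_trans; [|exact J]. rewrite E. wit e.
    - now apply F.
    - split; [now apply F|]. apply add_le; [apply le_refl|exact A]. }
  assert (P2 : 2 <= s (fact q)).
  { rewrite monus_SS. apply pos_S, fact_pos. }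
  set (l := lpf (s (fact q))).
  assert (Pl : prime l) by now apply lpf_prime.
  assert (Il : q < l).
  { apply not_le_lt. intros I. assert (D : l | (1 : N)).
    { apply (dvd_sub l (fact q)).
      - apply dvd_fact; trivial. apply ge2_neq_0, lpf_ge.
      - rewrite add_S, add_0. now apply lpfP. }
    apply dvd_le in D; [|apply S_O]. apply not_2_le_1.
    eapply le_trans; [apply (prime_ge l Pl)|exact D]. }
  assert (Jl : l <= s (fact q)).
  { apply dvd_le; [apply S_O|]. now apply lpfP. }
  split; [now apply (G l)|]. split; [apply le_add|]. intros r' P I.
  destruct (le_or_lt r' (s (fact q))) as [C|C]; [now apply (G r')|].
  eapply le_trans; [now apply (G l)|]. apply lt_le. eapply le_lt_trans; eauto.
Qed.

Lemma pp_0 : pp 0 = (2 : N).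
Proof. unfold c_prime, c_one. prv1. rewrite ev_rec_0. now prv1. Qed.
Lemma pp_S i : pp (s i) = ev M c_nextprime (pp i).
Proof. unfold c_prime at 1. prv1. rewrite ev_rec_S. unfold c_prime. now prv1. Qed.
Lemma prime_2 : prime (2 : N).
Proof.
  apply primeE, le_anti; [|apply lpf_ge]. apply lpfP; [apply le_refl|apply le_refl|apply dvd_refl].
Qed.
Lemma pp_prime i : prime (pp i).
Proof.
  nind i. - rewrite pp_0. apply prime_2.
  - intros i H. rewrite pp_S. apply nextprimeP. now apply ge2_neq_0, prime_ge.
Qed.
Lemma pp_neq_0 i : pp i <> 0.
Proof. apply ge2_neq_0, prime_ge, pp_prime. Qed.
Lemma pp_lt_S i : pp i < pp (s i).
Proof. rewrite pp_S. apply nextprimeP, pp_neq_0. Qed.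
Lemma pp_mono i j : i < j -> pp i < pp j.
Proof.
  nind j.
  - intros H. now apply lt_0 in H.
  - intros j IH H. apply lt_S_cases in H as [H| ->].
    + eapply lt_trans; [now apply IH|]. apply pp_lt_S.
    + apply pp_lt_S.
Qed.
Lemma pp_inj i j : pp i = pp j -> i = j.
Proof.
  intros H. apply NNPP. intros D. apply lt_or_gt in D as [D|D]; apply pp_mono in D;
    rewrite H in D; now apply lt_irrefl in D.
Qed.
Lemma pp_gt i : s (s i) <= pp i.
Proof.
  nind i. - rewrite pp_0. apply le_refl.
  - intros i H. eapply le_trans; [|apply pp_lt_S]. now rewrite monus_SS.
Qed.
Lemma prime_pp q : prime q -> exists i, pp i = q.
Proof.
  intros P. destruct (least (fun i => q <= pp i) _ q) as [i [_ [H Min]]].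
  { apply lt_le. eapply le_trans; [apply le_self|]. apply pp_gt. }
  exists i. apply le_anti; trivial. destruct (O_or_S i) as [->|[j ->]].
  - rewrite pp_0. now apply prime_ge.
  - rewrite pp_S. apply nextprimeP; trivial; [apply pp_neq_0|].
    apply not_le_lt, Min, lt_self.
Qed.

(** ** Exponents *)

Lemma exp_0 x : x ^ 0 = 1.
Proof. unfold c_exp, c_one. rewrite ev_rec_0. now prv1. Qed.
Lemma exp_S x n : x ^ s n = x ^ n * x.
Proof. unfold c_exp at 1, c2, arg_m. rewrite ev_rec_S. now prv1. Qed.
Lemma exp_add x m n : x ^ (m + n) = x ^ m * x ^ n.
Proof.
  nind n. - now rewrite add_0, exp_0, mul_one.
  - intros n H. rewrite add_S, !exp_S, H. nring.
Qed.
Lemma exp_neq_0 x n : x <> 0 -> x ^ n <> 0.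
Proof.
  intros H. nind n. - rewrite exp_0. apply S_O.
  - intros n IH E. rewrite exp_S in E. apply mul_eq_0 in E as [E|E]; easy.
Qed.
Lemma exp_gt q n : 2 <= q -> n < q ^ n.
Proof.
  intros H. nind n. - rewrite exp_0. apply lt_self.
  - intros n IH. rewrite exp_S. apply le_ex in H as [e ->]. apply le_ex in IH as [d E].
    rewrite E. wit (n + d + d + e * s n + e * d).
Qed.
Lemma exp_dvd q m n : m <= n -> q ^ m | q ^ n.
Proof. intros H. apply le_ex in H as [d ->]. rewrite exp_add. apply dvd_mul_l. Qed.

Lemma val_spec q x : 2 <= q -> x <> 0 -> (q ^ val q x | x) /\ ~ (q ^ s (val q x) | x).
Proof.
  intros Hq Hx. unfold c_val. prv1.
  match goal with |- context [c_search ?g] => set (f := g) end.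
  assert (F : forall i, ev M f (NJ M (NJ M q x) i) = 0 <-> ~ (q ^ s i | x)).
  { intros i. unfold f. change (c_ifz ?a c_one PZero) with (b_not a).
    rewrite b_notP. unfold c2, arg_m, arg_n. prv1. reflexivity. }
  destruct (O_or_S x) as [->|[x' E]]; [easy|].
  destruct (search_found f (NJ M q x) x x') as [A B].
  { rewrite E. apply lt_self. }
  { apply F. intros D. apply dvd_le in D; trivial. rewrite <- E in D.
    apply (lt_not_le _ _ (exp_gt q x Hq)). exact D. }
  split; [|now apply F].
  destruct (searchP f (NJ M q x) x) as [_ [C _]].
  set (r := ev M (c_search f) (NJ M (NJ M q x) x)) in *.
  destruct (O_or_S r) as [->|[r' E']]; [rewrite exp_0; apply one_dvd|].
  rewrite E'. apply NNPP. intros X. apply (C r'); [rewrite E'; apply lt_self|]. now apply F.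
Qed.

Lemma val_ex q x : 2 <= q -> x <> 0 -> exists y, x = q ^ val q x * y /\ ~ (q | y).
Proof.
  intros Hq Hx. destruct (val_spec q x Hq Hx) as [A B]. apply dvdP in A as [y E].
  exists y. split; trivial. intros D. apply B. apply dvdP in D as [z D].
  apply dvdP. exists z. rewrite E at 1. rewrite D, exp_S. nring.
Qed.

Lemma val_unique q v y : 2 <= q -> ~ (q | y) -> val q (q ^ v * y) = v.
Proof.
  intros Hq Hy. assert (Hx : q ^ v * y <> 0).
  { intros E. apply mul_eq_0 in E as [E| ->].
    - apply exp_neq_0 in E; trivial. now apply ge2_neq_0.
    - apply Hy, dvdP. exists 0. now rewrite mul_0. }
  destruct (val_spec q _ Hq Hx) as [A B]. set (r := val q _) in *.
  apply NNPP. intros D. apply lt_or_gt in D as [D|D].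
  - apply B. eapply dvd_trans; [apply exp_dvd, D|]. apply dvd_mul_l.
  - apply Hy. assert (C : q ^ s v | q ^ v * y) by (eapply dvd_trans; [apply exp_dvd, D|exact A]).
    apply dvdP in C as [z C]. apply dvdP. exists z.
    apply (mul_cancel (q ^ v)); [apply exp_neq_0; now apply ge2_neq_0|].
    rewrite C, exp_S. nring.
Qed.

Lemma val_mul q x y : prime q -> x <> 0 -> y <> 0 -> val q (x * y) = val q x + val q y.
Proof.
  intros P Hx Hy. pose proof (prime_ge q P) as Hq.
  destruct (val_ex q x Hq Hx) as [a [Ea Na]]. destruct (val_ex q y Hq Hy) as [b [Eb Nb]].
  replace (x * y) with (q ^ (val q x + val q y) * (a * b)).
  - apply val_unique; trivial. intros D. apply euclid in D as [D|D]; auto.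
  - transitivity ((q ^ val q x * a) * (q ^ val q y * b)); [rewrite exp_add; nring|].
    now rewrite <- Ea, <- Eb.
Qed.
Lemma val_1 q : 2 <= q -> val q 1 = 0.
Proof.
  intros Hq. rewrite <- (mul_one 1), <- (exp_0 q) at 1. apply val_unique; trivial.
  intros D. apply dvd_le in D; [|apply S_O]. apply not_2_le_1. eapply le_trans; eauto.
Qed.
Lemma val_exp q x n : prime q -> x <> 0 -> val q (x ^ n) = val q x * n.
Proof.
  intros P Hx. nind n.
  - rewrite exp_0, mul_0. now apply val_1, prime_ge.
  - intros n IH. rewrite exp_S, val_mul, IH, mul_S; trivial. now apply exp_neq_0.
Qed.
Lemma val_self q : 2 <= q -> val q q = 1.
Proof.
  intros Hq. transitivity (val q (q ^ 1 * 1)).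
  - f_equal. f_equal. rewrite exp_S, exp_0, one_mul, mul_one. reflexivity.
  - apply val_unique; trivial.
    intros D. apply dvd_le in D; [|apply S_O]. apply not_2_le_1. eapply le_trans; eauto.
Qed.
Lemma val_0 q x : 2 <= q -> x <> 0 -> val q x = 0 <-> ~ (q | x).
Proof.
  intros Hq Hx. destruct (val_spec q x Hq Hx) as [A B]. split.
  - intros E. rewrite E in B. rewrite exp_S, exp_0, one_mul in B. exact B.
  - intros D. destruct (O_or_S (val q x)) as [|[v E]]; trivial. exfalso. apply D.
    rewrite E in A. eapply dvd_trans; [|exact A]. rewrite exp_S. apply dvd_mul_r.
Qed.
Lemma val_pp i j : i <> j -> val (pp i) (pp j) = 0.
Proof.
  intros H. apply val_0; [apply prime_ge, pp_prime|apply pp_neq_0|].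
  intros D. apply prime_dvd in D as [D|D]; [| |apply pp_prime].
  - pose proof (prime_ge _ (pp_prime i)) as X. rewrite D in X. now apply not_2_le_1.
  - now apply pp_inj in D.
Qed.

(** Uniqueness of prime factorization, by removing the least prime factor from both
    numbers.  Quantifiers are bounded by [B] to have the statement in the reach of
    induction. *)
Lemma val_ext x y : x <> 0 -> y <> 0 ->
  (forall q, prime q -> val q x = val q y) -> x = y.
Proof.
  intros Hx Hy H.
  enough (A : forall B x, x <= B -> forall y, y < s B -> x <> 0 -> y <> 0 ->
    (forall q, q < s B -> prime q -> val q x = val q y) -> x = y).
  { apply (A (x + y)); trivial.
    - apply le_add.
    - rewrite lt_S, add_comm. apply le_add.
    - auto. }
  clear x y Hx Hy H. intros B x. pattern x; revert x. apply strong_ind; [apply _|].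
  intros x IH I y Iy Hx Hy H. rewrite lt_S in Iy.
  assert (X : forall x y, y <= B -> y <> 0 -> x = 1 ->
    (forall q, q < s B -> prime q -> val q x = val q y) -> y = 1).
  { clear. intros x y Iy Hy -> H. apply NNPP. intros N. pose proof (cases2 y Hy N) as Y.
    apply (val_0 (lpf y) y); trivial; [apply lpf_ge| |now apply lpfP].
    rewrite <- H.
    - apply val_1, lpf_ge.
    - rewrite lt_S. eapply le_trans; [|exact Iy]. apply dvd_le; trivial. now apply lpfP.
    - now apply lpf_prime. }
  destruct (classic (x = 1)) as [E|N]; [rewrite E; symmetry; now apply (X x)|].
  pose proof (cases2 x Hx N) as Hx2. set (q := lpf x).
  assert (P : prime q) by now apply lpf_prime. pose proof (prime_ge q P) as Hq.
  assert (Dx : q | x) by now apply lpfP.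
  assert (Iq : q < s B).
  { rewrite lt_S. eapply le_trans; [|exact I]. now apply dvd_le. }
  assert (Dy : q | y).
  { apply NNPP. intros D. apply val_0 in D; trivial. rewrite <- H in D; trivial.
    now apply val_0 in D. }
  apply dvdP in Dx as [x' Ex]. apply dvdP in Dy as [y' Ey].
  assert (Hx' : x' <> 0) by (intros ->; now rewrite mul_0 in Ex).
  assert (Hy' : y' <> 0) by (intros ->; now rewrite mul_0 in Ey).
  assert (Hq0 : q <> 0) by now apply ge2_neq_0.
  assert (Lt : forall z, z <> 0 -> z < q * z).
  { intros z Hz. apply pos_S, lt_ex in Hz as [e ->]. apply le_ex in Hq as [d ->].
    wit (e + d * s e). }
  assert (E' : x' = y').
  { apply IH; trivial.
    - rewrite Ex. auto.
    - eapply le_trans; [|exact I]. rewrite Ex. now apply lt_le, Lt.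
    - rewrite lt_S. eapply le_trans; [|exact Iy]. rewrite Ey. now apply lt_le, Lt.
    - intros r Ir Pr. specialize (H r Ir Pr). rewrite Ex, Ey, !val_mul in H; trivial.
      now apply add_cancel in H. }
  congruence.
Qed.

(** ** Codes of finite sequences *)

Lemma prod_0 f m : prod f m 0 = 1.
Proof. unfold c_prod, c_one. rewrite ev_rec_0. now prv1. Qed.
Lemma prod_S f m k : prod f m (s k) = prod f m k * pp k ^ ev M f (NJ M m k).
Proof. unfold c_prod at 1. rewrite ev_rec_S. now prv1. Qed.
Lemma pow_neq_0 i n : pp i ^ n <> 0.
Proof. apply exp_neq_0, pp_neq_0. Qed.
Lemma mul_neq_0 x y : x <> 0 -> y <> 0 -> x * y <> 0.
Proof. intros H H' E. apply mul_eq_0 in E as [E|E]; easy. Qed.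
Lemma prod_neq_0 f m k : prod f m k <> 0.
Proof.
  nind k. - rewrite prod_0. apply S_O.
  - intros k H. rewrite prod_S. apply mul_neq_0; trivial. apply pow_neq_0.
Qed.
Lemma val_pow i j n : i <> j -> val (pp i) (pp j ^ n) = 0.
Proof.
  intros H. rewrite val_exp, val_pp, O_mul; trivial; [apply pp_prime|apply pp_neq_0].
Qed.
Lemma val_prod_out f m k i : k <= i -> val (pp i) (prod f m k) = 0.
Proof.
  nind k.
  - intros _. rewrite prod_0. apply val_1, prime_ge, pp_prime.
  - intros k IH H. rewrite prod_S, val_mul, IH, val_pow, add_0; trivial.
    + intros E. rewrite E in H. now apply lt_irrefl in H.
    + now apply lt_le.
    + apply pp_prime.
    + apply prod_neq_0.
    + apply pow_neq_0.
Qed.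
Lemma val_prod f m k i : i < k -> val (pp i) (prod f m k) = ev M f (NJ M m i).
Proof.
  pose proof (pp_prime i) as Pi.
  nind k.
  - intros H. now apply lt_0 in H.
  - intros k IH H. rewrite prod_S, val_mul; trivial; [|apply prod_neq_0|apply pow_neq_0].
    apply lt_S_cases in H as [H|E].
    + rewrite IH, val_pow, add_0; trivial. intros E. rewrite E in H. now apply lt_irrefl in H.
    + rewrite <- E, val_prod_out, O_add by apply le_refl.
      rewrite val_exp, val_self, one_mul; trivial; [now apply prime_ge|apply pp_neq_0].
Qed.

Lemma code_0 f m : code f m 0 = 0.
Proof. unfold c_code. rewrite ifz_0; now prv1. Qed.
Lemma code_S f m k : s (code f m (s k)) = pp k * prod f m (s k).
Proof.
  unfold c_code. rewrite ifz_S by (prv1; apply S_O). prv1. rewrite pred_S.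
  destruct (O_or_S (pp k * prod f m (s k))) as [E|[y E]].
  - apply mul_eq_0 in E as [E|E]; [now apply pp_neq_0 in E|now apply prod_neq_0 in E].
  - rewrite E. now rewrite pred_S.
Qed.

(** The exponents of a number [x + 1] determine the sequence coded by [x]: it ends
    at the last prime that occurs, whose exponent counts one too many. *)

Lemma vl_dvd x i : vl x i = 0 <-> ~ (pp i | s x).
Proof. apply val_0; [apply prime_ge, pp_prime|apply S_O]. Qed.

Lemma lenP x :
  (forall i, len x <= i -> vl x i = 0) /\
  (len x = 0 \/ exists r, len x = s r /\ vl x r <> 0) /\ len x <= x.
Proof.
  unfold c_length. prv1. set (R := PRec _ _).
  assert (E0 : ev M R (NJ M x 0) = 0) by (unfold R; rewrite ev_rec_0; now prv1).
  assert (ES : forall n, (vl x n <> 0 -> ev M R (NJ M x (s n)) = s n) /\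
                         (vl x n = 0 -> ev M R (NJ M x (s n)) = ev M R (NJ M x n))).
  { intros n. rewrite vl_dvd.
    split; intros H; unfold R; rewrite ev_rec_S; [rewrite ifz_0|rewrite ifz_S];
      unfold arg_n, arg_m; prv1; trivial. now apply NNPP. }
  assert (Out : forall i, x <= i -> vl x i = 0).
  { intros i I. apply vl_dvd. intros D. apply dvd_le in D; [|apply S_O].
    apply (lt_not_le (s x) (pp i)); trivial.
    eapply lt_le_trans; [|apply pp_gt]. now rewrite !monus_SS. }
  assert (A : forall n, (forall i, i < x -> ev M R (NJ M x n) <= i -> i < n -> vl x i = 0) /\
    (ev M R (NJ M x n) = 0 \/ exists r, r < n /\ (ev M R (NJ M x n) = s r /\ vl x r <> 0)) /\
    ev M R (NJ M x n) <= n).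
  { intros n. nind n.
    - rewrite E0. split; [|split; [auto|apply le_refl]].
      intros i _ _ H. now apply lt_0 in H.
    - intros n [I1 [I2 I3]]. destruct (ES n) as [F1 F2].
      destruct (classic (vl x n = 0)) as [F|F].
      + rewrite (F2 F). split; [|split].
        * intros i X A B. apply lt_S_cases in B as [B| ->]; auto.
        * destruct I2 as [I2|[r [H1 [H2 H3]]]]; [auto|right].
          exists r. split; auto. rewrite lt_S. now apply lt_le.
        * now apply le_S.
      + rewrite (F1 F). split; [|split].
        * intros i _ A B. rewrite lt_S in B. now apply (lt_not_le n i) in A.
        * right. exists n. split; auto. apply lt_self.
        * apply le_refl. }
  destruct (A x) as [A1 [A2 A3]]. split; [|split]; trivial.
  - intros i H. destruct (le_or_lt x i) as [I|I]; auto.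
  - destruct A2 as [A2|[r [_ A2]]]; eauto.
Qed.

Lemma len_le x : len x <= x.
Proof. apply lenP. Qed.
Lemma len_0 : len 0 = (0 : N).
Proof. apply le_0, len_le. Qed.

Lemma len_unique x k : (forall i, k <= i -> vl x i = 0) ->
  (k = 0 \/ exists r, k = s r /\ vl x r <> 0) -> len x = k.
Proof.
  intros H1 H2. destruct (lenP x) as [L1 [L2 _]]. apply NNPP. intros D.
  apply lt_or_gt in D as [D|D].
  - destruct H2 as [->|[r [-> H2]]]; [now apply lt_0 in D|]. apply H2, L1. now rewrite lt_S in D.
  - destruct L2 as [E|[r [E L2]]]; [rewrite E in D; now apply lt_0 in D|].
    apply L2, H1. rewrite E in D. now rewrite lt_S in D.
Qed.

Lemma entry_last x i : len x <= s i -> entry x i = ev M c_pred (vl x i).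
Proof. intros H. unfold c_entry. rewrite ifz_0; now prv1. Qed.
Lemma entry_inner x i : s i < len x -> entry x i = vl x i.
Proof.
  intros H. unfold c_entry. rewrite ifz_S; prv1; trivial. now apply lt_not_le.
Qed.
Lemma entry_out x i : len x <= i -> entry x i = 0.
Proof.
  intros H. rewrite entry_last by now apply le_S.
  replace (vl x i) with (0 : N); [apply pred_0|]. symmetry. now apply lenP.
Qed.

Lemma vl_code f m k i : i < s k ->
  vl (code f m (s k)) i = val (pp i) (pp k) + ev M f (NJ M m i).
Proof.
  intros H. rewrite code_S, val_mul, val_prod; trivial.
  - apply pp_prime. - apply pp_neq_0. - apply prod_neq_0.
Qed.
Lemma len_code f m k : len (code f m k) = k.
Proof.
  destruct (O_or_S k) as [->|[j ->]]; [rewrite code_0; apply len_0|].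
  apply len_unique.
  - intros i H. rewrite code_S, val_mul, val_prod_out, val_pp; trivial.
    + apply add_0. + intros E. rewrite E in H. now apply lt_irrefl in H.
    + apply pp_prime. + apply pp_neq_0. + apply prod_neq_0.
  - right. exists j. split; trivial. rewrite vl_code by apply lt_self.
    rewrite val_self by apply prime_ge, pp_prime. rewrite S_add. apply S_O.
Qed.
Lemma entry_code f m k i : i < k -> entry (code f m k) i = ev M f (NJ M m i).
Proof.
  intros H. destruct (O_or_S k) as [->|[j ->]]; [now apply lt_0 in H|].
  destruct (lt_S_cases _ _ H) as [I| ->].
  - rewrite entry_inner by (rewrite len_code; now rewrite S_lt_S).
    rewrite vl_code, val_pp, O_add; trivial. intros E. rewrite E in I. now apply lt_irrefl in I.
  - rewrite entry_last by (rewrite len_code; apply le_refl).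
    rewrite vl_code by trivial. rewrite val_self by apply prime_ge, pp_prime.
    now rewrite S_add, O_add, pred_S.
Qed.

(** Every number is determined by the sequence that it codes.  The exponent of the last
    prime is recovered because it is positive ([lenP]). *)
Lemma code_ext x y : len x = len y ->
  (forall i, i < len x -> entry x i = entry y i) -> x = y.
Proof.
  intros HL HE. apply S_injective. apply val_ext; try apply S_O.
  intros q P. destruct (prime_pp q P) as [i <- ]. destruct (le_or_lt (len x) i) as [I|I].
  - destruct (lenP x) as [X _], (lenP y) as [Y _]. rewrite X, Y; trivial. congruence.
  - specialize (HE i I). destruct (le_or_lt (len x) (s i)) as [D|D].
    + assert (Last : forall z, i < len z -> len z <= s i -> vl z i = s (entry z i)).
      { clear. intros z I D. rewrite entry_last by trivial.
        destruct (lenP z) as [_ [[E|[r [E H]]] _]].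
        - rewrite E in I. now apply lt_0 in I.
        - assert (r = i) as ->.
          { apply S_injective. rewrite <- E. now apply le_anti. }
          now destruct (O_or_pred M (vl z i)). }
      rewrite !Last; congruence.
    + rewrite !entry_inner in HE; congruence.
Qed.

Lemma len_sing x : len (sing x) = 1.
Proof. unfold c_sing, c_one. prv1. apply len_code. Qed.
Lemma entry_sing x : entry (sing x) 0 = x.
Proof.
  unfold c_sing, c_one. prv1. rewrite entry_code by apply lt_self. now prv1.
Qed.
Lemma len_cat x y : len (cat x y) = len x + len y.
Proof. unfold c_cat. prv1. apply len_code. Qed.
Lemma entry_cat_l x y i : i < len x -> entry (cat x y) i = entry x i.
Proof.
  intros H. unfold c_cat. prv1. rewrite entry_code.
  - rewrite ifz_0; unfold arg_m; now prv1.
  - eapply lt_le_trans; [exact H|apply le_add].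
Qed.
Lemma entry_cat_r x y i : i < len y -> entry (cat x y) (len x + i) = entry y i.
Proof.
  intros H. unfold c_cat. prv1. rewrite entry_code.
  - rewrite ifz_S; unfold arg_m, arg_n; prv1.
    + now rewrite add_monus_l.
    + apply lt_not_le. rewrite lt_S. apply le_add.
  - apply le_ex in H as [z ->]. wit z.
Qed.

Lemma init_len x : init x (len x) = x.
Proof.
  apply code_ext; [apply len_code|]. rewrite len_code. intros i H. now apply entry_code.
Qed.
Lemma init_eq x y n : (forall i, i < n -> entry x i = entry y i) -> init x n = init y n.
Proof.
  intros H. apply code_ext; rewrite !len_code; trivial. intros i I.
  rewrite !entry_code; auto.
Qed.
Lemma init_init x n m : n <= m -> init (init x m) n = init x n.
Proof. intros H. apply init_eq. intros i I. apply entry_code. eapply lt_le_trans; eauto. Qed.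

Lemma bndE k : bnd k = pp k * prod c_one 0 k.
Proof. unfold c_bnd. now prv1. Qed.

Lemma pow_le i n m : n <= m -> pp i ^ n <= pp i ^ m.
Proof. intros H. apply dvd_le; [apply pow_neq_0|now apply exp_dvd]. Qed.
Lemma prod_le f m k : (forall i, i < k -> ev M f (NJ M m i) < 2) ->
  prod f m k <= prod c_one 0 k.
Proof.
  intros H. enough (A : forall j, j <= k -> prod f m j <= prod c_one 0 j) by apply A, le_refl.
  intros j. nind j.
  - intros _. rewrite !prod_0. apply le_refl.
  - intros j IH I. rewrite !prod_S. apply mul_le; [now apply IH, lt_le|]. apply pow_le.
    unfold c_one. prv1. rewrite <- lt_S. now apply H.
Qed.
Lemma binary_lt x : (forall i, i < len x -> entry x i < 2) -> x < bnd (len x).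
Proof.
  intros H. rewrite <- (init_len x) at 1. rewrite bndE.
  destruct (O_or_S (len x)) as [E|[k E]]; rewrite E in *.
  - rewrite code_0, pp_0, prod_0, mul_one. apply le_self.
  - rewrite code_S. apply mul_le; [apply lt_le, pp_lt_S|now apply prod_le].
Qed.
Lemma bnd_mono n m : n <= m -> bnd n <= bnd m.
Proof.
  nind m.
  - intros H. apply le_0 in H as ->. apply le_refl.
  - intros m IH H. apply le_S_eq in H as [H| ->]; [|apply le_refl].
    eapply le_trans; [now apply IH|]. rewrite !bndE. apply mul_le; [apply lt_le, pp_lt_S|].
    rewrite prod_S. apply dvd_le; [|apply dvd_mul_l].
    apply mul_neq_0; [apply prod_neq_0|apply pow_neq_0].
Qed.

(** [sum_(j<n) (<i> * j + 1)].  Nothing is claimed about the growth of [<i> * j] in [j], so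
    a sum serves as upper bound. *)
Definition c_total : pr :=
  PRec PZero (c2 c_add PL (PComp PSucc (c2 c_cat (PComp c_sing arg_m) arg_n))).
Lemma totalP i n j : j < n -> cat (sing i) j < ev M c_total (NJ M i n).
Proof.
  nind n.
  - intros I. now apply lt_0 in I.
  - intros n IH I. unfold c_total. rewrite ev_rec_S. fold c_total. unfold arg_m, arg_n. prv1.
    apply lt_S_cases in I as [I| ->].
    + eapply lt_le_trans; [now apply IH|]. apply le_add.
    + rewrite add_comm. apply le_add.
Qed.
End NumberTheory.

(** * Secured sequences *)

(** Unlike above, one primitive recursive function without parameters works in all
    structures, so that it can occur in formulas.  Resolution extracts the function from
    the shape of the predicate. *)
Class FunU (g : forall M, N M -> N M) :=
  { fun_pr : pr; fun_prP : forall M x, ev M fun_pr x = g M x }.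
Class DecU (P : forall M, N M -> Prop) :=
  { dec_pr : pr; dec_prP : forall M x, ev M dec_pr x = N0 M <-> P M x }.
Arguments fun_pr g {_}.
Arguments dec_pr P {_}.

#[local] Instance FunU_id : FunU (fun M x => x) | 0.
Proof. exists PId. intros. apply ev_Id. Defined.
#[local] Instance FunU_0 : FunU (fun M _ => N0 M) | 0.
Proof. exists PZero. intros. apply ev_Zero. Defined.
#[local] Instance FunU_ev f g : FunU g -> FunU (fun M x => ev M f (g M x)) | 1.
Proof. intros [h H]. exists (PComp f h). intros. now rewrite ev_comp, H. Defined.
#[local] Instance FunU_J g h :
  FunU g -> FunU h -> FunU (fun M x => NJ M (g M x) (h M x)) | 1.
Proof. intros [f H] [f' H']. exists (PPair f f'). intros. now rewrite ev_pair, H, H'. Defined.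
#[local] Instance DecU_eq g h : FunU g -> FunU h -> DecU (fun M x => g M x = h M x) | 1.
Proof. intros [f H] [f' H']. exists (b_eq f f'). intros. now rewrite b_eqP, H, H'. Defined.
#[local] Instance DecU_and P Q : DecU P -> DecU Q -> DecU (fun M x => P M x /\ Q M x) | 1.
Proof. intros [f H] [f' H']. exists (b_and f f'). intros. now rewrite b_andP, H, H'. Defined.
#[local] Instance DecU_or P Q : DecU P -> DecU Q -> DecU (fun M x => P M x \/ Q M x) | 1.
Proof. intros [f H] [f' H']. exists (b_or f f'). intros. now rewrite b_orP, H, H'. Defined.
#[local] Instance DecU_not P : DecU P -> DecU (fun M x => ~ P M x) | 1.
Proof. intros [f H]. exists (b_not f). intros. now rewrite b_notP, H. Defined.
#[local] Instance DecU_imp P Q : DecU P -> DecU Q -> DecU (fun M x => P M x -> Q M x) | 2.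
Proof.
  intros [f H] [f' H']. exists (b_or (b_not f) f'). intros. rewrite b_orP, b_notP, H, H'.
  destruct (classic (P M x)); tauto.
Defined.
#[local] Instance DecU_all g (Q : forall M, N M -> N M -> Prop) :
  FunU g -> DecU (fun M z => Q M (K z) (L z)) ->
  DecU (fun M x => forall y, y < g M x -> Q M x y) | 1.
Proof.
  intros [h H] [f E]. exists (b_all f h). intros. rewrite b_allP, H.
  split; intros A y I; specialize (A y I).
  - apply E in A. now rewrite ev_K, ev_L in A.
  - apply E. now rewrite ev_K, ev_L.
Defined.
#[local] Instance DecU_ex g (Q : forall M, N M -> N M -> Prop) :
  FunU g -> DecU (fun M z => Q M (K z) (L z)) ->
  DecU (fun M x => exists y, y < g M x /\ Q M x y) | 1.
Proof.
  intros [h H] [f E]. exists (b_ex f h). intros. rewrite b_exP, H.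
  split; intros [y [I A]]; exists y; split; trivial.
  - apply E in A. now rewrite ev_K, ev_L in A.
  - apply E. now rewrite ev_K, ev_L.
Defined.

(** The least [y < g(x)] with [~ Q x y], or [g(x)] if there is none.  By means of this
    function a bounded universal hypothesis becomes quantifier-free: it suffices that [Q]
    holds at this one place ([failP]). *)
Definition c_fail g (Q : forall M, N M -> N M -> Prop)
  {Fg : FunU g} {DQ : DecU (fun M z => Q M (K z) (L z))} : pr :=
  c2 (c_search (b_not (dec_pr (fun M z => Q M (K z) (L z))))) PId (fun_pr g).
Arguments c_fail g Q {_ _}.

Lemma failP g Q {Fg : FunU g} {DQ : DecU (fun M z => Q M (K z) (L z))} M (x : N M) :
  let w := ev M (c_fail g Q) x in
  (w < g M x -> Q M x w) -> forall y, y < g M x -> Q M x y.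
Proof.
  unfold c_fail. rewrite ev_c2, ev_Id, fun_prP. cbv zeta. intros H y I. apply NNPP. intros NQ.
  destruct (search_found (b_not (dec_pr (fun M z => Q M (K z) (L z)))) x (g M x) y I) as [A B].
  - rewrite b_notP, dec_prP, ev_K, ev_L. exact NQ.
  - rewrite b_notP, dec_prP, ev_K, ev_L in B. apply B, H. eapply le_lt_trans; eauto.
Qed.

Definition c_tail : pr := c2 (c_code (c2 c_entry PK (PComp PSucc PL))) PId (PComp c_pred c_length).
(** [(x,i,n) |-> <x(<i>*0), ..., x(<i>*(n-1))>]: what [x] says about the [i]-th
    subsequence. *)
Definition c_part : pr :=
  c_code (c2 c_entry (PComp PK PK) (c2 c_cat (PComp c_sing (PComp PL PK)) PL)).
Local Notation tail w := (ev _ c_tail w).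
Local Notation part x i n := (ev _ c_part (NJ _ (NJ _ x i) n)).

Section Secured.
Context {M : PRA}.
Local Notation N := (N M).
Implicit Types a b q t u w x i j k n m : N.

Definition Bin t : Prop := forall i, i < len t -> entry t i < 2.
Definition Agree t u : Prop := forall i, i < len t -> i < len u -> entry t i = entry u i.

(** Throughout, [a] codes a long initial segment of the function that gives the bar. *)
Definition Hit a t : Prop := exists n, n < s (len t) /\ entry a (init t n) <> 0.
(** [q] is secured at stage [k].  The bound on [t] holds for all binary sequences of length
    [k] ([sec_iff]).  If [q] is longer than [k], only its first [k] values matter. *)
Definition Sec a k q : Prop :=
  forall t, t < bnd k -> len t = k /\ Bin t /\ Agree t q -> Hit a t.
Definition Ahead a q i k : Prop :=
  Sec a k (cat q (sing i)) /\ ~ Sec a k (cat q (sing (1 - i))) /\ ~ Sec a k 0.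
Definition AheadBy a q i n : Prop := exists k, k < s n /\ Ahead a q i k.
(** With [w = <i> * u], this is membership of [u] in the [i]-th of the two bars to which
    the contraposed choice principle is applied. *)
Definition Live a q w : Prop :=
  entry a (tail w) <> 0 /\ ~ AheadBy a q (entry w 0) (len (tail w)).
(** The [i]-th subsequence of any extension of [x] meets the bar, and [x] shows it: all
    positions [<i> * j] that are needed lie below the length of [x]. *)
Definition Meets x i a : Prop :=
  exists n, n < s (len x) /\
    ((forall j, j < n -> cat (sing i) j < len x) /\ entry a (part x i n) <> 0).
End Secured.

Lemma DecU_sub P g : DecU P -> FunU g -> DecU (fun M x => P M (g M x)).
Proof. intros [f H] [f' H']. exists (PComp f f'). intros. now rewrite ev_comp, H', H. Defined.
Lemma DecU_ext P Q : DecU P -> (forall M x, P M x <-> Q M x) -> DecU Q.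
Proof. intros [f H] E. exists f. intros. now rewrite H. Defined.
Lemma DecU_sub2 (R : forall M, N M -> N M -> Prop) f g :
  DecU (fun M z => R M (K z) (L z)) -> FunU f -> FunU g ->
  DecU (fun M x => R M (f M x) (g M x)).
Proof.
  intros D F F'. refine (DecU_ext _ _ (DecU_sub _ (fun M x => NJ M (f M x) (g M x)) D _) _).
  intros. now rewrite ev_K, ev_L.
Defined.
Lemma DecU_sub3 (R : forall M, N M -> N M -> N M -> Prop) f g h :
  DecU (fun M z => R M (K (K z)) (L (K z)) (L z)) -> FunU f -> FunU g -> FunU h ->
  DecU (fun M x => R M (f M x) (g M x) (h M x)).
Proof.
  intros D F F' F''.
  refine (DecU_ext _ _ (DecU_sub _ (fun M x => NJ M (NJ M (f M x) (g M x)) (h M x)) D _) _).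
  intros. now rewrite !ev_K, !ev_L.
Defined.
Lemma DecU_sub4 (R : forall M, N M -> N M -> N M -> N M -> Prop) f g h e :
  DecU (fun M z => R M (K (K (K z))) (L (K (K z))) (L (K z)) (L z)) ->
  FunU f -> FunU g -> FunU h -> FunU e ->
  DecU (fun M x => R M (f M x) (g M x) (h M x) (e M x)).
Proof.
  intros D F F' F'' F3.
  refine (DecU_ext _ _
    (DecU_sub _ (fun M x => NJ M (NJ M (NJ M (f M x) (g M x)) (h M x)) (e M x)) D _) _).
  intros. now rewrite !ev_K, !ev_L.
Defined.

#[local] Instance DecU_Bin f : FunU f -> DecU (fun M x => Bin (f M x)).
Proof. apply DecU_sub. unfold Bin. apply _. Defined.
#[local] Instance DecU_Agree f g : FunU f -> FunU g -> DecU (fun M x => Agree (f M x) (g M x)).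
Proof. apply DecU_sub2. unfold Agree. apply _. Defined.
#[local] Instance DecU_Hit f g : FunU f -> FunU g -> DecU (fun M x => Hit (f M x) (g M x)).
Proof. apply DecU_sub2. unfold Hit. apply _. Defined.
#[local] Instance DecU_Sec f g h : FunU f -> FunU g -> FunU h ->
  DecU (fun M x => Sec (f M x) (g M x) (h M x)).
Proof. apply DecU_sub3. unfold Sec. apply _. Defined.
#[local] Instance DecU_Ahead f g h e : FunU f -> FunU g -> FunU h -> FunU e ->
  DecU (fun M x => Ahead (f M x) (g M x) (h M x) (e M x)).
Proof. apply DecU_sub4. unfold Ahead. apply _. Defined.
#[local] Instance DecU_AheadBy f g h e : FunU f -> FunU g -> FunU h -> FunU e ->
  DecU (fun M x => AheadBy (f M x) (g M x) (h M x) (e M x)).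
Proof. apply DecU_sub4. unfold AheadBy. apply _. Defined.
#[local] Instance DecU_Live f g h : FunU f -> FunU g -> FunU h ->
  DecU (fun M x => Live (f M x) (g M x) (h M x)).
Proof. apply DecU_sub3. unfold Live. apply _. Defined.
#[local] Instance DecU_Meets f g h : FunU f -> FunU g -> FunU h ->
  DecU (fun M x => Meets (f M x) (g M x) (h M x)).
Proof. apply DecU_sub3. unfold Meets. apply _. Defined.

Definition c_bin : pr := dec_pr (fun M x => Bin x).
Definition c_agree : pr := dec_pr (fun M z => Agree (K z) (L z)).
Definition c_sec : pr := dec_pr (fun M z => Sec (K (K z)) (L (K z)) (L z)).
Definition c_ahead : pr :=
  dec_pr (fun M z => Ahead (K (K (K z))) (L (K (K z))) (L (K z)) (L z)).
(* The next two are positive where the property holds, as the values of a bar are. *)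
Definition c_live : pr := dec_pr (fun M z => ~ Live (L (L z)) (K (L z)) (K z)).
Definition c_meets : pr :=
  dec_pr (fun M z => ~ (Meets (K z) 0 (K (L z)) \/ Meets (K z) 1 (L (L z)))).
(** The value [(q,i) + 1] at [((q,i),k)] if the [i]-th successor of [q] is ahead at
    stage [k], for the enumeration of all such pairs. *)
Definition c_enum : pr :=
  let p := PK in let q := PComp PK (PComp PK p) in let i := PComp PL (PComp PK p) in
  c_ifz (c2 c_ahead (PPair (PPair PL q) i) (PComp PL p)) (PComp PSucc (PComp PK p)) PZero.
(** [(n,(t0,t1)) |->] the [n]-th value of a sequence whose subsequences are [t0] and [t1],
    continued by zeros. *)
Definition c_comb : pr :=
  c_ifz (c2 c_entry PK PZero)
    (c2 c_entry (PComp PK PL) (PComp c_tail PK)) (c2 c_entry (PComp PL PL) (PComp c_tail PK)).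
(** An initial segment of this length shows that the [i]-th subsequence meets the bar at
    [u]; the length is above [u] as well, so that a segment of the bar of the same length
    contains the value at [u]. *)
Definition c_need : pr :=
  c2 c_add (c2 c_add (PComp PSucc PL) (PComp c_length PL))
    (c2 c_total PK (PComp c_length PL)).

Definition w_bin : pr := c_fail (fun M x => len x) (fun M x i => entry x i < 2).
Definition w_agree : pr := c_fail (fun M z => len (K z))
  (fun M z i => i < len (L z) -> entry (K z) i = entry (L z) i).
Definition w_miss : pr := c_fail (fun M z => bnd (L z))
  (fun M z t => ~ (len t = L z /\ Bin t /\ ~ Hit (K z) t)).
Definition w_hit : pr := c_fail (fun M z => s (len (L z)))
  (fun M z n => entry (K z) (init (L z) n) = 0).
Definition w_part : pr := c_fail (fun M z => len (L z))
  (fun M z j => entry (K (K z)) (cat (sing (L (K z))) j) = entry (L z) j).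
Definition w_comb : pr := c_fail (fun M z => len (K z))
  (fun M z j => entry (K z) j = ev M c_comb (NJ M j (L z))).

Section Facts.
Context {M : PRA}.
Local Notation N := (N M).
Implicit Types a b q t u w x i j k n m : N.

Ltac spec d := unfold d; rewrite dec_prP; repeat rewrite ?ev_K, ?ev_L; reflexivity.
Lemma binP t : ev M c_bin t = 0 <-> Bin t.
Proof. spec c_bin. Qed.
Lemma agreeP t u : ev M c_agree (NJ M t u) = 0 <-> Agree t u.
Proof. spec c_agree. Qed.
Lemma secP a k q : ev M c_sec (NJ M (NJ M a k) q) = 0 <-> Sec a k q.
Proof. spec c_sec. Qed.
Lemma aheadP a q i k : ev M c_ahead (NJ M (NJ M (NJ M a q) i) k) = 0 <-> Ahead a q i k.
Proof. spec c_ahead. Qed.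
Lemma liveP a q w : ev M c_live (NJ M w (NJ M q a)) <> 0 <-> Live a q w.
Proof. unfold c_live. rewrite dec_prP. repeat rewrite ?ev_K, ?ev_L. split; [apply NNPP|tauto]. Qed.
Lemma meetsP x a b : ev M c_meets (NJ M x (NJ M a b)) <> 0 <-> Meets x 0 a \/ Meets x 1 b.
Proof. unfold c_meets. rewrite dec_prP. repeat rewrite ?ev_K, ?ev_L. split; [apply NNPP|tauto]. Qed.

Lemma len_tail w : len (tail w) = ev M c_pred (len w).
Proof. unfold c_tail. rewrite ev_c2, ev_Id, ev_comp. apply len_code. Qed.
Lemma len_cons i u : len (cat (sing i) u) = s (len u).
Proof. now rewrite len_cat, len_sing, S_add, O_add. Qed.
Lemma head_cons i u : entry (cat (sing i) u) 0 = i.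
Proof. rewrite entry_cat_l, entry_sing; trivial. rewrite len_sing. apply lt_self. Qed.
Lemma tail_cons i u : tail (cat (sing i) u) = u.
Proof.
  assert (E : len (tail (cat (sing i) u)) = len u) by now rewrite len_tail, len_cons, pred_S.
  apply code_ext; trivial. rewrite E. intros j I.
  unfold c_tail. rewrite ev_c2, ev_Id, ev_comp, entry_code by now rewrite len_cons, pred_S.
  rewrite ev_c2, ev_comp, ev_K, ev_L. rewrite <- (entry_cat_r (sing i) u j I), len_sing.
  now rewrite S_add, O_add.
Qed.

Lemma entry_bound a u : entry a u <> 0 -> u < len a.
Proof.
  intros H. apply not_le_lt. intros I. apply H. now apply entry_out.
Qed.
Lemma init_bin t n : Bin t -> n <= len t -> Bin (init t n).
Proof.
  intros B I i. rewrite len_code. intros J. rewrite entry_code by trivial. apply B.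
  eapply lt_le_trans; eauto.
Qed.
Lemma init_agree t q n : Agree t q -> n <= len t -> Agree (init t n) q.
Proof.
  intros A I i. rewrite len_code. intros J J'. rewrite entry_code by trivial. apply A; trivial.
  exact (lt_le_trans _ _ _ J I).
Qed.
Lemma init_lt t k n : Bin t -> n <= len t -> len t <= k -> init t n < bnd k.
Proof.
  intros B I I'. eapply lt_le_trans.
  - apply binary_lt. now apply init_bin.
  - rewrite len_code. apply bnd_mono. eapply le_trans; eauto.
Qed.
Lemma agree_sym t u : Agree t u -> Agree u t.
Proof. intros A i I J. symmetry. now apply A. Qed.
Lemma agree_entry a b u : Agree a b -> u < len b -> entry a u <> 0 -> entry b u <> 0.
Proof. intros A I H. rewrite <- (A u); trivial. now apply entry_bound. Qed.

Lemma sec_iff a k q :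
  Sec a k q <-> forall t, len t = k -> Bin t -> Agree t q -> Hit a t.
Proof.
  split.
  - intros H t E B A. apply H; auto. rewrite <- E. now apply binary_lt.
  - intros H t _ [E [B A]]. auto.
Qed.
(** Securing is witnessed by initial segments of length at most [k]. *)
Lemma sec_mono a k k' q : Sec a k q -> k <= k' -> Sec a k' q.
Proof.
  rewrite !sec_iff. intros H I t E B A. rewrite <- E in I.
  destruct (H (init t k)) as [n [In Hn]].
  - apply len_code.
  - now apply init_bin.
  - now apply init_agree.
  - rewrite len_code, lt_S in In. rewrite init_init in Hn by trivial.
    exists n. split; trivial. rewrite lt_S. eapply le_trans; eauto.
Qed.
(** At stage [k] the bar is only consulted below [bnd k]. *)
Lemma sec_agree a b k q : Agree a b -> bnd k <= len b -> Sec a k q -> Sec b k q.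
Proof.
  rewrite !sec_iff. intros A I H t E B Q. destruct (H t E B Q) as [n [In Hn]].
  exists n. split; trivial. apply agree_entry with a; trivial.
  eapply lt_le_trans; [|exact I]. apply init_lt; trivial; [now rewrite <- lt_S|].
  rewrite E. apply le_refl.
Qed.
Lemma ahead_agree a b q i k : Agree a b -> bnd k <= len a -> bnd k <= len b ->
  Ahead a q i k -> Ahead b q i k.
Proof.
  intros A I I' [H1 [H2 H3]]. split; [|split].
  - now apply sec_agree with a.
  - intros X. apply H2. apply sec_agree with b; trivial. now apply agree_sym.
  - intros X. apply H3. apply sec_agree with b; trivial. now apply agree_sym.
Qed.

(** The successor that is secured at the earlier of the two stages is still secured at
    the later one, where it should not be. *)
Lemma ahead_excl a b q k m : Agree a b -> bnd k <= len a -> bnd m <= len b ->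
  Ahead a q 0 k -> Ahead b q 1 m -> False.
Proof.
  intros A I I' [H1 [H2 _]] [H3 [H4 _]]. rewrite monus_diag in H4. rewrite monus_0 in H2.
  destruct (le_or_lt k m) as [C|C].
  - apply H4. apply sec_mono with k; trivial. apply sec_agree with a; trivial.
    eapply le_trans; [|exact I']. now apply bnd_mono.
  - apply lt_le in C. apply H2. apply sec_mono with m; trivial.
    apply sec_agree with b; trivial; [now apply agree_sym|].
    eapply le_trans; [|exact I]. now apply bnd_mono.
Qed.

Lemma live_one q u0 u1 a b : len a = bnd (len u0) -> len b = bnd (len u1) -> Agree a b ->
  entry a u0 <> 0 -> entry b u1 <> 0 ->
  Live a q (cat (sing 0) u0) \/ Live b q (cat (sing 1) u1).
Proof.
  intros Ea Eb A H0 H1. unfold Live. rewrite !tail_cons, !head_cons.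
  apply NNPP. intros X. apply not_or_and in X as [X0 X1].
  assert (Y0 : AheadBy a q 0 (len u0)) by (apply NNPP; tauto).
  assert (Y1 : AheadBy b q 1 (len u1)) by (apply NNPP; tauto).
  destruct Y0 as [k [I0 P0]], Y1 as [m [I1 P1]]. rewrite lt_S in I0, I1.
  apply (ahead_excl a b q k m); trivial.
  - rewrite Ea. now apply bnd_mono.
  - rewrite Eb. now apply bnd_mono.
Qed.

Lemma missP a k q : ~ Sec a k q -> let t := ev M w_miss (NJ M a k) in
  len t = k /\ Bin t /\ ~ Hit a t.
Proof.
  intros H t. apply NNPP. intros X. apply H. intros u I [E [B _]]. apply NNPP. intros NH.
  pose proof (failP (fun M z => bnd (L z))
    (fun M z v => ~ (len v = L z /\ Bin v /\ ~ Hit (K z) v)) M (NJ M a k)) as F.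
  cbv beta zeta in F. repeat rewrite ?ev_K, ?ev_L in F.
  refine (F _ u I _); [|tauto]. intros _. exact X.
Qed.

(** The sequence [w_miss (a,k)] has length [k] and misses the bar.  No sequence [u] that
    agrees with it is [Live]: if [u] is shorter than [k], it is not in the bar, and from
    length [k] on the successor has been ahead. *)
Lemma ahead_dead a b q i k u : Ahead a q i k -> len a = bnd k -> len b = bnd (len u) ->
  Agree a b -> Agree u (ev M w_miss (NJ M a k)) -> ~ Live b q (cat (sing i) u).
Proof.
  intros P Ea Eb A Au [L1 L2]. rewrite tail_cons in L1, L2. rewrite head_cons in L2.
  destruct (missP a k 0) as [Et [Bt Ht]]; [apply P|].
  set (t := ev M w_miss (NJ M a k)) in *.
  destruct (le_or_lt k (len u)) as [C|C].
  - apply L2. exists k. split; [now rewrite lt_S|].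
    apply ahead_agree with a; trivial; [rewrite Ea; apply le_refl|].
    rewrite Eb. now apply bnd_mono.
  - apply Ht. exists (len u). rewrite Et. split; [rewrite lt_S; now apply lt_le|].
    assert (E : init t (len u) = u).
    { rewrite <- (init_len u) at 2. apply init_eq. intros j I. symmetry. apply Au; trivial.
      rewrite Et. eapply lt_trans; eauto. }
    rewrite E. apply agree_entry with b; trivial; [now apply agree_sym|].
    rewrite Ea. rewrite <- E. apply init_lt; trivial; rewrite Et; [now apply lt_le|apply le_refl].
Qed.

Lemma sec_start a t : Bin t -> entry a t <> 0 -> Sec a (len t) t.
Proof.
  intros B H. apply sec_iff. intros u E Bu A.
  assert (u = t) as ->.
  { apply code_ext; trivial. intros i I. apply A; trivial. now rewrite <- E. }
  exists (len t). split; [apply lt_self|]. now rewrite init_len.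
Qed.

Lemma lt_2_cases i : i < 2 -> i = 0 \/ i = 1.
Proof.
  intros H. apply lt_S_cases in H as [H|H]; auto. apply lt_S_cases in H as [H|H]; auto.
  now apply lt_0 in H.
Qed.

(** The chosen successor is secured but not ahead, so either the empty sequence or the
    other successor is secured, and in the latter case [q] is. *)
Lemma sec_step a n q i : i < 2 -> ~ Ahead a q i n -> Sec a n (cat q (sing i)) ->
  Sec a n 0 \/ Sec a n q.
Proof.
  intros I NA H. apply NNPP. intros X. apply not_or_and in X as [X0 Xq]. apply NA.
  split; [|split]; trivial. intros H'. apply Xq.
  assert (H0 : Sec a n (cat q (sing 0)) /\ Sec a n (cat q (sing 1))).
  { apply lt_2_cases in I as [->| ->].
    - rewrite monus_0 in H'. auto.
    - rewrite monus_diag in H'. auto. }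
  clear -H0. destruct H0 as [H0 H1]. rewrite sec_iff in *. intros t E B A.
  assert (Ext : forall j, j < 2 -> (len q < len t -> entry t (len q) = j) -> Agree t (cat q (sing j))).
  { intros j Ij Ej i Ii. rewrite len_cat, len_sing, add_S, add_0. intros Iq.
    apply lt_S_cases in Iq as [Iq| ->].
    - rewrite entry_cat_l; auto.
    - rewrite Ej by trivial. rewrite <- (add_0 (len q)) at 1. rewrite entry_cat_r.
      + now rewrite entry_sing.
      + rewrite len_sing. apply lt_self. }
  destruct (classic (len q < len t)) as [C|C].
  - destruct (lt_2_cases _ (B _ C)) as [D|D].
    + apply H0; trivial. apply Ext; auto. apply (le_S 1 1), le_refl.
    + apply H1; trivial. apply Ext; auto. apply lt_self.
  - apply H0; trivial. apply Ext; [apply (le_S 1 1), le_refl|tauto].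
Qed.

Lemma hitP a t : Hit a t -> let n := ev M w_hit (NJ M a t) in
  n <= len t /\ entry a (init t n) <> 0.
Proof.
  intros [m [I H]] n. rewrite <- lt_S. apply NNPP. intros X. apply H. revert m I H.
  pose proof (failP (fun M z => s (len (L z)))
    (fun M z v => entry (K z) (init (L z) v) = 0) M (NJ M a t)) as F.
  cbv beta zeta in F. repeat rewrite ?ev_K, ?ev_L in F. intros m I _. apply F; trivial.
  intros In. apply NNPP. intros Y. apply X. auto.
Qed.

Lemma sec_hit a t : Sec a (len t) 0 -> Bin t -> let n := ev M w_hit (NJ M a t) in
  n <= len t /\ entry a (init t n) <> 0.
Proof.
  intros H B. apply hitP. rewrite sec_iff in H. apply H; trivial.
  intros i _ I. rewrite len_0 in I. now apply lt_0 in I.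
Qed.

Lemma needP i u : u < ev M c_need (NJ M i u) /\
  forall j, j < len u -> cat (sing i) j < ev M c_need (NJ M i u).
Proof.
  unfold c_need. rewrite !ev_c2, !ev_comp, !ev_K, !ev_L. split.
  - eapply lt_le_trans; [|apply le_add]. apply le_add.
  - intros j I. eapply lt_le_trans; [apply (totalP i _ j I)|]. rewrite add_comm. apply le_add.
Qed.
Lemma need_len i u : len u <= ev M c_need (NJ M i u).
Proof.
  unfold c_need. rewrite !ev_c2, !ev_comp, !ev_L.
  eapply le_trans; [|apply le_add]. rewrite add_comm. apply le_add.
Qed.

Lemma part_entry x i n j : j < n -> entry (part x i n) j = entry x (cat (sing i) j).
Proof.
  intros I. unfold c_part. rewrite entry_code by trivial.
  prv1. reflexivity.
Qed.

Lemma len_part x i n : len (part x i n) = n.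
Proof. apply len_code. Qed.

Lemma meets_intro x i u a : len x = ev M c_need (NJ M i u) -> entry a u <> 0 ->
  (forall j, j < len u -> entry x (cat (sing i) j) = entry u j) -> Meets x i a.
Proof.
  intros Ex Ea H. exists (len u). rewrite lt_S, Ex. split; [apply need_len|].
  split; [apply needP|]. replace (part x i (len u)) with u; trivial.
  apply code_ext; [now rewrite len_part|]. intros j I. now rewrite part_entry, H.
Qed.

(** [a] is the shorter segment of the bar, of the length of [x], and [b] the longer. *)
Lemma meets_hit x i a b t : Meets x i a -> Agree a b -> len a <= len b -> len x <= len t ->
  (forall j, cat (sing i) j < len x -> entry x (cat (sing i) j) = entry t j) -> Hit b t.
Proof.
  intros [n [In [Hp Ha]]] A I I' H. rewrite lt_S in In.
  exists n. split; [rewrite lt_S; eapply le_trans; eauto|].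
  replace (init t n) with (part x i n).
  - apply agree_entry with a; trivial. eapply lt_le_trans; [|exact I]. now apply entry_bound.
  - apply code_ext; rewrite len_part; [now rewrite len_code|].
    intros j J. rewrite part_entry, entry_code, H; auto.
Qed.

Lemma comb_at0 j u w : ev M c_comb (NJ M (cat (sing 0) j) (NJ M u w)) = entry u j.
Proof.
  unfold c_comb. rewrite ifz_0; prv1; [now rewrite tail_cons|apply head_cons].
Qed.
Lemma comb_at1 j u w : ev M c_comb (NJ M (cat (sing 1) j) (NJ M u w)) = entry w j.
Proof.
  unfold c_comb. rewrite ifz_S; prv1; [now rewrite tail_cons|rewrite head_cons; apply S_O].
Qed.
Lemma bin_entry t i : Bin t -> entry t i < 2.
Proof.
  intros B. destruct (le_or_lt (len t) i) as [I|I]; auto. rewrite entry_out by trivial.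
  rewrite monus_SS. apply zero_le.
Qed.
Lemma comb_bin j u w : Bin u -> Bin w -> ev M c_comb (NJ M j (NJ M u w)) < 2.
Proof.
  intros B B'. unfold c_comb.
  match goal with |- ev M (c_ifz ?c ?a ?b) ?z < 2 => destruct (classic (ev M c z = 0)) as [E|E];
    [rewrite (ifz_0 c a b z E)|rewrite (ifz_S c a b z E)] end;
  prv1; now apply bin_entry.
Qed.

(** A segment [x] of the combination of two sequences that miss their bars for [m] steps
    shows nothing, as [length(x) <= x < m]. *)
Lemma comb_miss x m a a' b b' : x < m -> ~ Sec b m 0 -> ~ Sec b' m 0 ->
  Agree a b -> Agree a' b' -> len a = len x -> len a' = len x -> len b = m -> len b' = m ->
  let t := ev M w_miss (NJ M b m) in let t' := ev M w_miss (NJ M b' m) in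
  (forall j, j < len x -> entry x j = ev M c_comb (NJ M j (NJ M t t'))) ->
  ~ (Meets x 0 a \/ Meets x 1 a').
Proof.
  intros I NS NS' A A' La La' Lb Lb' t t' H.
  destruct (missP b m 0 NS) as [E [B N]], (missP b' m 0 NS') as [E' [B' N']].
  fold t in E, B, N. fold t' in E', B', N'.
  assert (X : len x <= m) by (apply lt_le; eapply le_lt_trans; [apply len_le|exact I]).
  intros [Y|Y].
  - apply N, (meets_hit x 0 a b t); trivial; [congruence|congruence|].
    intros j J. rewrite H by trivial. apply comb_at0.
  - apply N', (meets_hit x 1 a' b' t'); trivial; [congruence|congruence|].
    intros j J. rewrite H by trivial. apply comb_at1.
Qed.

Lemma enum_out a q i k : Ahead a q i k ->
  ev M c_enum (NJ M (NJ M (NJ M q i) k) a) = s (NJ M q i).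
Proof.
  intros H. unfold c_enum. rewrite ifz_0.
  - prv1. reflexivity.
  - prv1. now apply aheadP.
Qed.
Lemma enum_in a q i p : ev M c_enum (NJ M p a) = s (NJ M q i) -> Ahead a q i (L p).
Proof.
  unfold c_enum. 
  match goal with |- ev M (c_ifz ?c ?a ?b) ?z = _ -> _ => destruct (classic (ev M c z = 0)) as [E|E];
    [rewrite (ifz_0 c a b z E)|rewrite (ifz_S c a b z E)] end; intros H.
  - revert H E. prv1. intros H E. apply S_injective in H. revert E. rewrite H. prv1.
    apply aheadP.
  - rewrite ev_Zero in H. symmetry in H. now apply S_O in H.
Qed.

(** ** Quantifier-free formulations *)

Lemma agree_of_fail t u : let i := ev M w_agree (NJ M t u) in
  (i < len t -> i < len u -> entry t i = entry u i) -> ev M c_agree (NJ M t u) = 0.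
Proof.
  intros i H. apply agreeP. unfold i, w_agree in H.
  pose proof (failP (fun M z => len (K z))
    (fun M z v => v < len (L z) -> entry (K z) v = entry (L z) v) M (NJ M t u)) as F.
  cbv beta zeta in F. rewrite !ev_K, !ev_L in F. exact (F H).
Qed.
Lemma eq_of_agree t u : len t = len u -> ev M c_agree (NJ M t u) = 0 -> t = u.
Proof.
  intros E A. apply agreeP in A. apply code_ext; trivial. intros i I. apply A; trivial.
  now rewrite <- E.
Qed.
Lemma bin_of_fail t : let i := ev M w_bin t in
  (i < len t -> entry t i < 2) -> ev M c_bin t = 0.
Proof. intros i H. apply binP. exact (failP (fun M z => len z) (fun M z v => entry z v < 2) M t H). Qed.
Lemma bin_bound t : ev M c_bin t = 0 -> t < bnd (len t).
Proof. intros H. apply binary_lt. now apply binP. Qed.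
Lemma pred_len_cons i u : ev M c_pred (len (cat (sing i) u)) = len u.
Proof. now rewrite len_cons, pred_S. Qed.

Lemma qf_live_one q u w a b : len a = bnd (len u) -> len b = bnd (len w) ->
  ev M c_agree (NJ M a b) = 0 -> entry a u <> 0 -> entry b w <> 0 ->
  ev M c_live (NJ M (cat (sing 0) u) (NJ M q a)) <> 0 \/
  ev M c_live (NJ M (cat (sing 1) w) (NJ M q b)) <> 0.
Proof. rewrite !liveP, agreeP. apply live_one. Qed.

Lemma qf_miss_bin a q i k n : ev M c_ahead (NJ M (NJ M (NJ M a q) i) k) = 0 ->
  entry (ev M w_miss (NJ M a k)) n < 2.
Proof. rewrite aheadP. intros [_ [_ H]]. apply bin_entry. now apply missP in H. Qed.

Lemma qf_dead a b q i k u : ev M c_ahead (NJ M (NJ M (NJ M a q) i) k) = 0 ->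
  len a = bnd k -> len b = bnd (len u) -> ev M c_agree (NJ M a b) = 0 ->
  ev M c_agree (NJ M u (ev M w_miss (NJ M a k))) = 0 ->
  ev M c_live (NJ M (cat (sing i) u) (NJ M q b)) <> 0 -> False.
Proof. rewrite aheadP, !agreeP, liveP. apply ahead_dead. Qed.

Lemma qf_enum_in a q i p : ev M c_enum (NJ M p a) = s (NJ M q i) ->
  ev M c_ahead (NJ M (NJ M (NJ M a q) i) (L p)) = 0.
Proof. intros H. now apply aheadP, enum_in. Qed.
Lemma qf_enum_out a q i k : ev M c_ahead (NJ M (NJ M (NJ M a q) i) k) = 0 ->
  ev M c_enum (NJ M (NJ M (NJ M q i) k) a) = s (NJ M q i).
Proof. rewrite aheadP. apply enum_out. Qed.

Lemma qf_sec_start a t n : ev M c_bin t = 0 -> entry a t <> 0 -> len t = n ->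
  ev M c_sec (NJ M (NJ M a n) t) = 0.
Proof. rewrite binP, secP. intros H H' <-. now apply sec_start. Qed.
Lemma qf_sec_step a n q i : i < 2 -> (ev M c_ahead (NJ M (NJ M (NJ M a q) i) n) <> 0) ->
  ev M c_sec (NJ M (NJ M a n) (cat q (sing i))) = 0 ->
  ev M c_sec (NJ M (NJ M a n) 0) = 0 \/ ev M c_sec (NJ M (NJ M a n) q) = 0.
Proof. rewrite !secP, aheadP. apply sec_step. Qed.

Lemma qf_sec_hit a n t : ev M c_sec (NJ M (NJ M a n) 0) = 0 -> len t = n ->
  ev M c_bin t = 0 -> entry a (init t (ev M w_hit (NJ M a t))) <> 0.
Proof. rewrite secP, binP. intros H <- B. now apply sec_hit. Qed.
Lemma qf_sec_hit_le a n t i : ev M c_sec (NJ M (NJ M a n) 0) = 0 -> len t = n ->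
  ev M c_bin t = 0 -> i < ev M w_hit (NJ M a t) ->
  i < len t /\ entry (init t (ev M w_hit (NJ M a t))) i = entry t i.
Proof.
  rewrite secP, binP. intros H <- B I. split.
  - eapply lt_le_trans; [exact I|]. now apply sec_hit.
  - now apply entry_code.
Qed.

Lemma qf_meets i x u a : len x = ev M c_need (NJ M i u) -> entry a u <> 0 ->
  (let j := ev M w_part (NJ M (NJ M x i) u) in j < len u -> entry x (cat (sing i) j) = entry u j) ->
  Meets x i a.
Proof.
  intros H H' F. apply meets_intro with u; trivial.
  pose proof (failP (fun M z => len (L z))
    (fun M z v => entry (K (K z)) (cat (sing (L (K z))) v) = entry (L z) v) M
    (NJ M (NJ M x i) u)) as G.
  cbv beta zeta in G. repeat rewrite ?ev_K, ?ev_L in G. exact (G F).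
Qed.
Lemma qf_meets0 x u a b : len x = ev M c_need (NJ M 0 u) -> entry a u <> 0 ->
  (let j := ev M w_part (NJ M (NJ M x 0) u) in j < len u -> entry x (cat (sing 0) j) = entry u j) ->
  ev M c_meets (NJ M x (NJ M a b)) <> 0.
Proof. rewrite meetsP. intros H H' F. left. now apply qf_meets with u. Qed.
Lemma qf_meets1 x u a b : len x = ev M c_need (NJ M 1 u) -> entry b u <> 0 ->
  (let j := ev M w_part (NJ M (NJ M x 1) u) in j < len u -> entry x (cat (sing 1) j) = entry u j) ->
  ev M c_meets (NJ M x (NJ M a b)) <> 0.
Proof. rewrite meetsP. intros H H' F. right. now apply qf_meets with u. Qed.

Lemma qf_comb_bin a b m j :
  ev M c_sec (NJ M (NJ M a m) 0) <> 0 -> ev M c_sec (NJ M (NJ M b m) 0) <> 0 ->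
  ev M c_comb (NJ M j (NJ M (ev M w_miss (NJ M a m)) (ev M w_miss (NJ M b m)))) < 2.
Proof. rewrite !secP. intros H H'. apply comb_bin; now apply missP in H, H'. Qed.

Lemma qf_comb_miss x m a a' b b' : x < m ->
  ev M c_sec (NJ M (NJ M b m) 0) <> 0 -> ev M c_sec (NJ M (NJ M b' m) 0) <> 0 ->
  ev M c_agree (NJ M a b) = 0 -> ev M c_agree (NJ M a' b') = 0 ->
  len a = len x -> len a' = len x -> len b = m -> len b' = m ->
  (let z := NJ M (ev M w_miss (NJ M b m)) (ev M w_miss (NJ M b' m)) in
   let j := ev M w_comb (NJ M x z) in j < len x -> entry x j = ev M c_comb (NJ M j z)) ->
  ev M c_meets (NJ M x (NJ M a a')) <> 0 -> False.
Proof.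
  rewrite !secP, !agreeP, meetsP. intros I N N' A A' La La' Lb Lb' F.
  apply (comb_miss x m a a' b b'); trivial. cbv zeta.
  set (z := NJ M (ev M w_miss (NJ M b m)) (ev M w_miss (NJ M b' m))) in *.
  pose proof (failP (fun M z => len (K z))
    (fun M z v => entry (K z) v = ev M c_comb (NJ M v (L z))) M (NJ M x z)) as G.
  cbv beta zeta in G. repeat rewrite ?ev_K, ?ev_L in G. exact (G F).
Qed.
Lemma qf_need_part i u j : j < len u -> cat (sing i) j < ev M c_need (NJ M i u).
Proof. apply needP. Qed.
End Facts.
End Arith.

(** * The derivation *)

(** ** The principles in terms of forcing *)

Local Notation lt t u := (eqn (cs c_monus (tJ (St t) u)) tzero).
Local Notation two := (St (St tzero)).
Local Notation len t := (cs c_length t).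
Local Notation entry t u := (cs c_entry (tJ t u)).
Local Notation cons i u := (cs c_cat (tJ (cs c_sing i) u)).
Local Notation snoc u i := (cs c_cat (tJ u (cs c_sing i))).
Local Notation neg P := (imp P bot).
Local Notation nonzero t := (neg (eqn t tzero)).

Definition Cant (c : fterm) : wprop := alln (fun n => lt (tapp c n) two).
Definition Inits (c : fterm) (n u : term) : wprop :=
  wand (eqn (len u) n) (alln (fun i => imp (lt i n) (eqn (entry u i) (tapp c i)))).
Definition Subseq (c : fterm) (i : term) (d : fterm) : wprop :=
  alln (fun m => eqn (tapp d m) (tapp c (cons i m))).
Definition Opens (a c : fterm) : wprop :=
  exn (fun n => exn (fun u => wand (Inits c n u) (nonzero (tapp a u)))).
Definition BarW (B : term -> wprop) : wprop :=
  allf (fun c => imp (Cant c) (exn (fun n => exn (fun u => wand (Inits c n u) (B u))))).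
Definition Enum (a : fterm) (n : term) : wprop := exn (fun p => eqn (tapp a p) (St n)).

Lemma force_FT : force tvar fvar FT =
  allf (fun a => imp (BarW (fun u => nonzero (tapp a u)))
    (exn (fun m => exn (fun b => wand (Inits a m b)
      (BarW (fun u => wand (lt u (len b)) (nonzero (entry b u)))))))).
Proof. reflexivity. Qed.

Lemma force_revAC : force tvar fvar Sigma01_revAC_2_Cantor =
  allf (fun a => imp
    (allf (fun c => imp (Cant c) (exn (fun i => wand (lt i two)
      (exf (fun d => wand (Subseq c i d)
        (exf (fun b => wand (Subseq a i b) (Opens b d)))))))))
    (exn (fun i => wand (lt i two)
      (exf (fun b => wand (Subseq a i b) (allf (fun c => imp (Cant c) (Opens b c)))))))).
Proof. reflexivity. Qed.

Lemma force_AC : force tvar fvar Pi01_AC_omega_2 =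
  allf (fun a => imp
    (alln (fun n => exn (fun m => wand (lt m two) (neg (Enum a (tJ n m))))))
    (exf (fun c => wand (Cant c) (alln (fun n => neg (Enum a (tJ n (tapp c n)))))))).
Proof. reflexivity. Qed.

Lemma AC_omega_2 G : force tvar fvar Pi01_AC_omega_2 G.
Proof. apply force_ax. right; reflexivity. Qed.

(** ** Facts transferred from arithmetical structures *)

(** [import_list (tt, x, ..)] reads the goal, with all hypotheses as premises, as an
    instance of a formula in which the terms [x, ..] are number variables, and applies
    [transfer] to that formula. *)

Ltac reify P :=
  lazymatch P with
  | bot => constr:(Bot)
  | eqn ?a ?b => constr:(EqN a b)
  | imp ?p ?q => let a := reify p in let b := reify q in constr:(Imp a b)
  | wand ?p ?q => let a := reify p in let b := reify q in constr:(And a b)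
  | wor ?p ?q => let a := reify p in let b := reify q in constr:(Or a b)
  end.
Ltac env_of l := lazymatch l with
  | (?l', ?x) => let e := env_of l' in constr:(scons x e)
  | tt => constr:(tvar) end.
Ltac abstract_vars F l n :=
  lazymatch l with
  | tt => F
  | (?l', ?x) =>
    let F1 := eval pattern x in F in
    lazymatch F1 with ?f _ =>
      let F2 := eval cbv beta in (f (tvar n)) in
      abstract_vars F2 l' (S n) end
  end.
Ltac import_list l :=
  repeat match goal with H : ?P ?G |- ?Q ?G =>
    refine (mp P Q G _ H); clear H end;
  match goal with |- ?P ?G =>
    let F := reify P in
    let F' := abstract_vars F l 0 in
    let e := env_of l in
    change (force e fvar F' G) end;
  apply transfer; [reflexivity|];
  let M := fresh "M" in let v := fresh "v" in
  intros M v; cbn [sat teval].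

Lemma t_lt_S i n G : lt i (St n) G -> wor (lt i n) (eqn i n) G.
Proof. intros H. import_list (tt, i, n). apply Arith.lt_S_cases. Qed.
Lemma t_lt_0 i G : lt i tzero G -> bot G.
Proof. intros H. import_list (tt, i). apply Arith.lt_0. Qed.
Lemma t_len_0 G : eqn (len tzero) tzero G.
Proof. import_list tt. apply Arith.len_0. Qed.
Lemma t_len_snoc x y G : eqn (len (snoc x y)) (St (len x)) G.
Proof.
  import_list (tt, x, y). now rewrite Arith.len_cat, Arith.len_sing, Arith.add_S, Arith.add_0.
Qed.
Lemma t_entry_old x y i G : lt i (len x) G -> eqn (entry (snoc x y) i) (entry x i) G.
Proof. intros H. import_list (tt, x, y, i). apply Arith.entry_cat_l. Qed.
Lemma t_entry_new x y G : eqn (entry (snoc x y) (len x)) y G.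
Proof.
  import_list (tt, x, y). intros. generalize (v 0) (v 1). intros a b.
  rewrite <- (Arith.add_0 (ev M c_length b)) at 1.
  rewrite Arith.entry_cat_r, Arith.entry_sing; trivial. rewrite Arith.len_sing. apply Arith.lt_self.
Qed.
Lemma t_agree t u G : let i := cs Arith.w_agree (tJ t u) in
  imp (lt i (len t)) (imp (lt i (len u)) (eqn (entry t i) (entry u i))) G ->
  eqn (cs Arith.c_agree (tJ t u)) tzero G.
Proof. intros i H. subst i. import_list (tt, t, u). apply Arith.agree_of_fail. Qed.
Lemma t_ext t u G : eqn (len t) (len u) G -> eqn (cs Arith.c_agree (tJ t u)) tzero G -> eqn t u G.
Proof. intros H H'. import_list (tt, t, u). apply Arith.eq_of_agree. Qed.
Lemma t_bin t G : let i := cs Arith.w_bin t in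
  imp (lt i (len t)) (lt (entry t i) two) G -> eqn (cs Arith.c_bin t) tzero G.
Proof. intros i H. subst i. import_list (tt, t). apply Arith.bin_of_fail. Qed.
Lemma t_bin_bound t G : eqn (cs Arith.c_bin t) tzero G -> lt t (cs Arith.c_bnd (len t)) G.
Proof. intros H. import_list (tt, t). apply Arith.bin_bound. Qed.
Lemma t_entry_bound a u G : nonzero (entry a u) G -> lt u (len a) G.
Proof. intros H. import_list (tt, a, u). apply Arith.entry_bound. Qed.
Lemma t_lt_2 i G : lt i two G -> wor (eqn i tzero) (eqn i (St tzero)) G.
Proof. intros H. import_list (tt, i). apply Arith.lt_2_cases. Qed.
Lemma t_0_lt_2 G : lt tzero two G.
Proof. import_list tt. apply (Arith.le_S (ev M PSucc (N0 M)) (ev M PSucc (N0 M))), Arith.le_refl. Qed.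
Lemma t_1_lt_2 G : lt (St tzero) two G.
Proof. import_list tt. apply Arith.lt_self. Qed.
Lemma t_pred_len_cons i u G : eqn (cs c_pred (len (cons i u))) (len u) G.
Proof. import_list (tt, i, u). apply Arith.pred_len_cons. Qed.

Local Notation agr t u := (eqn (cs Arith.c_agree (tJ t u)) tzero).
Local Notation bin t := (eqn (cs Arith.c_bin t) tzero).
Local Notation bnd k := (cs Arith.c_bnd k).
Local Notation live q a w := (nonzero (cs Arith.c_live (tJ w (tJ q a)))).
Local Notation ahead a q i k := (eqn (cs Arith.c_ahead (tJ (tJ (tJ a q) i) k)) tzero).
Local Notation sec a k q := (eqn (cs Arith.c_sec (tJ (tJ a k) q)) tzero).
Local Notation miss a k := (cs Arith.w_miss (tJ a k)).
Local Notation hit a t := (cs Arith.w_hit (tJ a t)).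
Local Notation init t n := (cs (c_code c_entry) (tJ t n)).

Lemma t_live_one q u w a b G : eqn (len a) (bnd (len u)) G -> eqn (len b) (bnd (len w)) G ->
  agr a b G -> nonzero (entry a u) G -> nonzero (entry b w) G ->
  wor (live q a (cons tzero u)) (live q b (cons (St tzero) w)) G.
Proof. intros H1 H2 H3 H4 H5. import_list (tt, q, u, w, a, b). apply Arith.qf_live_one. Qed.
Lemma t_miss_bin a q i k n G : ahead a q i k G -> lt (entry (miss a k) n) two G.
Proof. intros H. import_list (tt, a, q, i, k, n). apply Arith.qf_miss_bin. Qed.
Lemma t_dead a b q i k u G : ahead a q i k G -> eqn (len a) (bnd k) G ->
  eqn (len b) (bnd (len u)) G -> agr a b G -> agr u (miss a k) G ->
  live q b (cons i u) G -> bot G.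
Proof. intros H1 H2 H3 H4 H5 H6. import_list (tt, a, b, q, i, k, u). apply Arith.qf_dead. Qed.
Lemma t_enum_in a q i p G : eqn (cs Arith.c_enum (tJ p a)) (St (tJ q i)) G ->
  ahead a q i (cs PL p) G.
Proof. intros H. import_list (tt, a, q, i, p). apply Arith.qf_enum_in. Qed.
Lemma t_enum_out a q i k G : ahead a q i k G ->
  eqn (cs Arith.c_enum (tJ (tJ (tJ q i) k) a)) (St (tJ q i)) G.
Proof. intros H. import_list (tt, a, q, i, k). apply Arith.qf_enum_out. Qed.
Lemma t_sec_start a t n G : bin t G -> nonzero (entry a t) G -> eqn (len t) n G -> sec a n t G.
Proof. intros H1 H2 H3. import_list (tt, a, t, n). apply Arith.qf_sec_start. Qed.
Lemma t_sec_step a n q i G : lt i two G -> neg (ahead a q i n) G -> sec a n (snoc q i) G ->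
  wor (sec a n tzero) (sec a n q) G.
Proof. intros H1 H2 H3. import_list (tt, a, n, q, i). apply Arith.qf_sec_step. Qed.
Lemma t_sec_hit a n t G : sec a n tzero G -> eqn (len t) n G -> bin t G ->
  nonzero (entry a (init t (hit a t))) G.
Proof. intros H1 H2 H3. import_list (tt, a, n, t). apply Arith.qf_sec_hit. Qed.
Lemma t_sec_hit_le a n t i G : sec a n tzero G -> eqn (len t) n G -> bin t G ->
  lt i (hit a t) G ->
  wand (lt i (len t)) (eqn (entry (init t (hit a t)) i) (entry t i)) G.
Proof. intros H1 H2 H3 H4. import_list (tt, a, n, t, i). apply Arith.qf_sec_hit_le. Qed.
Lemma t_len_init t n G : eqn (len (init t n)) n G.
Proof. import_list (tt, t, n). apply Arith.len_code. Qed.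
Lemma t_need_lt i u G : lt u (cs Arith.c_need (tJ i u)) G.
Proof. import_list (tt, i, u). apply Arith.needP. Qed.
Lemma t_need_part i u j G : lt j (len u) G -> lt (cons i j) (cs Arith.c_need (tJ i u)) G.
Proof. intros H. import_list (tt, i, u, j). apply Arith.qf_need_part. Qed.
Lemma t_meets0 x u a b G : eqn (len x) (cs Arith.c_need (tJ tzero u)) G ->
  nonzero (entry a u) G ->
  (let j := cs Arith.w_part (tJ (tJ x tzero) u) in
   imp (lt j (len u)) (eqn (entry x (cons tzero j)) (entry u j))) G ->
  nonzero (cs Arith.c_meets (tJ x (tJ a b))) G.
Proof. cbv zeta. intros H1 H2 H3. import_list (tt, x, u, a, b). apply Arith.qf_meets0. Qed.
Lemma t_meets1 x u a b G : eqn (len x) (cs Arith.c_need (tJ (St tzero) u)) G ->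
  nonzero (entry b u) G ->
  (let j := cs Arith.w_part (tJ (tJ x (St tzero)) u) in
   imp (lt j (len u)) (eqn (entry x (cons (St tzero) j)) (entry u j))) G ->
  nonzero (cs Arith.c_meets (tJ x (tJ a b))) G.
Proof. cbv zeta. intros H1 H2 H3. import_list (tt, x, u, a, b). apply Arith.qf_meets1. Qed.
Lemma t_comb_bin a b m j G : neg (sec a m tzero) G -> neg (sec b m tzero) G ->
  lt (cs Arith.c_comb (tJ j (tJ (miss a m) (miss b m)))) two G.
Proof. intros H1 H2. import_list (tt, a, b, m, j). apply Arith.qf_comb_bin. Qed.
Lemma t_comb_miss x m a a' b b' G : lt x m G ->
  neg (sec b m tzero) G -> neg (sec b' m tzero) G -> agr a b G -> agr a' b' G ->
  eqn (len a) (len x) G -> eqn (len a') (len x) G -> eqn (len b) m G -> eqn (len b') m G ->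
  (let z := tJ (miss b m) (miss b' m) in let j := cs Arith.w_comb (tJ x z) in
   imp (lt j (len x)) (eqn (entry x j) (cs Arith.c_comb (tJ j z)))) G ->
  nonzero (cs Arith.c_meets (tJ x (tJ a a'))) G -> bot G.
Proof.
  cbv zeta. intros H1 H2 H3 H4 H5 H6 H7 H8 H9 H10 H11.
  import_list (tt, x, m, a, a', b, b'). apply Arith.qf_comb_miss.
Qed.

(** ** Functions *)

Lemma fun_comp f g G :
  exf (fun h => alln (fun n => eqn (tapp h n) (tapp f (tapp g n)))) G.
Proof. exact (force_ax (close ax_comp) tvar fvar G (or_introl BIM_ax_comp) f g). Qed.
Lemma fun_pair f g G :
  exf (fun h => alln (fun n => eqn (tapp h n) (tJ (tapp f n) (tapp g n)))) G.
Proof. exact (force_ax (close ax_pair) tvar fvar G (or_introl BIM_ax_pair) f g). Qed.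
Lemma fun_rec f g G : exf (fun h => alln (fun m => alln (fun n =>
  wand (eqn (tapp h (tJ m tzero)) (tapp f m))
       (eqn (tapp h (tJ m (St n))) (tapp g (tJ (tJ m n) (tapp h (tJ m n)))))))) G.
Proof. exact (force_ax (close ax_rec) tvar fvar G (or_introl BIM_ax_rec) f g). Qed.

(** The theory has no comprehension: a function exists only if its values are obtained by
    composing and pairing functions and numbers.  Resolution does this for a given [X]. *)
Class Graph (X : term -> term) :=
  graph : forall G, exf (fun h => alln (fun n => eqn (tapp h n) (X n))) G.

#[export] Instance Graph_id : Graph (fun n => n) | 0.
Proof. intros G. apply (exf_intro _ (fcst PId)); [apply _|]. intros n. apply e_Id. Qed.

#[export] Instance Graph_app f X : Graph X -> Graph (fun n => tapp f (X n)) | 1.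
Proof.
  intros HX G. wopen (HX _) as [g Hg]. wopen (fun_comp f g _) as [h Hh].
  apply (exf_intro _ h); [apply _|]. intros n. erw (Hh n). erw (Hg n).
Qed.
#[export] Instance Graph_app1 f : Graph (tapp f) | 0 := Graph_app f _ Graph_id.

#[export] Instance Graph_J X Y : Graph X -> Graph Y -> Graph (fun n => tJ (X n) (Y n)) | 1.
Proof.
  intros HX HY G. wopen (HX _) as [g Hg]. wopen (HY _) as [k Hk].
  wopen (fun_pair g k _) as [h Hh].
  apply (exf_intro _ h); [apply _|]. intros n. erw (Hh n). erw (Hg n). erw (Hk n).
Qed.

#[export] Instance Graph_const t : Graph (fun _ => t) | 0.
Proof.
  intros G. revert t.
  apply (force_ind (ExF (AllN (EqN (tapp (fvar 0) (tvar 0)) (tvar 1)))) tvar fvar).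
  - apply (exf_intro _ (fcst PZero)); [apply _|]. intros n. apply e_Zero.
  - intros G' _ t H. cbn [force tsubst scons fsubst] in *.
    wopen H as [g Hg]. wopen (fun_comp (fcst PSucc) g _) as [h Hh].
    apply (exf_intro _ h); [apply _|]. intros n. erw (Hh n). erw (Hg n).
Qed.
#[export] Instance Graph_J1 t : Graph (tJ t) | 0 := Graph_J _ _ (Graph_const t) Graph_id.

Lemma lt_eqn_r i n m G : lt i n G -> eqn n m G -> lt i m G.
Proof. intros H E. erw <- E. exact H. Qed.

(** Course-of-values recursion.  With [g] ignoring one of its arguments this gives both the
    initial segments of a function and the path described by a choice of successors. *)
Lemma history g G : exf (fun h =>
  wand (eqn (tapp h tzero) tzero)
  (wand (alln (fun n => eqn (tapp h (St n)) (snoc (tapp h n) (tapp g (tJ n (tapp h n))))))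
  (wand (alln (fun n => eqn (len (tapp h n)) n))
     (alln (fun n => alln (fun i => imp (lt i n)
       (eqn (entry (tapp h n) i) (tapp g (tJ i (tapp h i)))))))))) G.
Proof.
  wopen (graph (X := fun z => snoc (cs PL z) (tapp g (tJ (cs PL (cs PK z)) (cs PL z)))) _)
    as [b Hb].
  wopen (fun_rec (fcst PZero) b _) as [c Hc].
  wopen (graph (X := fun n => tapp c (tJ tzero n)) _) as [h Hh].
  apply (exf_intro _ h); [apply _|].
  wassert H0 : (eqn (tapp h tzero) tzero).
  { erw (Hh tzero). erw (proj1 (Hc tzero tzero)). apply e_Zero. }
  wassert HS : (alln (fun n => eqn (tapp h (St n)) (snoc (tapp h n) (tapp g (tJ n (tapp h n)))))).
  { intros n. erw (Hh (St n)). erw (proj2 (Hc tzero n)).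
    erw (Hb (tJ (tJ tzero n) (tapp c (tJ tzero n)))). erw e_L. erw e_K. erw e_L. erw (Hh n). }
  wassert HL : (alln (fun n => eqn (len (tapp h n)) n)).
  { intros n. revert n.
    apply (force_ind (EqN (len (tapp (fvar 0) (tvar 0))) (tvar 0)) tvar (scons h fvar)).
    - cbn [force tsubst scons fsubst]. erw H0. apply t_len_0.
    - intros G1 I n IH. cbn [force tsubst scons fsubst] in *.
      apply (good_mono _ _ I) in HS. clear H0 Hh I.
      erw (HS n). erw (t_len_snoc (tapp h n) (tapp g (tJ n (tapp h n))) G1). erw IH. }
  split; [exact H0|]. split; [exact HS|]. split; [exact HL|].
  intros n. revert n.
  apply (force_ind (AllN (Imp (EqN (cs c_monus (tJ (St (tvar 0)) (tvar 1))) tzero)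
     (EqN (entry (tapp (fvar 0) (tvar 1)) (tvar 0))
          (tapp (fvar 1) (tJ (tvar 0) (tapp (fvar 0) (tvar 0)))))))
     tvar (scons h (scons g fvar))); cbn [force tsubst scons fsubst].
  - intros i. wintro H. apply bot_elim; [apply _|]. exact (t_lt_0 _ _ H).
  - intros G1 I n IH i. apply (good_mono _ _ I) in HS. apply (good_mono _ _ I) in HL.
    clear H0 Hh I. wintro H. set (y := tapp g (tJ n (tapp h n))).
    erw (HS n). fold y. wopen (t_lt_S i n _ H) as [C|C].
    + erw (t_entry_old (tapp h n) y i _ (lt_eqn_r _ _ _ _ C (eqn_sym _ _ _ (HL n)))).
      exact (mp _ _ _ (IH i) C).
    + erw C. eapply eqn_trans; [|exact (t_entry_new (tapp h n) y _)]. erw (HL n).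
Qed.

(** ** Initial segments *)

Lemma course c G : exf (fun e => alln (fun n => Inits c n (tapp e n))) G.
Proof.
  wopen (graph (X := fun z => tapp c (cs PK z)) _) as [g Hg].
  wopen (history g _) as [h [_ [_ [HL HE]]]].
  apply (exf_intro _ h); [apply _|]. intros n. split; [exact (HL n)|].
  intros i. wintro H. erw (mp _ _ _ (HE n i) H). erw (Hg (tJ i (tapp h i))). erw e_K.
Qed.

Lemma inits_entry c n u i G : Inits c n u G -> lt i n G -> eqn (entry u i) (tapp c i) G.
Proof. intros [_ H] I. exact (mp _ _ _ (H i) I). Qed.
Lemma inits_agree c n m t u G : Inits c n t G -> Inits c m u G -> agr t u G.
Proof.
  intros H K. apply t_agree. wintro I. wintro J.
  erw (inits_entry c n t _ _ H (lt_eqn_r _ _ _ _ I (proj1 H))). apply eqn_sym.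
  exact (inits_entry c m u _ _ K (lt_eqn_r _ _ _ _ J (proj1 K))).
Qed.
Lemma inits_eq c n t u G : Inits c n t G -> Inits c n u G -> eqn t u G.
Proof.
  intros H K. apply t_ext; [|exact (inits_agree c n n t u G H K)].
  erw (proj1 H). apply eqn_sym, K.
Qed.
Lemma inits_bin c n t G : Cant c G -> Inits c n t G -> bin t G.
Proof.
  intros C H. apply t_bin. wintro I.
  erw (inits_entry c n t _ _ H (lt_eqn_r _ _ _ _ I (proj1 H))). apply C.
Qed.
Lemma nonzero_eqn t u G : eqn t u G -> nonzero t G -> nonzero u G.
Proof. intros E H. wintro Z. apply (mp _ _ _ H). erw E. exact Z. Qed.

(** Opening [sec] for a function of Cantor space by means of its segment of length [n]. *)
Lemma sec_meets a n c G : sec a n tzero G -> Cant c G ->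
  exn (fun m => exn (fun u => wand (Inits c m u)
    (wand (lt u (len a)) (nonzero (entry a u))))) G.
Proof.
  intros S0 Cc. wopen (course c _) as [ec Hc]. set (v := tapp ec n).
  pose proof (inits_bin _ _ _ _ Cc (Hc n)) as Bv. fold v in Bv.
  pose proof (t_sec_hit a n v _ S0 (proj1 (Hc n)) Bv) as Hit.
  apply (exn_intro _ (hit a v)); [apply _|].
  apply (exn_intro _ (init v (hit a v))); [apply _|].
  split; [split|split]; trivial.
  - apply t_len_init.
  - intros i. wintro I.
    destruct (t_sec_hit_le a n v i _ S0 (proj1 (Hc n)) Bv I) as [I' E]. erw E.
    exact (inits_entry _ _ _ _ _ (Hc n) (lt_eqn_r _ _ _ _ I' (proj1 (Hc n)))).
  - exact (t_entry_bound _ _ _ Hit).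
Qed.

(** ** From the contraposed choice principle to the fan theorem *)

(** In the proof, [e] enumerates initial segments of the bar [al], [ep] the pairs [(q,i)]
    such that the [i]-th successor of [q] is ahead at some stage, and [be] gives the two
    bars belonging to [q].  [h] is the path that [ga] describes, [de] the sequence of its
    choices. *)
Lemma revAC_FT G : force tvar fvar Sigma01_revAC_2_Cantor G -> force tvar fvar FT G.
Proof.
  rewrite force_revAC, force_FT. intros R al. wintro HB.
  wopen (course al _) as [e He].
  assert (Hent : forall u G, bin u G -> alln (fun n => Inits al n (tapp e n)) G ->
    eqn (entry (tapp e (bnd (len u))) u) (tapp al u) G).
  { intros u G' B H. exact (inits_entry _ _ _ _ _ (H _) (t_bin_bound u _ B)). }
  wopen (graph (X := fun p => cs Arith.c_enum (tJ p (tapp e (bnd (cs PL p))))) _) as [ep Hep].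
  wassert Key : (alln (fun q => exn (fun i => wand (lt i two) (neg (Enum ep (tJ q i)))))).
  { intros q.
    wopen (graph (X := fun w => cs Arith.c_live
      (tJ w (tJ q (tapp e (bnd (cs c_pred (len w))))))) _) as [be Hbe].
    assert (Hbe' : forall i u G, alln (fun w => eqn (tapp be w) (cs Arith.c_live
        (tJ w (tJ q (tapp e (bnd (cs c_pred (len w)))))))) G ->
      eqn (tapp be (cons i u))
        (cs Arith.c_live (tJ (cons i u) (tJ q (tapp e (bnd (len u)))))) G).
    { intros i u G' H. erw (H (cons i u)). erw (t_pred_len_cons i u G'). }
    specialize (R be).
    refine (cl_bind _ _ _ _ (mp _ _ _ R _) _).
    - clear R. intros c. wintro Cc.
      wopen (graph (X := fun m => tapp c (cons tzero m)) _) as [c0 H0].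
      wopen (graph (X := fun m => tapp c (cons (St tzero) m)) _) as [c1 H1].
      assert (C0 : forall G, Cant c G -> Subseq c tzero c0 G -> Cant c0 G).
      { intros G' C H n. erw (H n). apply C. }
      assert (C1 : forall G, Cant c G -> Subseq c (St tzero) c1 G -> Cant c1 G).
      { intros G' C H n. erw (H n). apply C. }
      wopen (mp _ _ _ (HB c0) (C0 _ Cc H0)) as [n0 X]. wopen X as [u0 [I0 P0]].
      wopen (mp _ _ _ (HB c1) (C1 _ Cc H1)) as [n1 X]. wopen X as [u1 [I1 P1]].
      wopen (t_live_one q u0 u1 (tapp e (bnd (len u0))) (tapp e (bnd (len u1))) _
        (proj1 (He _)) (proj1 (He _)) (inits_agree _ _ _ _ _ _ (He _) (He _))
        (nonzero_eqn _ _ _ (eqn_sym _ _ _ (Hent u0 _ (inits_bin _ _ _ _ (C0 _ Cc H0) I0) He)) P0)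
        (nonzero_eqn _ _ _ (eqn_sym _ _ _ (Hent u1 _ (inits_bin _ _ _ _ (C1 _ Cc H1) I1) He)) P1))
        as [Lv|Lv].
      + apply (exn_intro _ tzero); [apply _|]. split; [apply t_0_lt_2|].
        apply (exf_intro _ c0); [apply _|]. split; [exact H0|].
        wopen (graph (X := fun m => tapp be (cons tzero m)) _) as [b Hb].
        apply (exf_intro _ b); [apply _|]. split; [exact Hb|].
        apply (exn_intro _ n0); [apply _|]. apply (exn_intro _ u0); [apply _|].
        split; [exact I0|]. apply (nonzero_eqn _ _ _ (eqn_sym _ _ _ (Hb u0))).
        exact (nonzero_eqn _ _ _ (eqn_sym _ _ _ (Hbe' _ _ _ Hbe)) Lv).
      + apply (exn_intro _ (St tzero)); [apply _|]. split; [apply t_1_lt_2|].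
        apply (exf_intro _ c1); [apply _|]. split; [exact H1|].
        wopen (graph (X := fun m => tapp be (cons (St tzero) m)) _) as [b Hb].
        apply (exf_intro _ b); [apply _|]. split; [exact Hb|].
        apply (exn_intro _ n1); [apply _|]. apply (exn_intro _ u1); [apply _|].
        split; [exact I1|]. apply (nonzero_eqn _ _ _ (eqn_sym _ _ _ (Hb u1))).
        exact (nonzero_eqn _ _ _ (eqn_sym _ _ _ (Hbe' _ _ _ Hbe)) Lv).
    - wnext. intros [i [Hi X]]. wopen X as [b [Hb Hall]].
      apply (exn_intro _ i); [apply _|]. split; [exact Hi|].
      wintro En. wopen En as [p Hp].
      set (k := cs PL p). set (a := tapp e (bnd k)).
      wassert A : (ahead a q i k).
      { apply t_enum_in. unfold a, k. erw <- (Hep p). exact Hp. }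
      wopen (graph (X := fun n => entry (miss a k) n) _) as [d Hd].
      wassert Cd : (Cant d).
      { intros n. erw (Hd n). exact (t_miss_bin a q i k n _ A). }
      wopen (mp _ _ _ (Hall d) Cd) as [n X]. wopen X as [u [Iu Pu]].
      apply (t_dead a (tapp e (bnd (len u))) q i k u _ A).
      + apply (proj1 (He _)).
      + apply (proj1 (He _)).
      + exact (inits_agree _ _ _ _ _ _ (He _) (He _)).
      + apply t_agree. wintro J. wintro _'.
        erw (inits_entry _ _ _ _ _ Iu (lt_eqn_r _ _ _ _ J (proj1 Iu))). apply Hd.
      + apply (nonzero_eqn _ _ _ (Hbe' i u _ Hbe)).
        exact (nonzero_eqn _ _ _ (Hb u) Pu). }
  clear R.
  match goal with |- ?P ?G => pose proof (AC_omega_2 G) as AC end. rewrite force_AC in AC.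
  wopen (mp _ _ _ (AC ep) Key) as [ga [Cga Hga]]. clear Key.
  wopen (graph (X := fun z => tapp ga (cs PL z)) _) as [g Hg].
  wopen (history g _) as [h [h0 [hS [hL hE]]]].
  assert (Hgh : forall i G, alln (fun z => eqn (tapp g z) (tapp ga (cs PL z))) G ->
     eqn (tapp g (tJ i (tapp h i))) (tapp ga (tapp h i)) G).
  { intros i G' H. erw (H (tJ i (tapp h i))). erw e_L. }
  wopen (graph (X := fun n => tapp ga (tapp h n)) _) as [de Hde].
  wassert Ide : (alln (fun n => Inits de n (tapp h n))).
  { intros n. split; [exact (hL n)|]. intros i. wintro H.
    erw (mp _ _ _ (hE n i) H). erw (Hgh i _ Hg). apply eqn_sym, Hde. }
  wassert Cde : (Cant de).
  { intros n. erw (Hde n). apply Cga. }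
  wopen (mp _ _ _ (HB de) Cde) as [n X]. wopen X as [t [It Pt]].
  set (a := tapp e (bnd n)).
  wassert Sn : (sec a n (tapp h n)).
  { pose proof (inits_bin _ _ _ _ Cde It) as Bt.
    erw <- (inits_eq _ _ _ _ _ It (Ide n)). apply t_sec_start; [exact Bt| |apply It].
    refine (nonzero_eqn _ _ _ (eqn_sym _ _ _ _) Pt).
    unfold a. erw <- (proj1 It). exact (Hent t _ Bt He). }
  wassert S0 : (sec a n tzero).
  { (* induction on the length [j] of a segment of the path, at the fixed stage [n] *)
    refine (mp _ _ _ _ Sn). clear Sn HB It Pt Ide Cde Hde. generalize n at 2 as j.
    apply (force_ind
      (Imp (EqN (cs Arith.c_sec (tJ (tJ (tvar 1) (tvar 2)) (tapp (fvar 0) (tvar 0)))) tzero)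
           (EqN (cs Arith.c_sec (tJ (tJ (tvar 1) (tvar 2)) tzero)) tzero))
      (scons a (scons n tvar)) (scons h fvar)); cbn [force tsubst scons fsubst].
    - wintro H. refine (eqn_trans _ _ _ _ (eqn_sym _ _ _ _) H). erw h0.
    - wnext. intros j IH. wintro H. set (y := tapp ga (tapp h j)).
      wassert H' : (sec a n (snoc (tapp h j) y)).
      { refine (eqn_trans _ _ _ _ (eqn_sym _ _ _ _) H). erw (hS j). erw (Hgh j _ Hg). }
      wassert NA : (neg (ahead a (tapp h j) y n)).
      { wintro A. apply (mp _ _ _ (Hga (tapp h j))).
        apply (exn_intro _ (tJ (tJ (tapp h j) y) n)); [apply _|].
        erw (Hep (tJ (tJ (tapp h j) y) n)). erw (e_L (tJ (tapp h j) y) n).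
        exact (t_enum_out a (tapp h j) y n _ A). }
      wopen (t_sec_step a n (tapp h j) y _ (Cga _) NA H') as [S|S]; [exact S|].
      exact (mp _ _ _ IH S). }
  apply (exn_intro _ (bnd n)); [apply _|]. apply (exn_intro _ a); [apply _|].
  split; [apply He|]. intros c. wintro Cc. exact (sec_meets a n c _ S0 Cc).
Qed.

(** ** From the fan theorem to the contraposed choice principle *)

(** The premises of [t_meets0] and [t_meets1], for the segment of [c] of length
    [need(k,u)].  The index [i] is only known to be equal to [k]. *)
Lemma need_shows c ec d n u i k al al' e b G :
  eqn i k G -> Subseq c i d G -> Inits d n u G -> alln (fun m => Inits c m (tapp ec m)) G ->
  Subseq al i b G -> Subseq al k al' G -> alln (fun m => Inits al' m (tapp e m)) G ->
  nonzero (tapp b u) G ->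
  let x := tapp ec (cs Arith.c_need (tJ k u)) in
  wand (nonzero (entry (tapp e (len x)) u))
    (alln (fun j => imp (lt j (len u)) (eqn (entry x (cons k j)) (entry u j)))) G.
Proof.
  intros Ei Hd Iu Hc Hb Hal He Pu x. split.
  - refine (nonzero_eqn _ _ _ _ Pu). apply eqn_sym.
    erw (inits_entry _ _ _ u _ (He (len x))
      (lt_eqn_r _ _ _ _ (t_need_lt k u _) (eqn_sym _ _ _ (proj1 (Hc _))))).
    erw (Hal u). erw (Hb u). erw Ei.
  - intros j. wintro J. unfold x.
    erw (inits_entry _ _ _ _ _ (Hc (cs Arith.c_need (tJ k u))) (t_need_part k u j _ J)).
    erw (inits_entry _ _ _ _ _ Iu (lt_eqn_r _ _ _ _ J (proj1 Iu))).
    erw (Hd j). erw Ei.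
Qed.

Lemma sec_opens e a m G : alln (fun n => Inits a n (tapp e n)) G -> sec (tapp e m) m tzero G ->
  allf (fun c => imp (Cant c) (Opens a c)) G.
Proof.
  intros He S c. wintro Cc. wopen (sec_meets _ _ c _ S Cc) as [n X]. wopen X as [u [Iu [Lu Pu]]].
  apply (exn_intro _ n); [apply _|]. apply (exn_intro _ u); [apply _|]. split; [exact Iu|].
  refine (nonzero_eqn _ _ _ _ Pu).
  exact (inits_entry _ _ _ _ _ (He m) (lt_eqn_r _ _ _ _ Lu (proj1 (He m)))).
Qed.

Lemma FT_revAC G : force tvar fvar FT G -> force tvar fvar Sigma01_revAC_2_Cantor G.
Proof.
  rewrite force_revAC, force_FT. intros F al. wintro HA.
  wopen (graph (X := fun m => tapp al (cons tzero m)) _) as [a0 H0].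
  wopen (graph (X := fun m => tapp al (cons (St tzero) m)) _) as [a1 H1].
  wopen (course a0 _) as [e0 He0]. wopen (course a1 _) as [e1 He1].
  wopen (graph (X := fun x => cs Arith.c_meets
    (tJ x (tJ (tapp e0 (len x)) (tapp e1 (len x))))) _) as [be Hbe].
  refine (cl_bind _ _ _ _ (mp _ _ _ (F be) _) _).
  - clear F. intros c. wintro Cc.
    wopen (mp _ _ _ (HA c) Cc) as [i [Hi X]]. wopen X as [d [Hd X]]. wopen X as [b [Hb X]].
    wopen X as [n X]. wopen X as [u [Iu Pu]]. wopen (course c _) as [ec Hc].
    wopen (t_lt_2 i _ Hi) as [E|E].
    + set (x := tapp ec (cs Arith.c_need (tJ tzero u))).
      apply (exn_intro _ (cs Arith.c_need (tJ tzero u))); [apply _|].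
      apply (exn_intro _ x); [apply _|]. split; [apply Hc|].
      destruct (need_shows c ec d n u i tzero al a0 e0 b _ E Hd Iu Hc Hb H0 He0 Pu) as [P Q].
      apply (nonzero_eqn _ _ _ (eqn_sym _ _ _ (Hbe x))).
      exact (t_meets0 x u _ _ _ (proj1 (Hc _)) P (Q _)).
    + set (x := tapp ec (cs Arith.c_need (tJ (St tzero) u))).
      apply (exn_intro _ (cs Arith.c_need (tJ (St tzero) u))); [apply _|].
      apply (exn_intro _ x); [apply _|]. split; [apply Hc|].
      destruct (need_shows c ec d n u i (St tzero) al a1 e1 b _ E Hd Iu Hc Hb H1 He1 Pu)
        as [P Q].
      apply (nonzero_eqn _ _ _ (eqn_sym _ _ _ (Hbe x))).
      exact (t_meets1 x u _ _ _ (proj1 (Hc _)) P (Q _)).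
  - wnext. intros [m X]. wopen X as [bb [Ib HB]]. clear F HA.
    wopen (eqn_dec (cs Arith.c_sec (tJ (tJ (tapp e0 m) m) tzero)) tzero _) as [S|S0].
    { apply (exn_intro _ tzero); [apply _|]. split; [apply t_0_lt_2|].
      apply (exf_intro _ a0); [apply _|]. split; [exact H0|]. exact (sec_opens _ _ _ _ He0 S). }
    wopen (eqn_dec (cs Arith.c_sec (tJ (tJ (tapp e1 m) m) tzero)) tzero _) as [S|S1].
    { apply (exn_intro _ (St tzero)); [apply _|]. split; [apply t_1_lt_2|].
      apply (exf_intro _ a1); [apply _|]. split; [exact H1|]. exact (sec_opens _ _ _ _ He1 S). }
    apply bot_elim; [apply _|].
    set (z := tJ (miss (tapp e0 m) m) (miss (tapp e1 m) m)).
    wopen (graph (X := fun n => cs Arith.c_comb (tJ n z)) _) as [ga Hga].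
    wassert C : (Cant ga).
    { intros n. erw (Hga n). exact (t_comb_bin _ _ _ n _ S0 S1). }
    wopen (mp _ _ _ (HB ga) C) as [n X]. wopen X as [x [Ix [Lx Px]]].
    pose proof (lt_eqn_r _ _ _ _ Lx (proj1 Ib)) as Lm.
    apply (t_comb_miss x m (tapp e0 (len x)) (tapp e1 (len x)) (tapp e0 m) (tapp e1 m) _ Lm S0 S1).
    + exact (inits_agree _ _ _ _ _ _ (He0 _) (He0 _)).
    + exact (inits_agree _ _ _ _ _ _ (He1 _) (He1 _)).
    + apply (proj1 (He0 _)).
    + apply (proj1 (He1 _)).
    + apply (proj1 (He0 _)).
    + apply (proj1 (He1 _)).
    + cbv zeta. fold z. wintro J.
      erw (inits_entry _ _ _ _ _ Ix (lt_eqn_r _ _ _ _ J (proj1 Ix))). apply Hga.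
    + apply (nonzero_eqn _ _ _ (Hbe x)).
      exact (nonzero_eqn _ _ _ (inits_entry _ _ _ _ _ Ib Lm) Px).
Qed.

Theorem theorem8p2 :
  derivable BIM_Pi01_AC (Iff Sigma01_revAC_2_Cantor FT).
Proof.
  apply force_id. split; intros G _.
  - apply revAC_FT.
  - apply FT_revAC.
Qed.
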